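(* Let $(X,\omega)$ be a $2n$-dimensional symplectic manifold, let $\boldsymbol{H}\colon X\to\mathbb{R}^n$ be an integrable Hamiltonian system and let $\sigma\colon B\to X$ be a local section of $\boldsymbol{H}$. For each $\boldsymbol{b}\in B$, the orbit $\Omega(\sigma(\boldsymbol{b}))$ of the $\mathbb{R}^n$-action generated by $\boldsymbol{H}$ is diffeomorphic to $\left(\mathbb{R}^k/\mathbb{Z}^k\right)\times\mathbb{R}^{n-k}$ for some $k$. In particular, if $\Omega(\sigma(\boldsymbol{b}))$ is compact then it is a torus.
   Context: For a smooth function $H$ on a symplectic manifold $(X,\omega)$, the Hamiltonian vector field $V_H$ is defined by $\iota_{V_H}\omega=-dH$, its flow is $\phi^H_t$, and $\{F,G\}:=\omega(V_F,V_G)$. An integrable Hamiltonian system on a $2n$-dimensional symplectic manifold $(X,\omega)$ is a smooth map $\boldsymbol{H}=(H_1,\dots,H_n)\colon X\to\mathbb{R}^n$ such that $\{H_i,H_j\}=0$ for all $i,j$, the image $\boldsymbol{H}(X)$ contains a dense open set of regular values, $\boldsymbol{H}$ is proper, and $\boldsymbol{H}$ has connected fibres. The flows $\phi^{H_i}_t$ then exist for all time and commute, so $\phi^{\boldsymbol{H}}_{\boldsymbol{t}}:=\phi^{H_1}_{t_1}\cdots\phi^{H_n}_{t_n}$ defines an action of $\mathbb{R}^n$ on $X$; $\Omega(x)$ denotes the orbit of $x$. A local section over an open set $B\subset\mathbb{R}^n$ with $B\subset\boldsymbol{H}(X)$ is a smooth map $\sigma\colon B\to X$ with $\boldsymbol{H}\circ\sigma=\mathrm{id}$.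 *)

(* Defs.v *)
From HB Require Import structures.
From mathcomp Require Import all_boot all_order all_algebra.
From mathcomp Require Import all_classical all_reals all_analysis.
From mathcomp Require Import ring lra.

Set Implicit Arguments.
Unset Strict Implicit.
Unset Printing Implicit Defensive.

Import Order.TTheory GRing.Theory Num.Theory.
Import numFieldNormedType.Exports.

Local Open Scope classical_set_scope.
Local Open Scope ring_scope.

Section SmoothFunctions.
Context {R : realType} {m : nat}.
Implicit Types (U : set 'rV[R]_m) (f : 'rV[R]_m -> R).

Fixpoint Ck (k : nat) U f : Prop :=
  {in U, continuous f} /\
  if k is k'.+1 then
    forall v : 'rV[R]_m,
      {in U, forall x, derivable f x v} /\ Ck k' U (fun x => 'D_v f x)
  else True.

(* Existence and continuity on U of all iterated directional derivatives; only
   meant for open U. *)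
Definition Cinfty U f := forall k, Ck k U f.

End SmoothFunctions.

(* The atlas need not be maximal.  The values of cmap outside cdom, and of cinv outside cimg,
   are irrelevant. *)
Record smoothManifold (R : realType) (m : nat) := SmoothManifold {
  carrier :> topologicalType;
  chart : Type;
  cdom : chart -> set carrier;
  cimg : chart -> set 'rV[R]_m;
  cmap : chart -> carrier -> 'rV[R]_m;
  cinv : chart -> 'rV[R]_m -> carrier;
  chart_at : carrier -> chart;
  manifold_hausdorff : hausdorff_space carrier;
  manifold_second_countable : @second_countable carrier;
  cdom_chart_at : forall p, cdom (chart_at p) p;
  cdom_open : forall c, open (cdom c);
  cimg_open : forall c, open (cimg c);
  cmapK : forall c p, cdom c p -> cimg c (cmap c p) /\ cinv c (cmap c p) = p;
  cinvK : forall c x, cimg c x -> cdom c (cinv c x) /\ cmap c (cinv c x) = x;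
  cmap_continuous : forall c, {in cdom c, continuous (cmap c)};
  cinv_continuous : forall c, {in cimg c, continuous (cinv c)};
  chart_compat : forall c d (i : 'I_m),
    Cinfty (cimg c `&` cinv c @^-1` cdom d) (fun x => cmap d (cinv c x) 0 i)
}.

Section SmoothMaps.
Context {R : realType} {m p : nat}.
Context {M : smoothManifold R m} {N : smoothManifold R p}.

Definition smooth_open (U : set M) (f : M -> N) : Prop :=
  {in U, continuous f} /\
  forall (c : chart M) (d : chart N) (i : 'I_p),
    Cinfty (cimg c `&` cinv c @^-1` (U `&` f @^-1` cdom d))
           (fun x => cmap d (f (cinv c x)) 0 i).

(* Smoothness on an arbitrary subset: local existence of smooth extensions
   to open sets of the ambient manifold.  On an embedded submanifold this is
   smoothness for the submanifold structure. *)
Definition smooth_on (A : set M) (f : M -> N) : Prop :=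
  forall x, A x -> exists U : set M, exists g : M -> N,
    [/\ open U, U x, smooth_open U g & {in A `&` U, f =1 g}].

Definition regular_value (f : M -> N) (y : N) : Prop :=
  forall x, f x = y ->
    row_full ('J (fun u => cmap (chart_at y) (f (cinv (chart_at x) u)))
                 (cmap (chart_at x) x)).

End SmoothMaps.

Definition diffeomorphic (R : realType) (m p : nat)
    (M : smoothManifold R m) (N : smoothManifold R p)
    (A : set M) (B : set N) : Prop :=
  exists f : M -> N, exists g : N -> M,
    [/\ smooth_on A f, smooth_on B g,
        (forall x, A x -> B (f x) /\ g (f x) = x) &
        (forall y, B y -> A (g y) /\ f (g y) = y)].

Section Ck_theory.
Context {R : realType}.

Lemma near_eq_continuous (T S : topologicalType) (f g : T -> S) (x : T) :
  (\forall y \near x, f y = g y) -> {for x, continuous g} ->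
  {for x, continuous f}.
Proof.
move=> fg gx; rewrite /prop_for /continuous_at (nbhs_singleton fg).
apply: cvg_trans gx; apply: near_eq_cvg.
by apply: filterS fg => y ->.
Qed.

Lemma Ck_sub m (U U' : set 'rV[R]_m) (f : 'rV[R]_m -> R) k :
  U' `<=` U -> Ck k U f -> Ck k U' f.
Proof.
move=> UU; elim: k f => [|k IH] f /= [cf df]; split=> //.
- by move=> x /set_mem/UU/mem_set; exact: cf.
- by move=> x /set_mem/UU/mem_set; exact: cf.
move=> v; have [df1 df2] := df v; split; last exact: IH.
by move=> x /set_mem/UU/mem_set; exact: df1.
Qed.

Lemma Ck_locally_const m (U : set 'rV[R]_m) (f : 'rV[R]_m -> R) k :
  open U -> (forall x, U x -> \forall y \near x, f y = f x) -> Ck k U f.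
Proof.
move=> oU; elim: k f => [|k IH] f fU.
  split=> // x /set_mem Ux.
  apply: (near_eq_continuous (g := fun=> f x) (fU _ Ux)).
  exact: cst_continuous.
have D x v : U x -> is_derive x v f 0.
  move=> Ux; apply: (@near_eq_is_derive _ _ _ (cst (f x))).
    by apply: filterS (fU _ Ux) => y ->.
split=> [x /set_mem Ux|v].
  apply: (near_eq_continuous (g := fun=> f x) (fU _ Ux)).
  exact: cst_continuous.
split=> [x /set_mem Ux|]; first by have [] := D x v Ux.
apply: IH => x Ux; have [_ ->] := D x v Ux.
have: nbhs x U by exact: open_nbhs_nbhs.
by apply: filterS => y Uy; have [_ ->] := D y v Uy.
Qed.

Lemma Cinfty_translation m (U : set 'rV[R]_m) (f : 'rV[R]_m -> R) (i : 'I_m) :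
  open U ->
  (forall x, U x -> exists a, \forall y \near x, f y = y 0 i + a) ->
  Cinfty U f.
Proof.
move=> oU fU k.
have fc : {in U, continuous f}.
  move=> x /set_mem Ux; have [a fa] := fU x Ux.
  apply: (near_eq_continuous (g := fun y : 'rV[R]_m => y 0 i + a) fa).
  apply: continuousD; last exact: cst_continuous.
  exact: coord_continuous.
case: k => [|k]; first by [].
have D x (v : 'rV[R]_m) : U x -> is_derive x v f (v 0 i).
  move=> Ux; have [a fa] := fU x Ux.
  apply: (@near_eq_is_derive _ _ _ (fun y : 'rV[R]_m => y 0 i + a)).
    by apply: filterS fa => y ->.
  have -> : v 0 i = v 0 i + 0 :> R by rewrite addr0.
  apply: (is_deriveD (f := fun y : 'rV[R]_m => y 0 i) (g := cst a)).
  have e : (fun h : R => h^-1 *: ((h *: v + x) 0 i - x 0 i)) @ 0^' --> v 0 i.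
    apply: (@cvg_trans _ ((fun=> v 0 i) @ (0:R)^')); last exact: cvg_cst.
    apply: near_eq_cvg; near=> h.
    rewrite !mxE addrK /GRing.scale/= mulKf//; near: h.
    exact: nbhs_dnbhs_neq.
  apply: DeriveDef; first by apply/cvg_ex; exists (v 0 i).
  exact: cvg_lim e.
split=> // v; split=> [x /set_mem Ux|]; first by have [] := D x v Ux.
apply: Ck_locally_const => // x Ux; have [_ ->] := D x v Ux.
have: nbhs x U by exact: open_nbhs_nbhs.
by apply: filterS => y Uy; have [_ ->] := D y v Uy.
Unshelve. all: by end_near.
Qed.

Lemma Ck_comp_linear m p (L : 'rV[R]_m -> 'rV[R]_p)
    (U : set 'rV[R]_p) (f : 'rV[R]_p -> R) k :
  linear L -> continuous L -> Ck k U f -> Ck k (L @^-1` U) (f \o L).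
Proof.
move=> lL cL.
have cc (g : 'rV[R]_p -> R) : {in U, continuous g} -> {in L @^-1` U, continuous (g \o L)}.
  move=> cg x /set_mem Ux; apply: (@continuous_comp _ _ _ L g x); first exact: cL.
  by apply: cg; exact: mem_set.
have E (g : 'rV[R]_p -> R) x v :
   (fun h : R => h^-1 *: (((g \o L) \o shift x) (h *: v) - (g \o L) x)) =
   (fun h : R => h^-1 *: ((g \o shift (L x)) (h *: L v) - g (L x))).
  by apply: funext => h /=; rewrite lL.
elim: k f => [|k IH] f [cf df]; split=> //; try exact: cc.
move=> v; have [df1 df2] := df (L v); split.
  move=> x /set_mem Ux; rewrite /derivable E; apply: df1; exact: mem_set.
have -> : (fun x => 'D_v (f \o L) x) = (fun x => 'D_(L v) f x) \o L.
  by apply: funext => x; rewrite /= /derive E.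
exact: IH.
Qed.

Lemma rV_continuous (T : topologicalType) m (f : T -> 'rV[R]_m) (x : T) :
  (forall i, {for x, continuous (fun y => f y 0 i)}) -> {for x, continuous f}.
Proof.
move=> H A [P NP PA].
have : \forall y \near x, forall i, P 0 i (f y 0 i).
  apply: filter_forall => i; exact: (H i _ (NP 0 i)).
by apply: filterS => y Hy; apply: PA => i j; rewrite (ord1 i).
Qed.

Lemma lsubmx_continuous m p : continuous (lsubmx : 'rV[R]_(m + p) -> 'rV[R]_m).
Proof.
move=> x; apply: rV_continuous => i.
rewrite (_ : (fun y => _) = fun y : 'rV[R]_(m + p) => y 0 (lshift p i)).
  exact: coord_continuous.
by apply: funext => y; rewrite mxE.
Qed.

Lemma rsubmx_continuous m p : continuous (rsubmx : 'rV[R]_(m + p) -> 'rV[R]_p).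
Proof.
move=> x; apply: rV_continuous => i.
rewrite (_ : (fun y => _) = fun y : 'rV[R]_(m + p) => y 0 (rshift m i)).
  exact: coord_continuous.
by apply: funext => y; rewrite mxE.
Qed.

Lemma rV_second_countable m : @second_countable 'rV[R]_m.
Proof.
pose b (qn : 'rV[rat]_m * nat) : set 'rV[R]_m :=
  (ball (map_mx ratr qn.1 : 'rV[R]_m) (qn.2.+1%:R^-1 : R))°.
exists (range b).
  apply: (card_le_trans (card_image_le _ _)); exact: countableP.
split=> [_ [qn _ <-]|x A /nbhs_ballP[e e0 xA]]; first exact: open_interior.
have e2 : 0 < e / 2 :> R by rewrite divr_gt0.
have [n ne] : exists n : nat, n.+1%:R^-1 < e / 2.
  have [N _ /(_ N (leqnn _)) Ne] := near_infty_natSinv_lt (PosNum e2).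
  by exists N.
pose r : R := n.+1%:R^-1.
have r0 : 0 < r by rewrite invr_gt0.
have qe (i : 'I_m) : exists q : rat, `|x 0 i - ratr q| < r / 2.
  have : x 0 i - r / 2 < x 0 i + r / 2 :> R by rewrite ltrD2l gtrN// divr_gt0.
  case/rat_in_itvoo => q; rewrite in_itv/= => /andP[q1 q2]; exists q.
  by rewrite ltr_norml; apply/andP; split; lra.
have [q qP] := choice qe.
have xq (y : 'rV[R]_m) : ball (\row_i ratr (q i) : 'rV[R]_m) r y -> A y.
  move=> [_ ry]; apply: xA; split=> // i j; rewrite (ord1 i).
  have := ry 0 j; rewrite /ball/= mxE => ry'.
  have rn : r < e / 2 := ne.
  have -> : x 0 j - y 0 j = (x 0 j - ratr (q j)) + (ratr (q j) - y 0 j) by lra.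
  by apply: (le_lt_trans (ler_normD _ _)); have := qP j; lra.
exists (b (\row_i q i, n)); last first.
  move=> y /interior_subset; rewrite /=.
  have -> : map_mx ratr (\row_i q i) = \row_i ratr (q i) :> 'rV[R]_m.
    by apply/rowP => i; rewrite !mxE.
  exact: xq.
split; first by exists (\row_i q i, n).
apply/nbhs_ballP; exists (r / 2); first by rewrite /= divr_gt0.
move=> y [_ xy]; split=> // i j; rewrite (ord1 i) /ball/= !mxE.
have := xy 0 j; rewrite /ball/= => xy'.
have -> : ratr (q j) - y 0 j = - (x 0 j - ratr (q j)) + (x 0 j - y 0 j) by lra.
apply: (le_lt_trans (ler_normD _ _)); rewrite normrN; have := qP j.
by rewrite -/r; lra.
Qed.

End Ck_theory.
#[local] Obligation Tactic := idtac.

Program Definition euclidean (R : realType) (n : nat) : smoothManifold R n :=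
  @SmoothManifold R n 'rV[R]_n unit (fun=> setT) (fun=> setT) (fun=> id)
    (fun=> id) (fun=> tt) _ _ _ _ _ _ _ _ _ _.
Next Obligation. by move=> R n; exact: norm_hausdorff. Qed.
Next Obligation. by move=> R n; exact: rV_second_countable. Qed.
Next Obligation. by []. Qed.
Next Obligation. by move=> *; exact: openT. Qed.
Next Obligation. by move=> *; exact: openT. Qed.
Next Obligation. by []. Qed.
Next Obligation. by []. Qed.
Next Obligation. by move=> R n _ x _ A. Qed.
Next Obligation. by move=> R n _ x _ A. Qed.
Next Obligation.
move=> R n c d i; apply: (Cinfty_translation (i := i)).
  by rewrite setTI; exact: openT.
by move=> x _; exists 0; near=> y; rewrite addr0.
Unshelve. all: by end_near.
Qed.

Local Open Scope quotient_scope.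

Section Torus.
Context {R : realType} {k : nat}.
Implicit Types (x y b : 'rV[R]_k).

Definition lattice_eqv : rel 'rV[R]_k :=
  fun x y => [forall i, x 0 i - y 0 i \is a Num.int].

Lemma lattice_eqvP x y :
  reflect (forall i, x 0 i - y 0 i \is a Num.int) (lattice_eqv x y).
Proof. exact: forallP. Qed.

Lemma lattice_eqv_refl : reflexive lattice_eqv.
Proof. by move=> x; apply/lattice_eqvP => i; rewrite subrr. Qed.

Lemma lattice_eqv_sym : symmetric lattice_eqv.
Proof.
move=> x y; apply/lattice_eqvP/lattice_eqvP => H i.
  by rewrite -opprB rpredN.
by rewrite -opprB rpredN.
Qed.

Lemma lattice_eqv_trans : transitive lattice_eqv.
Proof.
move=> y x z /lattice_eqvP xy /lattice_eqvP yz; apply/lattice_eqvP => i.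
by rewrite -(subrKA (y 0 i)) rpredD.
Qed.

Canonical lattice_equiv :=
  EquivRel lattice_eqv lattice_eqv_refl lattice_eqv_sym lattice_eqv_trans.

Definition torus_space := {eq_quot lattice_equiv}.

HB.instance Definition _ :=
  Topological.copy torus_space (quotient_topology torus_space).
HB.instance Definition _ := EqQuotient.on torus_space.

Definition torus_pi (x : 'rV[R]_k) : torus_space := \pi x.

Definition unit_box b := [set x : 'rV[R]_k | forall i, `|x 0 i - b 0 i| < 2^-1].

(* For all x outside a null set, the representative of x modulo Z^k in
   unit_box b. *)
Definition box_repr b x : 'rV[R]_k :=
  \row_i (x 0 i - (Num.floor (x 0 i - b 0 i + 2^-1))%:~R).

Let D b := [set x : 'rV[R]_k |
  forall i, x 0 i - b 0 i + 2^-1 \isn't a Num.int].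

Lemma box_repr_eqv b x : lattice_eqv (box_repr b x) x.
Proof.
apply/lattice_eqvP => i; rewrite mxE addrAC subrr sub0r rpredN; exact: intr_int.
Qed.

Lemma box_reprE b x y : lattice_eqv x y -> box_repr b x = box_repr b y.
Proof.
move=> /lattice_eqvP xy; apply/rowP => i; rewrite !mxE.
have -> : x 0 i - b 0 i + 2^-1 = (x 0 i - y 0 i) + (y 0 i - b 0 i + 2^-1) by lra.
rewrite floorDzr// rmorphD/= (floorK (xy i)); lra.
Qed.

Lemma unit_box_repr b x : unit_box b x -> box_repr b x = x.
Proof.
move=> bx; apply/rowP => i; rewrite mxE.
have := bx i; rewrite ltr_norml => /andP[? ?].
rewrite (_ : Num.floor _ = 0) ?subr0//; apply: floor_def; rewrite add0r; lra.
Qed.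

Lemma int_open01 (t : R) (m : int) : m%:~R < t -> t < (m + 1)%:~R ->
  t \isn't a Num.int.
Proof.
move=> mt tm; apply/negP => /floorK e; move: mt tm.
by rewrite -e !ltr_int ltzD1 ltNge => /negP.
Qed.

Let box_D b x : unit_box b x -> D b x.
Proof.
move=> bx i; have := bx i; rewrite ltr_norml => /andP[? ?].
by apply: (@int_open01 _ 0); rewrite ?add0r; lra.
Qed.

Let D_eqv b x y : lattice_eqv x y -> D b x -> D b y.
Proof.
rewrite lattice_eqv_sym => /lattice_eqvP xy Dx i; apply/negP => H.
have /negP[] := Dx i.
have -> : x 0 i - b 0 i + 2^-1 = (y 0 i - b 0 i + 2^-1) - (y 0 i - x 0 i) by lra.
by rewrite rpredB.
Qed.

Let D_box b x : D b x -> unit_box b (box_repr b x).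
Proof.
move=> Dx i; rewrite mxE; set t := x 0 i - b 0 i + 2^-1.
have := floor_itv t; rewrite intrD1 => /andP[].
rewrite le_eqVlt => /orP[/eqP e|t1 t2]; last first.
  by rewrite ltr_norml; apply/andP; rewrite /t in t1 t2 *; split; lra.
by have := Dx i; rewrite -/t -e intr_int.
Qed.

Lemma near_floor (t : R) : t \isn't a Num.int ->
  \forall u \near t, Num.floor u = Num.floor t /\ u \isn't a Num.int.
Proof.
move=> tn; have /andP[] := floor_itv t; rewrite le_eqVlt => /orP[/eqP e|t1 t2].
  by move: tn; rewrite -e intr_int.
have : t \in `](Num.floor t)%:~R, (Num.floor t + 1)%:~R[ by rewrite in_itv/= t1 t2.
move=> /near_in_itvoo; apply: filterS => u; rewrite in_itv/= => /andP[u1 u2].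
split; last exact: int_open01 u1 u2.
by apply: floor_def; rewrite (ltW u1).
Qed.

Let near_D b x : D b x -> nbhs x [set y | D b y /\
  forall i, Num.floor (y 0 i - b 0 i + 2^-1) =
            Num.floor (x 0 i - b 0 i + 2^-1)].
Proof.
move=> Dx.
pose Q (i : 'I_k) (y : 'rV[R]_k) :=
  Num.floor (y 0 i - b 0 i + 2^-1) = Num.floor (x 0 i - b 0 i + 2^-1) /\
  y 0 i - b 0 i + 2^-1 \isn't a Num.int.
have : \forall y \near x, forall i, Q i y.
  apply: (@filter_forall _ _ Q (nbhs x)) => i.
  have c : {for x, continuous (fun y : 'rV[R]_k => y 0 i - b 0 i + 2^-1)}.
    apply: continuousD; last exact: cst_continuous.
    by apply: continuousB; [exact: coord_continuous|exact: cst_continuous].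
  exact: (c _ (near_floor (Dx i))).
by apply: filterS => y Hy; split=> i; have [] := Hy i.
Qed.

Let near_box_repr b x : D b x -> forall i,
  exists a, \forall y \near x, box_repr b y 0 i = y 0 i + a.
Proof.
move=> Dx i; exists (- (Num.floor (x 0 i - b 0 i + 2^-1))%:~R).
by apply: filterS (near_D Dx) => y [_ /(_ i) e]; rewrite mxE e.
Qed.

Let D_open b : open (D b).
Proof.
by rewrite openE => x /near_D; apply: filterS => y [].
Qed.

Lemma unit_box_open b : open (unit_box b).
Proof.
rewrite openE => x bx.
pose Q (i : 'I_k) (y : 'rV[R]_k) := is_true (`|y 0 i - b 0 i| < 2^-1).
suff : \forall y \near x, forall i, Q i y by [].
apply: (@filter_forall _ _ Q (nbhs x)) => i.
have c : {for x, continuous (fun y : 'rV[R]_k => `|y 0 i - b 0 i|)}.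
  apply: (continuous_comp (f := fun y : 'rV[R]_k => y 0 i - b 0 i)
                          (g := fun t : R => `|t|)).
    by apply: continuousB; [exact: coord_continuous|exact: cst_continuous].
  exact: norm_continuous.
by apply: (c (fun t => t < 2^-1)); exact: lt_nbhsl.
Qed.

Let box_repr_continuous b x : D b x -> {for x, continuous (box_repr b)}.
Proof.
move=> Dx; apply: rV_continuous => i; have [a xa] := near_box_repr Dx i.
apply: (near_eq_continuous (g := fun y : 'rV[R]_k => y 0 i + a) xa).
by apply: continuousD; [exact: coord_continuous|exact: cst_continuous].
Qed.

Lemma torus_piP x y : torus_pi x = torus_pi y <-> lattice_eqv x y.
Proof.
exact: (rwP (eqmodP lattice_equiv x y)).
Qed.

Lemma torus_pi_repr (q : torus_space) : torus_pi (repr q) = q.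
Proof. exact: reprK. Qed.

Lemma repr_torus_pi x : lattice_eqv (repr (torus_pi x)) x.
Proof. by apply/torus_piP; rewrite torus_pi_repr. Qed.

Lemma torus_pi_continuous : continuous torus_pi.
Proof. exact: pi_continuous. Qed.

Lemma open_torusP (V : set torus_space) : open V <-> open (torus_pi @^-1` V).
Proof. by []. Qed.

Lemma open_torus_pi (U : set 'rV[R]_k) : open U -> open (torus_pi @` U).
Proof.
move=> oU; apply/open_torusP; rewrite openE => x [y Uy /torus_piP yx].
have c : {for x, continuous (fun z : 'rV[R]_k => z + (y - x))}.
  by apply: continuousD; [exact: cvg_id|exact: cst_continuous].
have : nbhs x ((fun z : 'rV[R]_k => z + (y - x)) @^-1` U).
  by apply: c; apply: open_nbhs_nbhs; split=> //=; rewrite addrC subrK.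
apply: filterS => z Uz; exists (z + (y - x)) => //; apply/torus_piP.
apply/lattice_eqvP => i; have := lattice_eqvP _ _ yx i; rewrite !mxE.
by rewrite addrAC subrr add0r.
Qed.

Lemma torus_hausdorff : hausdorff_space torus_space.
Proof.
rewrite open_hausdorff => p q pq.
have npq : ~ lattice_eqv (repr p) (repr q).
  by move=> /torus_piP; rewrite !torus_pi_repr => /eqP; apply/negP.
have [i ni] : exists i, repr p 0 i - repr q 0 i \isn't a Num.int.
  by apply/existsP; rewrite -negb_forall; apply/negP.
set t := repr p 0 i - repr q 0 i in ni *.
have /nbhs_ballP[e e0 te] := near_floor ni.
pose B x := [set y : 'rV[R]_k | `|y 0 i - x 0 i| < e / 2].
have oB x : open (B x).
  have -> : B x = (fun y : 'rV[R]_k => `|y 0 i - x 0 i|) @^-1`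
      [set s | s < e / 2] by [].
  apply: open_comp; last exact: open_lt.
  move=> y _; apply: (continuous_comp (f := fun y : 'rV[R]_k => y 0 i - x 0 i)
                          (g := fun t : R => `|t|)).
    by apply: continuousB; [exact: coord_continuous|exact: cst_continuous].
  exact: norm_continuous.
have Bx x : B x x by rewrite /B/= subrr normr0 divr_gt0.
exists (torus_pi @` B (repr p), torus_pi @` B (repr q)) => /=.
  by split; apply/mem_set; [exists (repr p)|exists (repr q)] => //;
    exact: torus_pi_repr.
split; try exact: open_torus_pi.
apply/eqP; rewrite -subset0 => r [[x px <-] [y qy /torus_piP/lattice_eqvP/(_ i) yx]].
suff /te[_ /negP] : ball t e (x 0 i - y 0 i).
  by apply; rewrite -opprB rpredN.
rewrite /ball/= /t.
have -> : repr p 0 i - repr q 0 i - (x 0 i - y 0 i) =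
  - (x 0 i - repr p 0 i) + (y 0 i - repr q 0 i) by lra.
apply: (le_lt_trans (ler_normD _ _)); rewrite normrN.
by rewrite (splitr e) ltrD.
Qed.

Lemma torus_second_countable : @second_countable torus_space.
Proof.
have [B cB [oB nB]] := @rV_second_countable R k.
exists [set torus_pi @` A | A in B].
  exact: (card_le_trans (card_image_le _ _) cB).
split=> [_ [A BA <-]|q V qV]; first exact/open_torus_pi/oB.
have : nbhs (repr q) (torus_pi @^-1` V).
  by apply: torus_pi_continuous; rewrite torus_pi_repr.
move=> /nB[A [BA Aq] AV]; exists (torus_pi @` A).
  by split; [exists A|exists (repr q); rewrite ?torus_pi_repr].
by move=> _ [x Ax <-]; exact: AV.
Qed.

Let cdomE b x : (torus_pi @` unit_box b) (torus_pi x) <-> D b x.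
Proof.
split=> [[y /box_D Dy /torus_piP yx]|Dx]; first exact: D_eqv yx Dy.
exists (box_repr b x); first exact: D_box.
by apply/torus_piP; exact: box_repr_eqv.
Qed.

Program Definition torus : smoothManifold R k :=
  @SmoothManifold R k torus_space 'rV[R]_k
    (fun b => torus_pi @` unit_box b) unit_box
    (fun b q => box_repr b (repr q)) (fun=> torus_pi) repr
    torus_hausdorff torus_second_countable _ _ _ _ _ _ _ _.
Next Obligation.
move=> q; exists (repr q); rewrite ?torus_pi_repr// => i.
by rewrite subrr normr0 invr_gt0.
Qed.
Next Obligation. by move=> b; apply: open_torus_pi; exact: unit_box_open. Qed.
Next Obligation. exact: unit_box_open. Qed.
Next Obligation.
move=> b q; rewrite -{1}(torus_pi_repr q) => /cdomE Dq; split; first exact: D_box.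
rewrite -[RHS]torus_pi_repr; apply/torus_piP; exact: box_repr_eqv.
Qed.
Next Obligation.
move=> b x bx; split; first by exists x.
by rewrite (box_reprE b (repr_torus_pi x)) unit_box_repr.
Qed.
Next Obligation.
move=> b q /set_mem; rewrite -{1}(torus_pi_repr q) => /cdomE Dq.
move=> A; rewrite nbhsE => -[V [oV Vq] VA].
have oW : open (D b `&` box_repr b @^-1` V).
  rewrite openE => x [Dx Vx]; apply: filterI; first by apply: open_nbhs_nbhs; split=> //; exact: D_open.
  by apply: (box_repr_continuous Dx); exact: open_nbhs_nbhs.
have := open_torus_pi oW => oW'.
have : nbhs q (torus_pi @` (D b `&` box_repr b @^-1` V)).
  by apply: open_nbhs_nbhs; split=> //; exists (repr q); rewrite ?torus_pi_repr.
apply: filterS => _ [x [Dx Vx] <-]; apply: VA.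
by rewrite /= (box_reprE b (repr_torus_pi x)).
Qed.
Next Obligation. by move=> b x _; exact: torus_pi_continuous. Qed.
Next Obligation.
move=> b d i.
have -> : (fun x => box_repr d (repr (torus_pi x)) 0 i) =
          (fun x => box_repr d x 0 i).
  by apply: funext => x; rewrite (box_reprE d (repr_torus_pi x)).
have -> : torus_pi @^-1` (torus_pi @` unit_box d) = D d.
  by apply/seteqP; split=> x /cdomE.
apply: (Cinfty_translation (i := i)).
  by apply: openI; [exact: unit_box_open|exact: D_open].
by move=> x [_ Dx]; exact: near_box_repr.
Qed.

End Torus.

Arguments torus R k : clear implicits.

Section Product.
Context {R : realType} {m p : nat}.
Context (M : smoothManifold R m) (N : smoothManifold R p).

Lemma prod_hausdorff : hausdorff_space (M * N)%type.
Proof.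
have := @manifold_hausdorff _ _ M; have := @manifold_hausdorff _ _ N.
rewrite !open_hausdorff => hN hM [x1 x2] [y1 y2] xy.
have [e1|n1] := eqVneq x1 y1.
  have n2 : x2 != y2 by apply: contra_neq xy => ->; rewrite e1.
  have [[A B] /= [/set_mem Ax /set_mem By] [oA oB /eqP AB]] := hN _ _ n2.
  exists (snd @^-1` A, snd @^-1` B) => /=; first by split; apply/mem_set.
  split.
  - by apply: open_comp => // z _; exact: cvg_snd.
  - by apply: open_comp => // z _; exact: cvg_snd.
  - apply/eqP; rewrite -subset0 => z [Az Bz].
    by have : (A `&` B) z.2 by []; rewrite AB.
have [[A B] /= [/set_mem Ax /set_mem By] [oA oB /eqP AB]] := hM _ _ n1.
exists (fst @^-1` A, fst @^-1` B) => /=; first by split; apply/mem_set.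
split.
- by apply: open_comp => // z _; exact: cvg_fst.
- by apply: open_comp => // z _; exact: cvg_fst.
- apply/eqP; rewrite -subset0 => z [Az Bz].
  by have : (A `&` B) z.1 by []; rewrite AB.
Qed.

Lemma open_setX (A : set M) (B : set N) : open A -> open B -> open (A `*` B).
Proof.
move=> oA oB.
have -> : A `*` B = fst @^-1` A `&` snd @^-1` B by [].
by apply: openI; apply: open_comp => // z _; [exact: cvg_fst|exact: cvg_snd].
Qed.

Lemma prod_second_countable : @second_countable (M * N)%type.
Proof.
have [A cA [oA nA]] := @manifold_second_countable _ _ M.
have [B cB [oB nB]] := @manifold_second_countable _ _ N.
exists [set U.1 `*` U.2 | U in A `*` B].
  exact: (card_le_trans (card_image_le _ _) (countableX cA cB)).
split=> [_ [[U V] [/= AU BV] <-]|[x y] W [[U V] [/= xU yV] UVW]].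
  by apply: open_setX; [exact: oA|exact: oB].
have [U' [AU' U'x] U'U] := nA _ _ xU.
have [V' [BV' V'y] V'V] := nB _ _ yV.
exists (U' `*` V'); first by split=> //; exists (U', V').
by move=> [a b] [/= /U'U Ua /V'V Vb]; apply: UVW.
Qed.

Lemma lsubmx_linear : linear (lsubmx : 'rV[R]_(m + p) -> 'rV[R]_m).
Proof. by move=> a u v; rewrite linearP. Qed.

Lemma rsubmx_linear : linear (rsubmx : 'rV[R]_(m + p) -> 'rV[R]_p).
Proof. by move=> a u v; rewrite linearP. Qed.

Program Definition prod_manifold : smoothManifold R (m + p) :=
  @SmoothManifold R (m + p) (M * N)%type (chart M * chart N)%type
    (fun c => cdom c.1 `*` cdom c.2)
    (fun c => lsubmx @^-1` cimg c.1 `&` rsubmx @^-1` cimg c.2)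
    (fun c z => row_mx (cmap c.1 z.1) (cmap c.2 z.2))
    (fun c x => (cinv c.1 (lsubmx x), cinv c.2 (rsubmx x)))
    (fun z => (chart_at z.1, chart_at z.2))
    prod_hausdorff prod_second_countable _ _ _ _ _ _ _ _.
Next Obligation. by move=> [x y]; split; exact: cdom_chart_at. Qed.
Next Obligation. by move=> c; apply: open_setX; exact: cdom_open. Qed.
Next Obligation.
move=> c; apply: openI; apply: open_comp; try exact: cimg_open.
- by move=> x _; exact: lsubmx_continuous.
- by move=> x _; exact: rsubmx_continuous.
Qed.
Next Obligation.
move=> [c d] [x y] [/= /cmapK[cx ex] /cmapK[dy ey]].
by rewrite row_mxKl row_mxKr ex ey.
Qed.
Next Obligation.
move=> [c d] x [/= /cinvK[cx ex] /cinvK[dy ey]].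
by rewrite ex ey hsubmxK.
Qed.
Next Obligation.
move=> [c d] [x y] /set_mem[/= cx dy]; apply: rV_continuous => i.
case: (split_ordP i) => j ->.
- rewrite (_ : (fun _ => _) = (fun z => cmap c z.1 0 j)); last first.
    by apply: funext => z; rewrite row_mxEl.
  apply: (@continuous_comp _ _ _ (fun z : M * N => cmap c z.1)
    (fun u : 'rV[R]_m => u 0 j)); last exact: coord_continuous.
  apply: (@continuous_comp _ _ _ (fun z : M * N => z.1) (cmap c)).
    exact: cvg_fst.
  by apply: cmap_continuous; exact: mem_set.
- rewrite (_ : (fun _ => _) = (fun z => cmap d z.2 0 j)); last first.
    by apply: funext => z; rewrite row_mxEr.
  apply: (@continuous_comp _ _ _ (fun z : M * N => cmap d z.2)
    (fun u : 'rV[R]_p => u 0 j)); last exact: coord_continuous.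
  apply: (@continuous_comp _ _ _ (fun z : M * N => z.2) (cmap d)).
    exact: cvg_snd.
  by apply: cmap_continuous; exact: mem_set.
Qed.
Next Obligation.
move=> [c d] x /set_mem[/= cx dx].
apply: (@cvg_pair _ _ _ (nbhs x) (nbhs (cinv c (lsubmx x)))
  (nbhs (cinv d (rsubmx x)))).
- apply: (@continuous_comp _ _ _ (lsubmx : 'rV[R]_(m + p) -> 'rV[R]_m)
    (cinv c)); first exact: lsubmx_continuous.
  by apply: cinv_continuous; exact: mem_set.
- apply: (@continuous_comp _ _ _ (rsubmx : 'rV[R]_(m + p) -> 'rV[R]_p)
    (cinv d)); first exact: rsubmx_continuous.
  by apply: cinv_continuous; exact: mem_set.
Qed.
Next Obligation.
move=> [c1 d1] [c2 d2] i k /=.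
case: (split_ordP i) => j ->.
- rewrite (_ : (fun _ => _) =
    (fun u => cmap c2 (cinv c1 u) 0 j) \o (lsubmx : 'rV[R]_(m + p) -> 'rV[R]_m));
    last by apply: funext => z; rewrite row_mxEl.
  apply: Ck_sub (Ck_comp_linear lsubmx_linear (@lsubmx_continuous _ _ _)
    (@chart_compat _ _ M c1 c2 j k)).
  by move=> x [[cx _] [cx2 _]].
- rewrite (_ : (fun _ => _) =
    (fun u => cmap d2 (cinv d1 u) 0 j) \o (rsubmx : 'rV[R]_(m + p) -> 'rV[R]_p));
    last by apply: funext => z; rewrite row_mxEr.
  apply: Ck_sub (Ck_comp_linear rsubmx_linear (@rsubmx_continuous _ _ _)
    (@chart_compat _ _ N d1 d2 j k)).
  by move=> x [[_ cx] [_ cx2]].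
Qed.

End Product.

(* Tensor fields are given by their components in each chart c at each point p
   of cdom c.  Tangent vectors are row vectors v; changing from chart c to chart
   d turns v into v *m J, with J the Jacobian matrix of the transition map.
   The bilinear form with components W is (u, v) |-> u *m W *m v^T. *)
Record symplectic_form (R : realType) (m : nat) (X : smoothManifold R m) :=
  SymplecticForm {
  omega :> chart X -> X -> 'M[R]_m;
  omega_change : forall c d p, cdom c p -> cdom d p ->
    let J := 'J (fun x => cmap d (cinv c x)) (cmap c p) in
    omega c p = J *m omega d p *m J^T;
  omega_smooth : forall c i j,
    Cinfty (cimg c) (fun x => omega c (cinv c x) i j);
  omega_skew : forall c p, cdom c p -> (omega c p)^T = - omega c p;
  omega_nondegenerate : forall c p, cdom c p -> omega c p \in unitmx;
  omega_closed : forall c x (i j l : 'I_m), cimg c x ->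
    let d_ (i j l : 'I_m) :=
      'D_(delta_mx 0 i) (fun y : 'rV[R]_m => omega c (cinv c y) j l) x in
    d_ i j l + d_ j l i + d_ l i j = 0
}.

Section HamiltonianDynamics.
Context {R : realType} {m : nat} {X : smoothManifold R m}.
Context (w : symplectic_form X).

Definition differential (F : X -> R) (c : chart X) (p : X) : 'rV[R]_m :=
  \row_i 'D_(delta_mx 0 i) (fun x : 'rV[R]_m => F (cinv c x)) (cmap c p).

Definition hamiltonian_field (F : X -> R) (c : chart X) (p : X) : 'rV[R]_m :=
  - differential F c p *m invmx (w c p).

(* iota_(V_F) omega = - dF *)
Lemma hamiltonian_fieldE F c p : cdom c p ->
  hamiltonian_field F c p *m w c p = - differential F c p.
Proof.
by move=> cp; rewrite mulmxKV//; exact: omega_nondegenerate.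
Qed.

Definition poisson (F G : X -> R) (p : X) : R :=
  let c := chart_at p in
  (hamiltonian_field F c p *m w c p *m (hamiltonian_field G c p)^T) 0 0.

Definition integral_curve (V : chart X -> X -> 'rV[R]_m) (g : R -> X) : Prop :=
  continuous g /\
  forall t c, cdom c (g t) ->
    is_derive t 1 (fun s : R => cmap c (g s)) (V c (g t)).

(* The value at time t of the integral curve of V starting at x; it has the
   dummy value x if there is no such curve defined for all times. *)
Definition flow (V : chart X -> X -> 'rV[R]_m) (t : R) (x : X) : X :=
  xget (cst x) [set g | integral_curve V g /\ g 0 = x] t.

(* phi^(H_1)_(t_1) (phi^(H_2)_(t_2) (... (phi^(H_n)_(t_n) x))) *)
Definition joint_flow (n : nat) (H : X -> 'rV[R]_n) (t : 'rV[R]_n) (x : X) : X :=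
  foldr (fun i => flow (hamiltonian_field (fun p => H p 0 i)) (t 0 i))
        x (enum 'I_n).

Definition flow_orbit (n : nat) (H : X -> 'rV[R]_n) (x : X) : set X :=
  [set joint_flow H t x | t in [set: 'rV[R]_n]].

End HamiltonianDynamics.

Record integrable_system (R : realType) (n : nat)
    (X : smoothManifold R (2 * n)) (w : symplectic_form X)
    (H : X -> 'rV[R]_n) : Prop := IntegrableSystem {
  integrable_smooth : smooth_open (N := euclidean R n) setT H;
  integrable_involution : forall (i j : 'I_n) (p : X),
    poisson w (fun x => H x 0 i) (fun x => H x 0 j) p = 0;
  integrable_regular : exists D : set 'rV[R]_n,
    [/\ open D, D `<=` range H, range H `<=` closure D &
        forall b, D b -> regular_value (N := euclidean R n) H b];
  integrable_proper : forall K : set 'rV[R]_n, compact K -> compact (H @^-1` K);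
  integrable_connected : forall b : 'rV[R]_n, connected (H @^-1` [set b])
}.

Record local_section (R : realType) (n m : nat) (X : smoothManifold R m)
    (H : X -> 'rV[R]_n) (B : set 'rV[R]_n) (s : 'rV[R]_n -> X) : Prop :=
  LocalSection {
  section_open : open B;
  section_sub : B `<=` range H;
  section_smooth : smooth_open (M := euclidean R n) B s;
  section_id : {in B, forall b, H (s b) = b}
}.

(* Main.v *)
Require Import Defs.
From mathcomp Require Import all_boot all_order all_algebra.
From mathcomp Require Import all_classical all_reals all_analysis.
From mathcomp Require Import ring lra.

Set Implicit Arguments.
Unset Strict Implicit.
Unset Printing Implicit Defensive.

Import Order.TTheory GRing.Theory Num.Theory.
Import numFieldNormedType.Exports.

Local Open Scope classical_set_scope.
Local Open Scope ring_scope.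

(* The flows of the H_i are complete because the fibres of H are compact and invariant, and they
   commute because {H_i, H_j} = 0 and d omega = 0 give [V_i, V_j] = 0.  Hence
   Phi(t) = phi_t(sigma(b)) satisfies Phi(t + u) = phi_u(Phi(t)) and d_i Phi = V_i(Phi), so Phi is
   smooth by bootstrapping, without any smooth dependence on initial conditions.  The section
   makes dH, hence the V_i, independent at sigma(b); if sum c_i V_i vanished at Phi(t), the line
   t + s c would consist of periods, so the V_i are independent all along the orbit.  Thus the
   period group Lam is discrete, Lam = (Z^k x 0) A for some invertible A, and Phi descends to a
   bijection from R^n / Lam onto the orbit.  For its inverse, near Phi(t) choose a linear map L of
   a chart to R^n which is dual to the V_i: then L o Phi is a local diffeomorphism, while (H, L) is
   injective, so (L o Phi)^-1 o L extends the local inverse of Phi to an open subset of X. *)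

(** * Differential calculus *)

(** Smoothness on a subset asks for extensions to open subsets of [X], so an injective immersion of
    R^n / Lam is not enough: a priori the orbit could return to a neighbourhood of Phi(t) at distant
    times and accumulate there. It cannot: [H] is constant on the orbit and the kernel of dH has
    dimension 2n - n, so it is exactly the span of the V_i. Hence (H, L) has an injective
    differential at Phi(t), and the local inverse recovers every nearby orbit point, at whatever
    time it was first reached. At t = 0 the same inverse shows that Phi is injective near 0, which
    is the discreteness of Lam. It is proved for short times by a Gronwall estimate and carried to
    all times by cutting these into equal steps, whose length is chosen uniformly on a compact
    fibre. If the orbit is compact then k = n, because a coordinate of the factor R^(n-k) would be
    unbounded on it. *)

Section Neighbourhoods.

Lemma near_join (T : topologicalType) (x : T) (P : set T) :
  (\forall y \near x, P y) -> \forall y \near x, \forall z \near y, P z.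
Proof. by move=> H; apply: nbhs_interior. Qed.

Lemma near_forall (T : topologicalType) (I : finType) (x : T) (P : I -> T -> Prop) :
  (forall i, \forall y \near x, P i y) -> \forall y \near x, forall i, P i y.
Proof. exact: (@filter_forall _ _ P (nbhs x)). Qed.

Lemma near_and (T : topologicalType) (x : T) (P Q S : T -> Prop) :
  (\forall y \near x, P y) -> (\forall y \near x, Q y) ->
  (forall y, P y -> Q y -> S y) -> \forall y \near x, S y.
Proof. by move=> HP HQ HS; apply: filterS (filterI HP HQ) => y [Py Qy]; exact: HS. Qed.

Lemma near_all (T : topologicalType) (x : T) (P : T -> Prop) :
  (forall y, P y) -> \forall y \near x, P y.
Proof. exact: nearW. Qed.

Lemma near_imp (T : topologicalType) (x : T) (P Q : T -> Prop) :
  (\forall y \near x, P y) -> (forall y, P y -> Q y) -> \forall y \near x, Q y.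
Proof. by move=> HP PQ; apply: filterS HP. Qed.

Lemma near_cont (T S : topologicalType) (f : T -> S) (x : T) (P : S -> Prop) :
  {for x, continuous f} -> (\forall z \near f x, P z) -> \forall y \near x, P (f y).
Proof. by move=> fc Pf; exact: fc. Qed.

Context {R : realType}.

Lemma ball_normP (V : normedModType R) (x : V) (P : set V) :
  (\forall y \near x, P y) <->
  exists2 r, 0 < r & forall y, `|y - x| < r -> P y.
Proof.
split=> [/nbhs_ballP[r r0 rP]|[r r0 rP]].
  by exists r => // y yx; apply: rP; rewrite -ball_normE/= distrC.
apply/nbhs_ballP; exists r => // y; rewrite -ball_normE/= distrC; exact: rP.
Qed.

Lemma near_norm_lt (V : normedModType R) (c t : V) e :
  `|t - c| < e -> \forall s \near t, `|s - c| < e.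
Proof.
move=> te; apply: (ball_normP t _).2; exists (e - `|t - c|) => [|s]; first by rewrite subr_gt0.
by rewrite ltrBrDr => /(le_lt_trans (ler_normD _ _)); rewrite subrKA.
Qed.

Lemma continuous_eps (V W : normedModType R) (f : V -> W) x :
  (forall e, 0 < e -> \forall y \near x, `|f x - f y| <= e) -> {for x, continuous f}.
Proof. by move=> H; apply/cvgrPdist_le. Qed.

Lemma half_pow_small (c d : R) : 0 < d -> exists n, c * 2^-1 ^+ n <= d.
Proof.
move=> d0; pose c' := `|c| + 1; have c'0 : 0 < c' by rewrite ltr_wpDl.
have d3 : 0 < d / c' by rewrite divr_gt0.
have : `|2^-1 : R| < 1 by rewrite gtr0_norm ?invr_gt0// invf_lt1 ?ltr1n.
move=> /cvg_expr /cvgrPdist_le /(_ _ d3) [N _ /(_ N (leqnn N))].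
rewrite sub0r normrN ger0_norm ?exprn_ge0// => H; exists N.
apply: (@le_trans _ _ (c' * 2^-1 ^+ N)); last by rewrite mulrC -ler_pdivlMr.
by rewrite ler_wpM2r ?exprn_ge0// (le_trans (ler_norm c))// lerDl.
Qed.

End Neighbourhoods.

Section RowVectors.
Context {R : realType}.

Lemma rV_norm_coord m (x : 'rV[R]_m) i : `|x 0 i| <= `|x|.
Proof.
rewrite [leRHS]/Num.norm /= mx_normrE.
by apply/bigmax_geP; right; exists (0, i).
Qed.

Lemma rV_norm_le m (x : 'rV[R]_m) c :
  0 <= c -> (forall i, `|x 0 i| <= c) -> `|x| <= c.
Proof.
move=> c0 xc; rewrite [leLHS]/Num.norm /= mx_normrE.
by apply/bigmax_leP; split=> // -[i j] _ /=; rewrite (ord1 i).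
Qed.

Lemma rV_norm_lt m (x : 'rV[R]_m) c :
  0 < c -> (forall i, `|x 0 i| < c) -> `|x| < c.
Proof.
move=> c0 xc; rewrite [ltLHS]/Num.norm /= mx_normrE.
by apply/bigmax_ltP; split=> // -[i j] _ /=; rewrite (ord1 i).
Qed.

Lemma mulmx_norm_le m p (M : 'M[R]_(m, p)) :
  exists2 C, 0 < C & forall x : 'rV[R]_m, `|x *m M| <= C * `|x|.
Proof.
pose C := 1 + \sum_i \sum_j `|M i j|.
have S0 : 0 <= \sum_i \sum_j `|M i j| by apply: sumr_ge0 => i _; apply: sumr_ge0.
have C0 : 0 < C by rewrite /C; lra.
exists C => // x; apply: rV_norm_le => [|j]; first by rewrite mulr_ge0// ltW.
rewrite mxE; apply: le_trans (ler_norm_sum _ _ _) _.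
apply: (@le_trans _ _ (\sum_i \sum_j `|M i j| * `|x|)); last first.
  under eq_bigr do rewrite -mulr_suml; rewrite -mulr_suml ler_wpM2r//.
  by rewrite /C lerDr.
apply: ler_sum => i _; rewrite normrM mulrC.
apply: (@le_trans _ _ (`|M i j| * `|x|)); first by rewrite ler_wpM2l// rV_norm_coord.
by rewrite (bigD1 j)//= lerDl; apply: sumr_ge0 => k _; rewrite mulr_ge0.
Qed.

Lemma is_derive_rV (V : normedModType R) m (f : V -> 'rV[R]_m) x v df :
  is_derive x v f df <->
  forall i, is_derive x v (fun y => f y 0 i) (df 0 i).
Proof.
split=> [[d <-] i|H].
  split; first by have /derivable_mxP := d; exact.
  by rewrite (derive_mx d) mxE.
have d : derivable f x v.
  by apply/derivable_mxP => i j; rewrite (ord1 i); have [] := H j.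
split=> //; rewrite (derive_mx d); apply/rowP => i; rewrite mxE.
by have [_ ->] := H i.
Qed.

(** The two difference quotients are the same function of [h]. This reduces directional derivatives
    to the one-variable case. *)
Lemma is_derive_line (V W : normedModType R) (f : V -> W) (x v : V) (s : R) d :
  is_derive (s *: v + x) v f d <-> is_derive s 1 (fun t : R => f (t *: v + x)) d.
Proof.
have E : (fun h : R => h^-1 *: (((fun t : R => f (t *: v + x)) \o shift s) (h *: 1)
           - f (s *: v + x)))
       = (fun h : R => h^-1 *: ((f \o shift (s *: v + x)) (h *: v) - f (s *: v + x))).
  by apply: funext => h /=; rewrite [h *: 1]mulr1 scalerDl addrA.
by split=> -[d1 d2]; split; move: d1 d2; rewrite /derivable /derive E.
Qed.

(** Points of the segment are written [u * t] with [u] in [0, 1], so that both signs of [t] are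
    covered at once and the hypotheses concern only the segment from 0 to [t]. *)
Lemma mvt_le (f df : R -> R) (c t : R) :
  (forall u, 0 <= u <= 1 -> is_derive (u * t) 1 f (df (u * t))) ->
  (forall u, 0 <= u <= 1 -> `|df (u * t)| <= c) -> `|f t - f 0| <= c * `|t|.
Proof.
move=> fd dc.
have [->|t0] := eqVneq t 0; first by rewrite subrr !normr0 mulr0.
have seg s : (0 <= s <= t) || (t <= s <= 0) -> exists2 u, 0 <= u <= 1 & s = u * t.
  move=> st; exists (s / t); last by rewrite divfK.
  case/orP: st => /andP[s0 st].
    have tp : 0 < t by rewrite lt_def t0 (le_trans s0).
    by rewrite divr_ge0 ?(ltW tp)//= ler_pdivrMr// mul1r.
  have tn : t < 0 by rewrite lt_def eq_sym t0 (le_trans s0).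
  rewrite -mulrNN -invrN divr_ge0 ?oppr_ge0 ?(ltW tn)//=.
  by rewrite ler_pdivrMr ?oppr_gt0// mul1r lerN2.
have key a b : a <= b -> (forall s, a <= s <= b -> exists2 u, 0 <= u <= 1 & s = u * t) ->
    `|f b - f a| <= c * (b - a).
  move=> ab H.
  have [||z] := @MVT_segment R f df a b ab.
  - move=> s; rewrite in_itv/= => /andP[/ltW s1 /ltW s2].
    by have [|u u01 ->] := H s; [rewrite s1|exact: fd].
  - apply: derivable_within_continuous => s; rewrite in_itv/= => s1.
    by have [|u u01 ->] := H s; [rewrite s1|have [] := fd u u01].
  rewrite in_itv/= => /H[u u01 ->] ->.
  by rewrite normrM (ger0_norm (_ : 0 <= b - a)) ?subr_ge0// ler_wpM2r ?subr_ge0// dc.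
have [tn|tp] := leP t 0.
  rewrite distrC (ler0_norm tn).
  by apply: le_trans (key t 0 tn _) _; rewrite ?sub0r// => s st; apply: seg; rewrite st orbT.
rewrite (gtr0_norm tp); apply: le_trans (key 0 t (ltW tp) _) _; rewrite ?subr0//.
by move=> s st; apply: seg; rewrite st.
Qed.

(** The norm is the maximum of the coordinates, so the scalar case applies to each coordinate with
    the same constant. *)
Lemma mvt_rV_le m (f df : R -> 'rV[R]_m) (c t : R) :
  0 <= c ->
  (forall u, 0 <= u <= 1 -> is_derive (u * t) 1 f (df (u * t))) ->
  (forall u, 0 <= u <= 1 -> `|df (u * t)| <= c) -> `|f t - f 0| <= c * `|t|.
Proof.
move=> c0 fd dc; apply: rV_norm_le => [|i]; first by rewrite mulr_ge0.
rewrite !mxE.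
apply: (@mvt_le (fun s => f s 0 i) (fun s => df s 0 i)) => u u01.
  exact: (proj1 (is_derive_rV _ _ _ _) (fd u u01)).
exact: le_trans (rV_norm_coord _ i) (dc u u01).
Qed.

Lemma convex_norm_lt (a b x r u : R) :
  `|a - x| < r -> `|b - x| < r -> 0 <= u <= 1 -> `|u * (a - b) + b - x| < r.
Proof.
move=> ax bx /andP[u0 u1].
have [->|u_neq] := eqVneq u 1; first by rewrite mul1r subrK.
have -> : u * (a - b) + b - x = u * (a - x) + (1 - u) * (b - x) by ring.
have u1' : u < 1 by rewrite lt_neqAle u_neq.
apply: le_lt_trans (ler_normD _ _) _.
rewrite !normrM (ger0_norm u0) (gtr0_norm (_ : 0 < 1 - u)) ?subr_gt0//.
have -> : r = u * r + (1 - u) * r by ring.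
by rewrite ler_ltD// ?ler_wpM2l// ?(ltW ax)// ltr_pM2l// subr_gt0.
Qed.

Definition C1at m (f : 'rV[R]_m -> R) (x : 'rV[R]_m) :=
  (\forall y \near x, forall i : 'I_m, derivable f y (delta_mx 0 i)) /\
  forall i : 'I_m, {for x, continuous ('D_(delta_mx 0 i) f)}.

(* Moving one coordinate at a time, the mean value theorem only involves partial derivatives. *)
Lemma C1at_strict m (f : 'rV[R]_m -> R) (x : 'rV[R]_m) : C1at f x ->
  forall eta, 0 < eta -> exists2 r, 0 < r & forall y z,
    `|y - x| < r -> `|z - x| < r ->
    `|f y - f z - \sum_i (y - z) 0 i * 'D_(delta_mx 0 i) f x| <= eta * `|y - z|.
Proof.
move=> [fd fc] eta eta0.
(* Each of the [m] coordinate steps gets an equal share of the error; [m.+1] avoids a division by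
   0. *)
pose eta' := eta / m.+1%:R.
have eta'0 : 0 < eta' by rewrite divr_gt0.
have [r r0 rP] : exists2 r, 0 < r & forall y, `|y - x| < r ->
   forall i : 'I_m, derivable f y (delta_mx 0 i) /\
      `|'D_(delta_mx 0 i) f y - 'D_(delta_mx 0 i) f x| <= eta'.
  apply/ball_normP.
  have /(filterI fd) : \forall y \near x, forall i : 'I_m,
      `|'D_(delta_mx 0 i) f y - 'D_(delta_mx 0 i) f x| <= eta'.
    apply: (@filter_forall _ _ (fun i y => `|'D_(delta_mx 0 i) f y
      - 'D_(delta_mx 0 i) f x| <= eta') (nbhs x)) => i.
    have /cvgrPdist_le/(_ _ eta'0) := fc i.
    by apply: filterS => y; rewrite distrC.
  by apply: filterS => y [dy ey] i.
exists r => // y z yr zr.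
pose p (k : nat) : 'rV[R]_m := \row_j (if (j < k)%N then y 0 j else z 0 j).
have p0 : p 0 = z by apply/rowP => j; rewrite mxE.
have pm : p m = y by apply/rowP => j; rewrite mxE ltn_ord.
have -> : f y - f z = \sum_(k < m) (f (p k.+1) - f (p k)).
  by rewrite -[in LHS]p0 -[in LHS]pm -(telescope_sumr (fun k => f (p k)))// big_mkord.
rewrite -sumrB; apply: le_trans (ler_norm_sum _ _ _) _.
have step (k : 'I_m) : `|f (p k.+1) - f (p k) - (y - z) 0 k * 'D_(delta_mx 0 k) f x|
    <= eta' * `|y - z|.
  set t := (y - z) 0 k; set d := 'D_(delta_mx 0 k) f x.
  have pk : p k.+1 = t *: delta_mx 0 k + p k.
    apply/rowP => j; rewrite !mxE eqxx/= ltnS leq_eqVlt.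
    have [->|jk] := eqVneq j k; first by rewrite eqxx ltnn mulr1 /t !mxE subrK.
    by rewrite -val_eqE in jk; rewrite (negbTE jk) mulr0 add0r.
  have inb u : 0 <= u <= 1 -> `|(u * t) *: delta_mx 0 k + p k - x| < r.
    move=> u01; apply: rV_norm_lt => // j; rewrite !mxE eqxx/=.
    have yj := le_lt_trans (rV_norm_coord (y - x) j) yr; rewrite !mxE in yj.
    have zj := le_lt_trans (rV_norm_coord (z - x) j) zr; rewrite !mxE in zj.
    have [e|jk] := eqVneq j k.
      subst j; rewrite ltnn mulr1 /t !mxE; exact: convex_norm_lt.
    by rewrite mulr0 add0r; case: ifP.
  pose g s := f (s *: delta_mx 0 k + p k) - s * d.
  have -> : f (p k.+1) - f (p k) - t * d = g t - g 0.
    by rewrite /g pk scale0r add0r mul0r subr0; ring.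
  apply: le_trans (_ : eta' * `|t| <= _); last first.
    by rewrite ler_wpM2l ?(ltW eta'0)//; exact: rV_norm_coord.
  apply: (@mvt_le g (fun s => 'D_(delta_mx 0 k) f (s *: delta_mx 0 k + p k) - d)).
    move=> u u01; apply: is_deriveB.
      by apply: (is_derive_line f (p k) (delta_mx 0 k) (u * t) _).1; apply: derivableP;
        have [] := rP _ (inb u u01) k.
    have := @is_deriveM _ _ id (cst d) (u * t) 1 1 0.
    by rewrite scaler0 add0r [_ *: _]mulr1; apply.
  by move=> u u01; have [] := rP _ (inb u u01) k.
apply: le_trans (ler_sum _ (fun k _ => step k)) _.
rewrite sumr_const card_ord -mulr_natl mulrA ler_wpM2r//.
by rewrite /eta' mulrCA ler_piMr ?(ltW eta0)// ler_pdivrMr// mul1r ler_nat.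
Qed.

End RowVectors.

Section Differentials.
Context {R : realType}.

Lemma sum_continuous (T : topologicalType) (I : Type) (r : seq I) (f : I -> T -> R) x :
  (forall i, {for x, continuous (f i)}) ->
  {for x, continuous (fun y => \sum_(i <- r) f i y)}.
Proof.
move=> fc; elim: r => [|i r IH].
  rewrite (_ : (fun _ => _) = cst 0); first exact: cst_continuous.
  by apply: funext => y; rewrite big_nil.
rewrite (_ : (fun _ => _) = (fun y => f i y + \sum_(j <- r) f j y)); last first.
  by apply: funext => y; rewrite big_cons.
by apply: continuousD; [exact: fc|exact: IH].
Qed.

Lemma mulmxr_continuous m p (M : 'M[R]_(m, p)) :
  continuous (fun v : 'rV[R]_m => v *m M).
Proof.
move=> x; apply: rV_continuous => j.
rewrite (_ : (fun _ => _) = (fun v : 'rV[R]_m => \sum_k v 0 k * M k j)); last first.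
  by apply: funext => v; rewrite mxE.
apply: sum_continuous => i; apply: continuousM; last exact: cst_continuous.
exact: coord_continuous.
Qed.

(** [C1at_strict] with second point [x], applied to each component, is a first-order expansion of
    [f] at [x]; uniqueness of the differential then identifies the Jacobian matrix. *)
Lemma C1at_differentiable_rV m p (f : 'rV[R]_m -> 'rV[R]_p) x :
  (forall j, C1at (fun y => f y 0 j) x) ->
  differentiable f x /\
  'J f x = \matrix_(i, j) 'D_(delta_mx 0 i) (fun y => f y 0 j) x.
Proof.
move=> fC; set M := \matrix_(i, j) _.
have Lc : continuous (mulmxr M : 'rV[R]_m -> 'rV[R]_p) by exact: mulmxr_continuous.
have L : f \o shift x = cst (f x) + mulmxr M +o_ (0 : 'rV[R]_m) id.
  apply/eqaddoP => eta eta0.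
  have H j := C1at_strict (fC j) eta0.
  have : \forall h \near (0 : 'rV[R]_m), forall j,
    `|f (h + x) 0 j - f x 0 j - \sum_i h 0 i * 'D_(delta_mx 0 i) (fun y => f y 0 j) x|
      <= eta * `|h|.
    apply: (@filter_forall _ _ (fun j h => `|f (h + x) 0 j - f x 0 j - \sum_i h 0 i *
     'D_(delta_mx 0 i) (fun y => f y 0 j) x| <= eta * `|h|) (nbhs (0 : 'rV[R]_m))) => j.
    have [r r0 rP] := H j; apply: (ball_normP (0 : 'rV[R]_m) _).2; exists r => // h.
    rewrite subr0 => hr.
    by have := rP (h + x) x; rewrite addrK subrr normr0; apply.
  apply: filterS => h hP; apply: rV_norm_le => [|j].
    by rewrite mulr_ge0// ltW.
  have := hP j; rewrite !mxE opprD addrA; congr (is_true (`|_ - _| <= _)).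
  by apply: eq_bigr => i _; rewrite !mxE.
have dE := diff_unique Lc L.
split; first by apply/diff_locallyP; rewrite dE.
by apply/matrixP => i j; rewrite mxE dE /= -rowE mxE.
Qed.

Lemma C1at_row1 m (f : 'rV[R]_m -> R) x : C1at f x ->
  forall j : 'I_1, C1at (fun y => (\row_(k < 1) f y) 0 j) x.
Proof. by move=> fC j; under eq_fun do rewrite mxE. Qed.

Lemma C1at_differentiable m (f : 'rV[R]_m -> R) x : C1at f x -> differentiable f x.
Proof.
move=> /C1at_row1/C1at_differentiable_rV[df _].
have -> : f = (fun N : 'rV[R]_1 => N 0 0 : R) \o (fun y => \row_(k < 1) f y).
  by apply: funext => y; rewrite /= mxE.
apply: differentiable_comp => //; exact: differentiable_coord.
Qed.

Lemma C1at_is_derive m (f : 'rV[R]_m -> R) x v : C1at f x ->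
  is_derive x v f (\sum_i v 0 i * 'D_(delta_mx 0 i) f x).
Proof.
move=> fC; have /C1at_differentiable_rV[df J] := C1at_row1 fC.
have := derivableP (diff_derivable (v := v) df).
rewrite deriveEjacobian// J => /is_derive_rV/(_ 0).
under eq_fun do rewrite mxE; rewrite mxE => H; apply: (is_derive_eq H).
by apply: eq_bigr => i _; rewrite mxE; under eq_fun do rewrite mxE.
Qed.

Lemma is_derive_line0 (V W : normedModType R) (f : V -> W) (x v : V) d :
  is_derive x v f d <-> is_derive (0 : R) 1 (fun t : R => f (t *: v + x)) d.
Proof. by have := @is_derive_line R V W f x v 0 d; rewrite scale0r add0r. Qed.

(** As [h] is only known to have a derivative in the direction [v], the chain rule for
    differentiable maps is applied to its restriction to the line through [x], a function of one
    variable. *)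
Lemma is_derive_diff_comp (V U W : normedModType R) (h : V -> U) (f : U -> W) x v w :
  is_derive x v h w -> differentiable f (h x) ->
  is_derive x v (f \o h) ('d f (h x) w).
Proof.
move=> /is_derive_line0[dh hw] df; apply/is_derive_line0.
set g := fun t : R => h (t *: v + x) in dh hw *.
have g0 : g 0 = h x by rewrite /g scale0r add0r.
have dg : differentiable g 0 by apply/derivable1_diffP.
rewrite -g0 in df *.
have dfg : differentiable (f \o g) 0 by exact: differentiable_comp.
rewrite (_ : (fun t : R => _) = f \o g)//.
apply: DeriveDef; first exact/derivable1_diffP.
by rewrite deriveE// diff_comp//= -hw [in RHS]deriveE.
Qed.

Lemma C1at_chain (V : normedModType R) m (h : V -> 'rV[R]_m) (f : 'rV[R]_m -> R) x v w :
  is_derive x v h w -> C1at f (h x) ->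
  is_derive x v (f \o h) (\sum_i w 0 i * 'D_(delta_mx 0 i) f (h x)).
Proof.
move=> hw fC; apply: (is_derive_eq (is_derive_diff_comp hw (C1at_differentiable fC))).
rewrite -deriveE; last exact: C1at_differentiable.
by have [_ ->] := C1at_is_derive w fC.
Qed.

Lemma fin_radius (I : finType) (P : I -> R -> Prop) :
  (forall i r r', 0 < r' -> r' <= r -> P i r -> P i r') ->
  (forall i, exists2 r, 0 < r & P i r) -> exists2 r, 0 < r & forall i, P i r.
Proof.
move=> Pm H.
have [r rP] := choice (fun i => let: ex_intro2 r r0 Pr := H i in
  ex_intro (fun r => 0 < r /\ P i r) r (conj r0 Pr)).
have m0 : 0 < \big[Num.min/1]_i r i.
  by apply/bigmin_gtP; split=> // i _; have [] := rP i.
exists (\big[Num.min/1]_i r i) => // i; have [ri Pi] := rP i.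
by apply: Pm Pi => //; exact: bigmin_le_cond.
Qed.

(** Strict differentiability with error 1 gives each component the constant 1 plus the sum of its
    absolute partial derivatives; [K] adds these up over the components. *)
Lemma C1at_lipschitz m p (f : 'rV[R]_m -> 'rV[R]_p) x :
  (forall j, C1at (fun y => f y 0 j) x) ->
  exists2 K, 0 <= K & exists2 r, 0 < r & forall y z, `|y - x| < r -> `|z - x| < r ->
    `|f y - f z| <= K * `|y - z|.
Proof.
move=> fC.
pose K := \sum_j (1 + \sum_i `|'D_(delta_mx 0 i) (fun y => f y 0 j) x|).
have Kj j : 0 <= 1 + \sum_i `|'D_(delta_mx 0 i) (fun y => f y 0 j) x|.
  by rewrite addr_ge0// sumr_ge0.
have K0 : 0 <= K by rewrite sumr_ge0.
exists K => //.
have [r r0 rP] : exists2 r, 0 < r & forall j y z, `|y - x| < r -> `|z - x| < r ->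
    `|f y 0 j - f z 0 j - \sum_i (y - z) 0 i *
      'D_(delta_mx 0 i) (fun y => f y 0 j) x| <= 1 * `|y - z|.
  apply: (@fin_radius _ (fun j r => forall y z, `|y - x| < r -> `|z - x| < r ->
    `|f y 0 j - f z 0 j - \sum_i (y - z) 0 i *
      'D_(delta_mx 0 i) (fun y => f y 0 j) x| <= 1 * `|y - z|)).
    by move=> j r r' _ r'r H y z yr zr; apply: H; exact: lt_le_trans r'r.
  by move=> j; exact: (C1at_strict (fC j) ltr01).
exists r => // y z yr zr; apply: rV_norm_le => [|j]; first by rewrite mulr_ge0.
apply: (@le_trans _ _ ((1 + \sum_i `|'D_(delta_mx 0 i) (fun y => f y 0 j) x|) * `|y - z|)).
  have := rP j y z yr zr; set S := \sum_i _ => rj.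
  have -> : (f y - f z) 0 j = (f y 0 j - f z 0 j - S) + S by rewrite !mxE subrK.
  apply: le_trans (ler_normD _ _) _; rewrite mulrDl lerD//.
  rewrite mulr_suml; apply: le_trans (ler_norm_sum _ _ _) _.
  apply: ler_sum => i _; rewrite normrM mulrC ler_wpM2l//; exact: rV_norm_coord.
rewrite ler_wpM2r// /K (bigD1 j)//= lerDl; exact: sumr_ge0.
Qed.

End Differentials.

(** * Germs of C^k functions *)

Section Germs.
Context {R : realType}.

(* The germ of f at x is C^k in terms of partial derivatives only; on open sets this agrees with
   Ck, which uses all directional derivatives. *)
Fixpoint ck m (k : nat) (f : 'rV[R]_m -> R) (x : 'rV[R]_m) : Prop :=
  if k is k'.+1 then
    (\forall y \near x, {for y, continuous f} /\
       forall i : 'I_m, derivable f y (delta_mx 0 i)) /\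
    forall i : 'I_m, ck k' ('D_(delta_mx 0 i) f) x
  else \forall y \near x, {for y, continuous f}.

Lemma ck_continuous_near m k (f : 'rV[R]_m -> R) x :
  ck k f x -> \forall y \near x, {for y, continuous f}.
Proof. by case: k => [//|k] [+ _]; apply: filterS => y []. Qed.

Lemma ck_continuous m k (f : 'rV[R]_m -> R) x : ck k f x -> {for x, continuous f}.
Proof. by move/ck_continuous_near/nbhs_singleton. Qed.

Lemma ckW m k (f : 'rV[R]_m -> R) x : ck k.+1 f x -> ck k f x.
Proof.
elim: k f => [|k IH] f; first exact: (@ck_continuous_near _ 1).
by move=> [fc fd]; split=> // i; exact: IH.
Qed.

Lemma ck_C1at m k (f : 'rV[R]_m -> R) x : ck k.+1 f x -> C1at f x.
Proof.
move=> [fc fd]; split; first by apply: filterS fc => y [].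
by move=> i; exact: ck_continuous (fd i).
Qed.

Lemma ck_open m k (f : 'rV[R]_m -> R) x : ck k f x -> \forall y \near x, ck k f y.
Proof.
elim: k f => [|k IH] f; first exact: near_join.
move=> [/near_join fc fd].
have H : \forall y \near x, forall i : 'I_m, ck k ('D_(delta_mx 0 i) f) y.
  by apply: near_forall => i; exact: IH (fd i).
by apply: (near_and fc H) => y yc yH; split.
Qed.

Lemma ck_near_eq m k (f g : 'rV[R]_m -> R) x :
  (\forall y \near x, f y = g y) -> ck k f x -> ck k g x.
Proof.
elim: k f g => [|k IH] f g fg.
  move=> fc; apply: (near_and (near_join fg) fc) => y fgy fy.
  by apply: near_eq_continuous fy; apply: filterS fgy => z ->.
move=> [fc fd]; have fg' := near_join fg; split.
  apply: (near_and fg' fc) => y fgy [fy dy]; split.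
    by apply: near_eq_continuous fy; apply: filterS fgy => z ->.
  by move=> i; exact: near_eq_derivable (dy i).
move=> i; apply: IH (fd i); apply: filterS fg' => y fgy.
exact: near_eq_derive.
Qed.

(** Allows the partial derivatives to be replaced by explicit formulas, to which an induction
    hypothesis on [k] can be applied. *)
Lemma ck_step m k (f : 'rV[R]_m -> R) (df : 'I_m -> 'rV[R]_m -> R) x :
  (\forall y \near x, {for y, continuous f}) ->
  (\forall y \near x, forall i, is_derive y (delta_mx 0 i) f (df i y)) ->
  (forall i, ck k (df i) x) -> ck k.+1 f x.
Proof.
move=> fc fd dk; split.
  by apply: (near_and fc fd) => y yc yd; split=> // i; have [] := yd i.
move=> i; apply: ck_near_eq (dk i); apply: filterS fd => y yd.
by have [_ ->] := yd i.
Qed.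

Lemma ck_is_derive_near m k (f : 'rV[R]_m -> R) x : ck k.+1 f x ->
  \forall y \near x, forall i, is_derive y (delta_mx 0 i) f ('D_(delta_mx 0 i) f y).
Proof. by move=> [+ _]; apply: filterS => y [_ yd] i; exact: derivableP. Qed.

Lemma ck_cst m k (c : R) (x : 'rV[R]_m) : ck k (fun=> c) x.
Proof.
elim: k c => [|k IH] c; first by apply: near_all => y; exact: cst_continuous.
apply: (@ck_step _ _ _ (fun _ _ => 0)) => //; first by apply: near_all => y; exact: cst_continuous.
by apply: near_all => y i; exact: is_derive_cst.
Qed.

Lemma ckD m k (f g : 'rV[R]_m -> R) x :
  ck k f x -> ck k g x -> ck k (fun y => f y + g y) x.
Proof.
elim: k f g => [|k IH] f g fk gk.
  by apply: (near_and fk gk) => y fy gy; exact: continuousD.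
have fc := ck_continuous_near fk; have gc := ck_continuous_near gk.
have fd := ck_is_derive_near fk; have gd := ck_is_derive_near gk.
apply: (ck_step (df := fun i y => 'D_(delta_mx 0 i) f y + 'D_(delta_mx 0 i) g y)).
- by apply: (near_and fc gc) => y fy gy; exact: continuousD.
- by apply: (near_and fd gd) => y fy gy i; exact: is_deriveD.
- by move=> i; apply: IH; [exact: fk.2|exact: gk.2].
Qed.

Lemma ckM m k (f g : 'rV[R]_m -> R) x :
  ck k f x -> ck k g x -> ck k (fun y => f y * g y) x.
Proof.
elim: k f g => [|k IH] f g fk gk.
  by apply: (near_and fk gk) => y fy gy; exact: continuousM.
have fc := ck_continuous_near fk; have gc := ck_continuous_near gk.
have fd := ck_is_derive_near fk; have gd := ck_is_derive_near gk.
apply: (ck_step (df := fun i y => f y * 'D_(delta_mx 0 i) g y + g y * 'D_(delta_mx 0 i) f y)).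
- by apply: (near_and fc gc) => y fy gy; exact: continuousM.
- by apply: (near_and fd gd) => y fy gy i; exact: is_deriveM.
- move=> i; apply: ckD; apply: IH; [exact: ckW|exact: gk.2|exact: ckW|exact: fk.2].
Qed.

Lemma ck_scale m k c (f : 'rV[R]_m -> R) x : ck k f x -> ck k (fun y => c * f y) x.
Proof. by apply: ckM; exact: ck_cst. Qed.

Lemma ckN m k (f : 'rV[R]_m -> R) x : ck k f x -> ck k (fun y => - f y) x.
Proof. by move=> /(ck_scale (-1)); under eq_fun do rewrite mulN1r. Qed.

Lemma ck_sum m k (I : Type) (r : seq I) (P : pred I) (f : I -> 'rV[R]_m -> R) x :
  (forall i, ck k (f i) x) -> ck k (fun y => \sum_(i <- r | P i) f i y) x.
Proof.
move=> fk; elim: r => [|i r IH].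
  by under eq_fun do rewrite big_nil; exact: ck_cst.
under eq_fun do rewrite big_cons.
by case: (P i) => //; exact: ckD.
Qed.

Lemma ck_prod m k (I : Type) (r : seq I) (P : pred I) (f : I -> 'rV[R]_m -> R) x :
  (forall i, ck k (f i) x) -> ck k (fun y => \prod_(i <- r | P i) f i y) x.
Proof.
move=> fk; elim: r => [|i r IH].
  by under eq_fun do rewrite big_nil; exact: ck_cst.
under eq_fun do rewrite big_cons.
by case: (P i) => //; exact: ckM.
Qed.

Lemma ckV m k (f : 'rV[R]_m -> R) x : f x != 0 ->
  ck k f x -> ck k (fun y => (f y)^-1) x.
Proof.
move=> fx0; have near0 l : ck l f x -> \forall y \near x, f y != 0.
  by move=> /ck_continuous fc; exact: cvgr_neq0 fc fx0.
have cV l : ck l f x -> \forall y \near x, {for y, continuous (fun y => (f y)^-1)}.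
  move=> fl; apply: (near_and (near0 l fl) (ck_continuous_near fl)) => y y0 yc; exact: continuousV.
elim: k => [|k IH] fk; first exact: cV fk.
have fd := ck_is_derive_near fk.
(* The derivative is written as a product containing the inverse of [f] itself, so that the
   induction hypothesis covers it. *)
apply: (ck_step (df := fun i y => - ((f y)^-1 * (f y)^-1) * 'D_(delta_mx 0 i) f y)).
- exact: cV fk.
- apply: (near_and (near0 _ fk) fd) => y y0 yd i.
  have [d e] := yd i; apply: DeriveDef; first exact: derivableV.
  by rewrite deriveV// -expr2 exprVn.
- move=> i; apply: ckM; last exact: fk.2.
  by apply: ckN; apply: ckM; apply: IH; exact: ckW.
Qed.

Lemma is_derive_coord m (y v : 'rV[R]_m) (i : 'I_m) :
  is_derive y v (fun x : 'rV[R]_m => x 0 i) (v 0 i).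
Proof. exact: (is_derive_rV id y v v).1 (is_derive_id y v) i. Qed.

Lemma ck_coord m k (i : 'I_m) (x : 'rV[R]_m) : ck k (fun y : 'rV[R]_m => y 0 i) x.
Proof.
case: k => [|k]; first by apply: near_all => y; exact: coord_continuous.
apply: (ck_step (df := fun j _ => (delta_mx 0 j : 'rV[R]_m) 0 i)).
- by apply: near_all => y; exact: coord_continuous.
- by apply: near_all => y j; exact: is_derive_coord.
- by move=> j; exact: ck_cst.
Qed.

Lemma ck_rV_continuous_near m p k (h : 'rV[R]_m -> 'rV[R]_p) x :
  (forall j, ck k (fun y => h y 0 j) x) -> \forall y \near x, {for y, continuous h}.
Proof.
move=> hk; apply: (near_imp (near_forall (fun j => ck_continuous_near (hk j)))) => y;
  exact: rV_continuous.
Qed.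

Lemma ck_comp m p k (h : 'rV[R]_m -> 'rV[R]_p) (g : 'rV[R]_p -> R) x :
  (forall j, ck k (fun y => h y 0 j) x) -> ck k g (h x) -> ck k (fun y => g (h y)) x.
Proof.
move=> hk; have hc := ck_rV_continuous_near hk; have hcx := nbhs_singleton hc.
have gc l (g' : 'rV[R]_p -> R) : ck l g' (h x) ->
    \forall y \near x, {for y, continuous (fun y => g' (h y))}.
  move=> /ck_continuous_near/hcx gl; apply: (near_and hc gl) => y yh yg; exact: continuous_comp.
(* The chain rule brings in the partial derivatives of [g], so the induction must be general in
   [g]. *)
elim: k g hk => [|k IH] g hk gk; first exact: gc gk.
have hd := near_forall (fun j => ck_is_derive_near (hk j)).
have gC : \forall y \near x, C1at g (h y).
  have /hcx : \forall z \near h x, C1at g z.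
    by apply: (near_imp (ck_open gk)) => z; exact: ck_C1at.
  exact.
apply: (ck_step (df := fun i y => \sum_j 'D_(delta_mx 0 i) (fun z => h z 0 j) y *
   'D_(delta_mx 0 j) g (h y))).
- exact: gc gk.
- apply: (near_and hd gC) => y yh yC i.
  pose w : 'rV[R]_p := \row_j 'D_(delta_mx 0 i) (fun z => h z 0 j) y.
  have yw : is_derive y (delta_mx 0 i) h w.
    by apply/is_derive_rV => j; rewrite mxE; exact: yh.
  apply: (is_derive_eq (C1at_chain yw yC)).
  by apply: eq_bigr => j _; rewrite mxE.
- move=> i; apply: ck_sum => j; apply: ckM; first exact: (hk j).2.
  by apply: (IH ('D_(delta_mx 0 j) g)); [move=> l; exact: ckW (hk l)|exact: gk.2].
Qed.

Lemma Cinfty_ck m (U : set 'rV[R]_m) f : open U -> Cinfty U f ->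
  forall x, U x -> forall k, ck k f x.
Proof.
move=> oU fU x Ux k.
have : Ck k U f by exact: fU.
elim: k f {fU} => [|k IH] f.
  move=> [fc _]; apply: (near_imp (open_nbhs_nbhs (conj oU Ux))) => y Uy; apply: fc; exact: mem_set.
move=> [fc fd]; split; last by move=> i; apply: IH; exact: (fd _).2.
apply: (near_imp (open_nbhs_nbhs (conj oU Ux))) => y Uy; split.
  by apply: fc; exact: mem_set.
by move=> i; apply: (fd _).1; exact: mem_set.
Qed.

(** [Ck] asks for derivatives in every direction; a C^1 germ is differentiable, so these are linear
    combinations of the partial derivatives. *)
Lemma ck_Cinfty m (U : set 'rV[R]_m) f : open U ->
  (forall x, U x -> forall k, ck k f x) -> Cinfty U f.
Proof.
move=> oU fU k.
have {}fU x : U x -> ck k f x by move=> Ux; exact: fU.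
elim: k f fU => [|k IH] f fU.
  by split=> // x /set_mem /fU; exact: ck_continuous.
split; first by move=> x /set_mem /fU; exact: ck_continuous.
move=> v; split.
  by move=> x /set_mem /fU /ck_C1at /C1at_is_derive -/(_ v) [].
apply: IH => x Ux.
apply: (@ck_near_eq _ _ (fun y => \sum_i v 0 i * 'D_(delta_mx 0 i) f y)).
  apply: (near_imp (open_nbhs_nbhs (conj oU Ux))) => y /fU /ck_C1at.
  by move=> /C1at_is_derive -/(_ v) [_ ->].
by apply: ck_sum => i; apply: ck_scale; exact: (fU x Ux).2.
Qed.

End Germs.

(** * Second derivatives, bootstrapping and smoothness of matrix operations *)

Section SecondOrder.
Context {R : realType}.

Lemma norm_delta_le m (i : 'I_m) : `|delta_mx 0 i : 'rV[R]_m| <= 1.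
Proof.
apply: rV_norm_le => // j; rewrite mxE eqxx/=.
by case: (j == i); rewrite ?normr1 ?normr0.
Qed.

(* The second difference on the left is symmetric in i and j. *)
Lemma second_difference m (f : 'rV[R]_m -> R) x (i j : 'I_m) eta : ck 2 f x -> 0 < eta ->
  exists2 r, 0 < r & forall t, 0 < t -> t < r ->
   `|f (t *: delta_mx 0 i + (t *: delta_mx 0 j + x)) - f (t *: delta_mx 0 i + x)
      - (f (t *: delta_mx 0 j + x) - f x)
      - t * (t * 'D_(delta_mx 0 j) ('D_(delta_mx 0 i) f) x)| <= eta * t * t.
Proof.
move=> fk eta0.
have [r1 r10 H1] := C1at_strict (ck_C1at (k := 0) (fk.2 i)) eta0.
have [r2 r20 H2] := (ball_normP x _).1 (ck_is_derive_near fk).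
(* The farthest corner of the square with sides [t] along the axes [i] and [j] lies within 2t of
   [x], hence the half. *)
exists (Num.min r1 r2 / 2) => [|t t0 tr]; first by rewrite divr_gt0// lt_min r10.
have tr' : t + t < Num.min r1 r2 by rewrite -mulr2n -mulr_natr -ltr_pdivlMr.
have [tr1 tr2] : t + t < r1 /\ t + t < r2.
  by move: tr'; rewrite lt_min => /andP[].
have n1 k u : 0 <= u <= 1 -> `|(u * t) *: (delta_mx 0 k : 'rV[R]_m)| <= t.
  move=> /andP[u0 u1]; rewrite normrZ ger0_norm ?mulr_ge0// ?(ltW t0)//.
  apply: le_trans (_ : t * 1 <= _); last by rewrite mulr1.
  by apply: ler_pM; rewrite ?mulr_ge0 ?(ltW t0) ?norm_delta_le// ler_piMl// ltW.
have nt k : `|t *: (delta_mx 0 k : 'rV[R]_m)| <= t.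
  by have := n1 k 1; rewrite mul1r; apply; rewrite ler01 lexx.
set d := 'D_(delta_mx 0 j) _ x.
(* The increment of [f] in direction [j], viewed along the axis [i] and corrected by its expected
   linear growth; its derivative is at most [eta * t], so the mean value theorem in direction [i]
   concludes. *)
pose g s := f (s *: delta_mx 0 i + (t *: delta_mx 0 j + x)) - f (s *: delta_mx 0 i + x)
  - s * (t * d).
have -> : f (t *: delta_mx 0 i + (t *: delta_mx 0 j + x)) - f (t *: delta_mx 0 i + x)
      - (f (t *: delta_mx 0 j + x) - f x) - t * (t * d) = g t - g 0.
  by rewrite /g scale0r !add0r; ring.
rewrite -[X in _ <= _ * X](gtr0_norm t0).
pose dg s := 'D_(delta_mx 0 i) f (s *: delta_mx 0 i + (t *: delta_mx 0 j + x)) -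
  'D_(delta_mx 0 i) f (s *: delta_mx 0 i + x) - t * d.
have b1 u : 0 <= u <= 1 -> `|(u * t) *: delta_mx 0 i + x - x| <= t.
  by move=> u01; rewrite addrK n1.
have b2 u : 0 <= u <= 1 ->
    `|(u * t) *: delta_mx 0 i + (t *: delta_mx 0 j + x) - x| <= t + t.
  move=> u01; rewrite addrA addrK; apply: le_trans (ler_normD _ _) _.
  by rewrite lerD// n1.
have tt : t <= t + t by rewrite lerDl ltW.
apply: (@mvt_le _ g dg) => u u01.
  apply: is_deriveB; first apply: is_deriveB.
  - apply: (is_derive_line _ _ _ _ _).1; apply: H2.
    exact: le_lt_trans (b2 u u01) _.
  - apply: (is_derive_line _ _ _ _ _).1; apply: H2.
    exact: le_lt_trans (b1 u u01) (le_lt_trans tt tr2).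
  - have := @is_deriveM _ _ id (cst (t * d)) (u * t) 1 1 0.
    by rewrite scaler0 add0r [_ *: _]mulr1; apply.
have := H1 _ _ (le_lt_trans (b2 u u01) tr1) (le_lt_trans (b1 u u01) (le_lt_trans tt tr1)).
rewrite [X in `|_ - \sum_(_ < _) _| <= eta * `|X|](_ : _ = t *: delta_mx 0 j); last first.
  by rewrite opprD addrACA subrr add0r addrK.
rewrite (bigD1 j)//= big1 ?addr0 => [|k kj]; last first.
  by rewrite opprD addrACA subrr add0r addrK !mxE (negbTE kj) andbF mulr0 mul0r.
rewrite opprD addrACA subrr add0r addrK !mxE !eqxx mulr1 => H.
by apply: le_trans H _; rewrite ler_wpM2l// ltW.
Qed.

(** The second differences for (i, j) and (j, i) coincide, and each approximates its mixed
    derivative times t^2 with error at most (e / 2) t^2; dividing by t^2 leaves [e]. *)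
Lemma schwarz m (f : 'rV[R]_m -> R) x (i j : 'I_m) : ck 2 f x ->
  'D_(delta_mx 0 i) ('D_(delta_mx 0 j) f) x = 'D_(delta_mx 0 j) ('D_(delta_mx 0 i) f) x.
Proof.
move=> fk; apply/eqP; rewrite -subr_eq0 -normr_le0; apply/ler_addgt0Pl => e e0.
rewrite addr0; have e2 : 0 < e / 2 by rewrite divr_gt0.
have [r1 r10 H1] := second_difference i j fk e2.
have [r2 r20 H2] := second_difference j i fk e2.
set t := Num.min r1 r2 / 2.
have m0 : 0 < Num.min r1 r2 by rewrite lt_min r10.
have t0 : 0 < t by rewrite divr_gt0.
have tm : t < Num.min r1 r2 by rewrite /t ltr_pdivrMr// mulr_natr mulr2n ltrDl.
have [tr1 tr2] : t < r1 /\ t < r2 by move: tm; rewrite lt_min => /andP[].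
have := H1 t t0 tr1; have := H2 t t0 tr2.
rewrite [t *: delta_mx 0 j + (_ + _)]addrCA.
set a := f _; set b := f _; set c := f _.
set p := 'D_(delta_mx 0 i) _ x; set q := 'D_(delta_mx 0 j) _ x => A B.
have tt0 : 0 < t * t by rewrite mulr_gt0.
rewrite -(ler_pM2r tt0) -[X in _ * X <= _](gtr0_norm tt0) -normrM.
have -> : (p - q) * (t * t) = (a - c - (b - f x) - t * (t * q)) -
   (a - b - (c - f x) - t * (t * p)) by ring.
apply: le_trans (ler_normB _ _) _; apply: le_trans (lerD B A) _.
by have -> : e / 2 * t * t + e / 2 * t * t = e * (t * t) by field.
Qed.

(** The gradient is Lipschitz near [x], so on the segment from [z] to [y] it deviates from its value
    at [z] by at most [K * |y - z|] in each of the [m] coordinates. The constant is uniform in the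
    base point [z], because the expansion will be used along a moving curve. *)
Lemma taylor2 m (f : 'rV[R]_m -> R) x : ck 2 f x ->
  exists2 C, 0 <= C & exists2 r, 0 < r & forall y z, `|y - x| < r -> `|z - x| < r ->
    `|f y - f z - \sum_i (y - z) 0 i * 'D_(delta_mx 0 i) f z| <= C * `|y - z| ^+ 2.
Proof.
move=> fk.
have GC j : C1at (fun y => (\row_i 'D_(delta_mx 0 i) f y : 'rV[R]_m) 0 j) x.
  by under eq_fun do rewrite mxE; exact: (ck_C1at (k := 0) (fk.2 j)).
have [K K0 [r1 r10 H1]] := C1at_lipschitz GC.
have fo : \forall y \near x, C1at f y.
  by apply: (near_imp (ck_open fk)) => y; exact: ck_C1at.
have [r2 r20 H2] := (ball_normP x _).1 fo.
exists (m%:R * K); first by rewrite mulr_ge0.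
exists (Num.min r1 r2) => [|y z]; first by rewrite lt_min r10.
move=> yr zr; pose v := y - z.
have inb u : 0 <= u <= 1 -> `|u *: v + z - x| < Num.min r1 r2.
  move=> u01; apply: rV_norm_lt => [|j]; first by rewrite lt_min r10.
  rewrite !mxE; have := le_lt_trans (rV_norm_coord (y - x) j) yr.
  have := le_lt_trans (rV_norm_coord (z - x) j) zr; rewrite !mxE => zj yj.
  exact: convex_norm_lt.
pose c := \sum_i v 0 i * 'D_(delta_mx 0 i) f z.
pose g s := f (s *: v + z) - s * c.
have -> : f y - f z - c = g 1 - g 0.
  by rewrite /g scale1r subrK scale0r add0r; ring.
rewrite -[leRHS]mulr1 -[X in _ <= _ * X](@normr1 R).
pose dg s := \sum_i v 0 i * 'D_(delta_mx 0 i) f (s *: v + z) - c.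
apply: (@mvt_le _ g dg) => u u01; rewrite mulr1.
  have {}u01 := inb u u01.
  apply: is_deriveB.
    apply: (is_derive_line _ _ _ _ _).1; apply: C1at_is_derive; apply: H2.
    by apply: lt_le_trans u01 _; rewrite ge_min lexx orbT.
  have := @is_deriveM _ _ id (cst c) u 1 1 0.
  by rewrite scaler0 add0r [_ *: _]mulr1; apply.
rewrite /dg /c -sumrB; apply: le_trans (ler_norm_sum _ _ _) _.
have step (i : 'I_m) : `|v 0 i * 'D_(delta_mx 0 i) f (u *: v + z) - v 0 i * 'D_(delta_mx 0 i) f z|
   <= K * `|v| ^+ 2.
  rewrite -mulrBr normrM expr2 mulrCA.
  apply: ler_pM => //; first exact: rV_norm_coord.
  have zr1 : `|z - x| < r1 by apply: lt_le_trans zr _; rewrite ge_min lexx.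
  have ur1 : `|u *: v + z - x| < r1 by apply: lt_le_trans (inb u u01) _; rewrite ge_min lexx.
  have := rV_norm_coord ((\row_i 'D_(delta_mx 0 i) f (u *: v + z)) -
    (\row_i 'D_(delta_mx 0 i) f z)) i.
  rewrite !mxE => /le_trans; apply; apply: le_trans (H1 _ _ ur1 zr1) _.
  rewrite addrK normrZ ler_wpM2l//; have /andP[u0 u1] := u01.
  by rewrite ger0_norm// ler_piMl.
apply: le_trans (ler_sum _ (fun i _ => step i)) _.
by rewrite sumr_const card_ord -[leLHS]mulr_natl -/v expr2 !mulrA.
Qed.

(** The derivatives of [f] are smooth functions of [f] itself: if [f] is C^k then so are they, and
    therefore [f] is C^(k+1). *)
Lemma ck_bootstrap m p (f : 'rV[R]_m -> 'rV[R]_p) (G : 'I_m -> 'I_p -> 'rV[R]_p -> R) x :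
  (\forall y \near x, {for y, continuous f}) ->
  (\forall y \near x, forall i j,
     is_derive y (delta_mx 0 i) (fun z => f z 0 j) (G i j (f y))) ->
  (forall i j k, ck k (G i j) (f x)) ->
  forall k j, ck k (fun y => f y 0 j) x.
Proof.
move=> fc fd Gk.
have fjc j : \forall y \near x, {for y, continuous (fun y => f y 0 j)}.
  apply: (near_imp fc) => y yc.
  exact: (continuous_comp yc (@coord_continuous _ _ _ 0 j (f y))).
elim=> [|k IH] j; first exact: fjc.
apply: (ck_step (df := fun i y => G i j (f y))) => //.
  by apply: (near_imp fd) => y yd i; exact: yd.
by move=> i; apply: ck_comp.
Qed.

Lemma ck_mulmx q m n p k (A : 'rV[R]_q -> 'M[R]_(m, n)) (B : 'rV[R]_q -> 'M[R]_(n, p)) x :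
  (forall i j, ck k (fun y => A y i j) x) -> (forall i j, ck k (fun y => B y i j) x) ->
  forall i j, ck k (fun y => (A y *m B y) i j) x.
Proof.
move=> Ak Bk i j; under eq_fun do rewrite mxE.
by apply: ck_sum => l; exact: ckM.
Qed.

Lemma ck_det q n k (A : 'rV[R]_q -> 'M[R]_n) x :
  (forall i j, ck k (fun y => A y i j) x) -> ck k (fun y => \det (A y)) x.
Proof.
move=> Ak; apply: ck_sum => s; apply: ck_scale.
exact: ck_prod.
Qed.

Lemma ck_invmx q n k (A : 'rV[R]_q -> 'M[R]_n) x : A x \in unitmx ->
  (forall i j, ck k (fun y => A y i j) x) ->
  forall i j, ck k (fun y => invmx (A y) i j) x.
Proof.
move=> Ax Ak i j; have dk := ck_det Ak.
have d0 : \det (A x) != 0 by rewrite -unitfE -unitmxE.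
(* Cramer's formula. It is only claimed near [x]: where [A y] is singular, [invmx] returns [A y]
   itself. *)
apply: (@ck_near_eq _ _ _ (fun y => (\det (A y))^-1 *
   ((-1) ^+ (j + i) * \det (row' j (col' i (A y)))))).
  have : \forall y \near x, \det (A y) != 0 by exact: cvgr_neq0 (ck_continuous dk) d0.
  move/near_imp; apply => y yd.
  by rewrite /invmx unitmxE unitfE yd !mxE.
apply: ckM; first exact: ckV.
apply: ck_scale; apply: ck_det => a b.
by under eq_fun do rewrite !mxE.
Qed.

End SecondOrder.

(** * Ordinary differential equations *)

Section ODE.
Context {R : realType}.

(** The intervals of radius 2 C 2^-n around [u n] are nested; the limit is the supremum of their
    lower ends, which also gives the explicit rate. *)
Lemma geometric_limit_real (u : nat -> R) C :
  (forall n, `|u n.+1 - u n| <= C * 2^-1 ^+ n) ->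
  exists l, forall n, `|u n - l| <= 2 * C * 2^-1 ^+ n.
Proof.
move=> uC; pose h (n : nat) : R := 2^-1 ^+ n.
have hS n : h n = 2 * h n.+1 by rewrite /h exprS mulrA divff// mul1r.
have step n : u n - 2 * C * h n <= u n.+1 - 2 * C * h n.+1 /\
    u n.+1 + 2 * C * h n.+1 <= u n + 2 * C * h n.
  have := uC n; rewrite -/(h n) ler_norml => /andP[A B].
  have e : C * h n = 2 * (C * h n.+1) by rewrite hS; ring.
  by rewrite -!(mulrA 2); split; lra.
have mono k n : u n - 2 * C * h n <= u (n + k)%N - 2 * C * h (n + k)%N /\
    u (n + k)%N + 2 * C * h (n + k)%N <= u n + 2 * C * h n.
  elim: k => [|k [IH1 IH2]]; first by rewrite addn0.
  by rewrite addnS; have [s1 s2] := step (n + k)%N; split; [exact: le_trans s1|exact: le_trans IH2].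
have C0 : 0 <= C by have := uC 0%N; rewrite expr0 mulr1; exact: le_trans.
have h0 n : 0 <= h n by rewrite exprn_ge0.
have ab n k : u n - 2 * C * h n <= u k + 2 * C * h k.
  have [nk|/ltnW kn] := leqP n k.
    have [+ _] := mono (k - n)%N n; rewrite subnKC// => /le_trans; apply.
    by rewrite lerD2l -subr_ge0 opprK addr_ge0// !mulr_ge0.
  have [_] := mono (n - k)%N k; rewrite subnKC//; apply: le_trans.
  by rewrite lerD2l -subr_ge0 opprK addr_ge0// !mulr_ge0.
pose A : set R := range (fun n => u n - 2 * C * h n).
have A0 : A !=set0 by exists (u 0%N - 2 * C * h 0%N), 0%N.
have Aub k : ubound A (u k + 2 * C * h k) by move=> _ [n _ <-]; exact: ab.
exists (sup A) => n; rewrite -/(h n) ler_distlC; apply/andP; split.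
  apply: ub_le_sup; last by exists n.
  by exists (u 0%N + 2 * C * h 0%N).
exact: ge_sup.
Qed.

Lemma geometric_limit m (u : nat -> 'rV[R]_m) C :
  (forall n, `|u n.+1 - u n| <= C * 2^-1 ^+ n) ->
  exists l, forall n, `|u n - l| <= 2 * C * 2^-1 ^+ n.
Proof.
move=> uC.
have C0 : 0 <= C by have := uC 0%N; rewrite expr0 mulr1; exact: le_trans.
have /choice[l lP] : forall j : 'I_m, exists l, forall n, `|u n 0 j - l| <= 2 * C * 2^-1 ^+ n.
  move=> j; apply: geometric_limit_real => n.
  by apply: le_trans (uC n); have := rV_norm_coord (u n.+1 - u n) j; rewrite !mxE.
exists (\row_j l j) => n; apply: rV_norm_le => [|j]; last by rewrite !mxE.
by rewrite !mulr_ge0// exprn_ge0.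
Qed.

Lemma uniform_limit_continuous (V W : normedModType R) (u : nat -> V -> W) (l : V -> W) C x :
  (forall n, {for x, continuous (u n)}) ->
  (forall n y, `|u n y - l y| <= C * 2^-1 ^+ n) -> {for x, continuous l}.
Proof.
move=> uc ul; apply/cvgrPdist_le => e e0.
have C0 : 0 <= C by have := ul 0%N x; rewrite expr0 mulr1; exact: le_trans.
have e3 : 0 < e / 3 by rewrite divr_gt0.
have [n nP] := half_pow_small C e3.
have /cvgrPdist_le /(_ _ e3) := uc n.
apply: filterS => y xy.
have -> : l x - l y = (u n x - u n y) - (u n x - l x) + (u n y - l y).
  by rewrite opprB [u n x - _ + _]addrC subrKA subrKA.
apply: le_trans (ler_normD _ _) _.
have -> : e = e / 3 + e / 3 + e / 3 by field.
apply: lerD; last exact: le_trans (ul n y) nP.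
apply: le_trans (ler_normB _ _) _; apply: lerD => //.
exact: le_trans (ul n x) nP.
Qed.

Lemma local_primitive (f : R -> R) : continuous f ->
  exists F : R -> R, F 0 = 0 /\ forall t : R, `|t| < 1 -> is_derive t 1 F (f t).
Proof.
move=> fc.
(* Integrating from -1 makes 0 an interior point of the interval on which the fundamental theorem
   applies; the value at 0 is subtracted afterwards. *)
pose F x := Rintegral lebesgue_measure `[-1, x] f.
have Fd (t : R) : `|t| < 1 -> is_derive t 1 F (f t).
  rewrite ltr_norml => /andP[t1 t2].
  have fi : lebesgue_measure.-integrable `[(-1 : R), 1] (EFin \o f).
    apply: continuous_compact_integrable; first exact: segment_compact.
    exact: continuous_subspaceT.
  have [d e] := @continuous_FTC1_closed R f (-1) t 1 t2 fi t1 (fc t).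
  by apply: DeriveDef; [exact: d|rewrite -derive1E; exact: e].
exists (fun x => F x - F 0); rewrite subrr; split=> // t t1.
rewrite -[f t]subr0; apply: is_deriveB; first exact: Fd.
Qed.

Definition clamp (a b t : R) : R := Num.max a (Num.min b t).

Lemma clamp_in a b t : a <= b -> a <= clamp a b t <= b.
Proof. by move=> ab; rewrite /clamp le_max lexx/= ge_max ab ge_min lexx. Qed.

Lemma clamp_id a b t : a <= t <= b -> clamp a b t = t.
Proof. by case/andP=> a1 b1; rewrite /clamp min_r// max_r. Qed.

Lemma clamp_lipschitz a b s t : `|clamp a b s - clamp a b t| <= `|s - t|.
Proof.
rewrite /clamp /Num.max /Num.min ler_norml.
have := ler_norm (s - t); have := ler_norm (t - s); rewrite (distrC t s).
by case: (ltP b s); case: (ltP b t); case: (ltP a b); case: (ltP a s); case: (ltP a t) => *;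
  apply/andP; split; lra.
Qed.

Lemma lipschitz_continuous (V W : normedModType R) (f : V -> W) K :
  (forall y z, `|f y - f z| <= K * `|y - z|) -> continuous f.
Proof.
move=> fK x; apply/cvgrPdist_le => e e0.
have K1 : 0 < `|K| + 1 by rewrite ltr_wpDl.
apply: near_imp (_ : \forall y \near x, `|x - y| <= e / (`|K| + 1)) _.
  by have /cvgrPdist_le := @cvg_id _ (nbhs x); apply; rewrite divr_gt0.
move=> y xy; apply: le_trans (fK x y) _.
apply: (@le_trans _ _ ((`|K| + 1) * `|x - y|)).
  by rewrite ler_wpM2r// (le_trans (ler_norm K))// lerDl.
by rewrite mulrC -ler_pdivlMr.
Qed.

(* Picard iteration; time is clamped to [-e, e] so that the sup norm estimates hold on all of R. *)
Lemma picard m (f : 'rV[R]_m -> 'rV[R]_m) K e (q : 'rV[R]_m) :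
  (forall y z, `|f y - f z| <= K * `|y - z|) -> 0 <= K ->
  0 < e -> e < 1 -> K * e <= 2^-1 ->
  exists y : R -> 'rV[R]_m, [/\ y 0 = q, continuous y &
    forall t : R, `|t| < e -> is_derive t 1 y (f (y t))].
Proof.
move=> fK K0 e0 e1 Ke.
have fc := lipschitz_continuous fK.
(* Primitives are chosen once for all functions, with [g] itself as a dummy value when [g] is not
   continuous. *)
have /choice[P PP] : forall g : R -> R, exists F : R -> R, continuous g ->
    F 0 = 0 /\ forall t : R, `|t| < 1 -> is_derive t 1 F (g t).
  move=> g; have [/local_primitive[F FP]|ng] := pselect (continuous g); first by exists F.
  by exists g.
pose cl t := clamp (- e) e t.
have ee : - e <= e by lra.
have cle t : `|cl t| <= e by rewrite ler_norml; exact: clamp_in.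
have cl1 t u : 0 <= u <= 1 -> `|u * cl t| < 1.
  move=> /andP[u0 u1]; apply: le_lt_trans e1; rewrite normrM -[e]mul1r.
  by apply: ler_pM => //; rewrite ger0_norm.
have clc : continuous cl.
  by apply: (@lipschitz_continuous _ _ _ 1) => s t; rewrite mul1r; exact: clamp_lipschitz.
have cl0 : cl 0 = 0 by rewrite /cl clamp_id// oppr_le0 ltW.
pose Pr (u : R -> 'rV[R]_m) t : 'rV[R]_m := \row_j P (fun s => f (u s) 0 j) t.
have fuc (u : R -> 'rV[R]_m) : continuous u -> forall j, continuous (fun s => f (u s) 0 j).
  move=> uc j s.
  apply: (@continuous_comp _ _ _ (fun s => f (u s)) (fun x : 'rV[R]_m => x 0 j)).
    by apply: continuous_comp; [exact: uc|exact: fc].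
  exact: coord_continuous.
have Pr0 u : continuous u -> Pr u 0 = 0.
  by move=> uc; apply/rowP => j; rewrite !mxE; have [] := PP _ (fuc u uc j).
have Prd u (t : R) : continuous u -> `|t| < 1 -> is_derive t 1 (Pr u) (f (u t)).
  move=> uc t1; apply/is_derive_rV => j; under eq_fun do rewrite mxE.
  by have [_] := PP _ (fuc u uc j); apply.
pose T u t := q + Pr u (cl t).
have Tc u : continuous u -> continuous (T u).
  move=> uc t; apply: (@continuousD _ _ _ (cst q) (fun t => Pr u (cl t)));
    first exact: cst_continuous.
  apply: (@continuous_comp _ _ _ cl (Pr u)); first exact: clc.
  apply: differentiable_continuous; apply/derivable1_diffP.
  by have := cl1 t 1; rewrite mul1r ler01 lexx => /(_ isT)/(Prd u _ uc)[].
(* Because K e <= 1/2, the integral operator [T] halves the uniform distance. *)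
have TT u v c : continuous u -> continuous v -> 0 <= c ->
    (forall s, `|u s - v s| <= c) -> forall t, `|T u t - T v t| <= c / 2.
  move=> uc vc c0 uv t.
  have -> : T u t - T v t = (Pr u \- Pr v) (cl t) - (Pr u \- Pr v) 0.
    by rewrite /T opprD addrACA subrr add0r/= !Pr0// subrr subr0.
  apply: (@le_trans _ _ (K * c * `|cl t|)); last first.
    rewrite mulrAC [leRHS]mulrC ler_wpM2r//; apply: le_trans Ke.
    by rewrite ler_wpM2l.
  apply: (@mvt_rV_le _ _ (Pr u \- Pr v) (fun s => f (u s) - f (v s))).
  - by rewrite mulr_ge0.
  - by move=> w w01; apply: is_deriveB; apply: Prd => //; exact: cl1.
  - by move=> w w01; apply: le_trans (fK _ _) _; rewrite ler_wpM2l.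
pose u n := iter n T (cst q).
have uc n : continuous (u n).
  by elim: n => [|n IH]; [exact: cst_continuous|exact: Tc].
have uS n t : `|u n.+1 t - u n t| <= `|f q| * 2^-1 ^+ n.
  elim: n t => [|n IH] t; last first.
    have := @TT (u n.+1) (u n) (`|f q| * 2^-1 ^+ n) (uc _) (uc _) _ IH t.
    by rewrite exprSr mulrA; apply; rewrite mulr_ge0// exprn_ge0.
  rewrite expr0 mulr1 /u/= /T addrC addKr.
  have c0 : continuous (cst q : R -> 'rV[R]_m) by exact: cst_continuous.
  rewrite -[Pr _ _]subr0 -(Pr0 _ c0).
  apply: (@le_trans _ _ (`|f q| * `|cl t|)).
    apply: (@mvt_rV_le _ _ _ (fun=> f q)) => // w w01.
    by apply: (Prd (cst q)) => //; exact: cl1.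
  by rewrite ler_piMr// (le_trans (cle t))// ltW.
have /choice[y yP] t := geometric_limit (uS^~ t).
have yc : continuous y.
  by move=> t; apply: (@uniform_limit_continuous _ _ u y (2 * `|f q|) t) => [n|n s];
    [exact: uc|exact: yP].
have yT t : y t = T y t.
  apply/eqP; rewrite -subr_eq0 -normr_le0; apply/ler_addgt0Pl => d d0; rewrite addr0.
  have [n nP] := half_pow_small (2 * `|f q| + 1) d0.
  have h0 : 0 <= 2^-1 ^+ n :> R by rewrite exprn_ge0.
  have c0 : 0 <= 2 * `|f q| * 2^-1 ^+ n by rewrite !mulr_ge0.
  have A := yP t n.+1; have B := @TT (u n) y _ (uc _) yc c0 (yP^~ n) t.
  have -> : y t - T y t = (u n.+1 t - T y t) - (u n.+1 t - y t).
    by rewrite opprB [u n.+1 t - _ + _]addrC subrKA.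
  apply: le_trans (ler_normB _ _) _; apply: le_trans (lerD B A) _; apply: le_trans nP.
  by rewrite exprS; set h := 2^-1 ^+ n in h0 *; have := normr_ge0 (f q); nra.
exists y; split=> //; first by rewrite yT /T cl0 Pr0// addr0.
move=> t te.
apply: (@near_eq_is_derive _ _ _ (fun s => q + Pr y s)).
  have : \forall s \near t, `|s| < e.
    have := @near_norm_lt R R 0 t e; rewrite subr0 => /(_ te).
    by apply: filterS => s; rewrite subr0.
  apply: filterS => s se; rewrite [RHS]yT /T /cl clamp_id//.
  by rewrite -ler_norml ltW.
rewrite -[f (y t)]add0r; apply: is_deriveD.
by apply: Prd => //; exact: lt_trans te e1.
Qed.

End ODE.

(** * Local existence and a Gronwall estimate *)

Section LocalFlows.
Context {R : realType}.

Lemma gronwall_small m (u du : R -> 'rV[R]_m) e K d :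
  0 < e -> 0 <= K -> 0 <= d -> K * e <= 2^-1 ->
  (forall t : R, `|t| <= e -> is_derive t 1 u (du t)) ->
  (forall t, `|t| <= e -> `|du t| <= K * `|u t| + d) ->
  forall t, `|t| <= e -> `|u t| <= 2 * (`|u 0| + e * d).
Proof.
move=> e0 K0 d0 Ke ud duK.
have uc : {within `[(- e), e], continuous (fun t => `|u t|)}.
  apply: continuous_in_subspaceT => t /set_mem; rewrite /= in_itv/= -ler_norml => te.
  apply: (@continuous_comp _ _ _ u (fun x => `|x|)); last exact: norm_continuous.
  by apply: differentiable_continuous; apply/derivable1_diffP; have [] := ud t te.
have [|c] := EVT_max _ uc; first by lra.
rewrite in_itv/= -ler_norml => ce cmax t te.
apply: le_trans (cmax t _) _; first by rewrite in_itv/= -ler_norml.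
have cmax' s : `|s| <= e -> `|u s| <= `|u c|.
  by move=> se; apply: cmax; rewrite in_itv/= -ler_norml.
have : `|u c - u 0| <= (K * `|u c| + d) * `|c|.
  have uce w : 0 <= w <= 1 -> `|w * c| <= e.
    move=> /andP[w0 w1]; rewrite normrM ger0_norm//.
    by rewrite -[e]mul1r ler_pM.
  apply: (@mvt_rV_le _ _ _ du) => [|w w01|w w01].
  - by rewrite addr_ge0// mulr_ge0.
  - by apply: ud; exact: uce.
  - apply: le_trans (duK _ (uce w w01)) _; rewrite lerD2r ler_wpM2l//.
    exact/cmax'/uce.
move=> H; have : `|u c - u 0| <= (K * `|u c| + d) * e.
  by apply: le_trans H _; rewrite ler_wpM2l// addr_ge0// mulr_ge0.
have : `|u c| <= `|u c - u 0| + `|u 0|.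
  by have := ler_normD (u c - u 0) (u 0); rewrite subrK.
have := normr_ge0 (u c); have := normr_ge0 (u 0); set a := `|u c|; set b := `|u 0|.
by nra.
Qed.

(** The Lipschitz bound is asked only between the two solutions, so that a field that is merely
    locally Lipschitz is allowed. *)
Lemma ode_unique m (f : 'rV[R]_m -> 'rV[R]_m) (y z : R -> 'rV[R]_m) e K :
  0 < e -> 0 <= K -> K * e <= 2^-1 ->
  (forall t : R, `|t| <= e -> is_derive t 1 y (f (y t))) ->
  (forall t : R, `|t| <= e -> is_derive t 1 z (f (z t))) ->
  (forall t, `|t| <= e -> `|f (y t) - f (z t)| <= K * `|y t - z t|) ->
  forall t, `|t| <= e -> `|y t - z t| <= 2 * `|y 0 - z 0|.
Proof.
move=> e0 K0 Ke yd zd fK t te.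
have := @gronwall_small m (y \- z) (fun t => f (y t) - f (z t)) e K 0 e0 K0 (lexx _) Ke.
rewrite mulr0 addr0; apply => // s se; last by rewrite addr0; exact: fK.
by apply: is_deriveB; [exact: yd|exact: zd].
Qed.

(** Precomposing [f] with the coordinatewise projection [c] onto the cube of radius [p] = 3r/4 makes
    it globally Lipschitz, so [picard] applies. Solutions starting within r/2 of [x] have speed at
    most [M] and move by at most r/4 during the time [e]; they stay in the cube, where the
    projection is the identity. *)
Lemma local_ode m (f : 'rV[R]_m -> 'rV[R]_m) x r K : 0 < r -> 0 <= K ->
  (forall y z, `|y - x| < r -> `|z - x| < r -> `|f y - f z| <= K * `|y - z|) ->
  exists2 e, 0 < e & exists2 M, 0 <= M & forall q, `|q - x| < r / 2 ->
   exists y : R -> 'rV[R]_m, [/\ y 0 = q, continuous y & forall t : R, `|t| < e ->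
     [/\ `|y t - x| < r, is_derive t 1 y (f (y t)) & `|y t - q| <= M * `|t|]].
Proof.
move=> r0 K0 fK; pose p := r * 3 / 4.
have p0 : 0 < p by rewrite /p; lra.
have pr : p < r by rewrite /p; lra.
pose c (y : 'rV[R]_m) : 'rV[R]_m := \row_i clamp (x 0 i - p) (x 0 i + p) (y 0 i).
have cx y : `|c y - x| <= p.
  apply: rV_norm_le => [|i]; first exact: ltW.
  rewrite !mxE ler_distl; apply: clamp_in; lra.
have cL y z : `|c y - c z| <= `|y - z|.
  apply: rV_norm_le => // i; rewrite !mxE; apply: le_trans (clamp_lipschitz _ _ _ _) _.
  by have := rV_norm_coord (y - z) i; rewrite !mxE.
have cid y : `|y - x| <= p -> c y = y.
  move=> yp; apply/rowP => i; rewrite mxE clamp_id// -ler_distl.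
  by apply: le_trans yp; have := rV_norm_coord (y - x) i; rewrite !mxE.
pose F y := f (c y).
have FK y z : `|F y - F z| <= K * `|y - z|.
  apply: le_trans (fK _ _ _ _) _; try exact: le_lt_trans (cx _) pr.
  exact: ler_wpM2l.
pose M := `|f x| + K * r.
have M0 : 0 <= M by rewrite addr_ge0// mulr_ge0// ltW.
have FM y : `|F y| <= M.
  have -> : F y = f x + (F y - f x) by rewrite addrC subrK.
  apply: le_trans (ler_normD _ _) _; rewrite lerD2l /F.
  apply: le_trans (fK _ _ _ _) _; rewrite ?subrr ?normr0//.
    exact: le_lt_trans (cx _) pr.
  by rewrite ler_wpM2l// (le_trans (cx _))// ltW.
(* Each summand of [d] is responsible for one of the bounds e < 1, K e <= 1/2 and M e <= r/4. *)
pose d := 2 + 2 * K + 4 * (M / r).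
have Mr : 0 <= M / r by rewrite divr_ge0// ltW.
have d0 : 0 < d by rewrite /d; lra.
pose e := d^-1.
have e0 : 0 < e by rewrite invr_gt0.
have ed : e * d = 1 by rewrite mulVf// gt_eqF.
have [e1 Ke Me] : [/\ e < 1, K * e <= 2^-1 & M * e <= r / 4].
  have : 0 <= e * K by rewrite mulr_ge0// ltW.
  have : 0 <= e * (M / r) by rewrite mulr_ge0// ltW.
  have Mrr : M = (M / r) * r by rewrite divfK// gt_eqF.
  move: ed; rewrite /d; set w := M / r in Mr Mrr * => ed A B.
  have ew : e * w <= 1 / 4 by lra.
  split; [lra|lra|rewrite Mrr; nra].
exists e => //; exists M => // q qr.
have [y [y0 yc yd]] := picard q FK K0 e0 e1 Ke.
exists y; split=> // t te.
have yq s : `|s| < e -> `|y s - q| <= M * `|s|.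
  move=> se; rewrite -y0; apply: (@mvt_rV_le _ _ _ (fun s => F (y s))) => // w /andP[w0 w1].
  apply: yd; rewrite normrM ger0_norm//; apply: le_lt_trans se.
  by rewrite -[leRHS]mul1r ler_wpM2r.
have yx : `|y t - x| <= p.
  have -> : y t - x = (y t - q) + (q - x) by rewrite subrKA.
  apply: le_trans (ler_normD _ _) _.
  have := yq t te; have : M * `|t| <= r / 4.
    by apply: le_trans Me; rewrite ler_wpM2l// ltW.
  by rewrite /p; lra.
split; [exact: le_lt_trans yx pr| |exact: yq].
by have := yd t te; rewrite /F cid.
Qed.

End LocalFlows.

Section LocalCommutation.
Context {R : realType}.

Lemma is_derive_eps (V W : normedModType R) (f : V -> W) x v d :
  is_derive x v f d <-> forall eta, 0 < eta ->
    \forall h \near (0 : R), `|f (h *: v + x) - f x - h *: d| <= eta * `|h|.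
Proof.
have E h : h != 0 -> `|h^-1 *: (f (h *: v + x) - f x) - d| =
    `|h|^-1 * `|f (h *: v + x) - f x - h *: d|.
  move=> h0; rewrite -normfV -normrZ; congr `|_|.
  by rewrite [RHS]scalerBr [h^-1 *: (h *: d)]scalerA mulVf// scale1r.
split=> [[dv dvd] eta eta0|H].
  have /cvgrPdist_le/(_ eta eta0) : (fun h : R => h^-1 *: ((f \o shift x) (h *: v) - f x)) @ 0^'
      --> d by rewrite -dvd; exact: dv.
  rewrite near_withinE; apply: filterS => h hP.
  have [->|h0] := eqVneq h 0.
    by rewrite scale0r add0r subrr scale0r subrr !normr0 mulr0.
  have := hP h0; rewrite /= distrC E// mulrC ler_pdivrMr// normr_gt0//.
have lim : (fun h : R => h^-1 *: ((f \o shift x) (h *: v) - f x)) @ 0^' --> d.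
  apply/cvgrPdist_le => eta eta0; rewrite near_withinE.
  apply: filterS (H eta eta0) => h hP h0.
  by rewrite /= distrC E// mulrC ler_pdivrMr// normr_gt0.
by apply: DeriveDef; [apply/cvg_ex; exists d|exact: cvg_lim lim].
Qed.

Lemma taylor2_rV m p (f : 'rV[R]_m -> 'rV[R]_p) x : (forall j, ck 2 (fun y => f y 0 j) x) ->
  exists2 C, 0 <= C & exists2 r, 0 < r & forall j y z, `|y - x| < r -> `|z - x| < r ->
    `|f y 0 j - f z 0 j - \sum_i (y - z) 0 i * 'D_(delta_mx 0 i) (fun y => f y 0 j) z|
      <= C * `|y - z| ^+ 2.
Proof.
move=> fk.
have /choice[C CP] : forall j, exists C, 0 <= C /\ exists2 r, 0 < r & forall y z,
    `|y - x| < r -> `|z - x| < r ->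
    `|f y 0 j - f z 0 j - \sum_i (y - z) 0 i * 'D_(delta_mx 0 i) (fun y => f y 0 j) z|
      <= C * `|y - z| ^+ 2.
  by move=> j; have [C C0 H] := taylor2 (fk j); exists C.
exists (\sum_j C j); first by apply: sumr_ge0 => j _; have [] := CP j.
apply: (@fin_radius _ _ (fun j r => forall y z,
    `|y - x| < r -> `|z - x| < r ->
    `|f y 0 j - f z 0 j - \sum_i (y - z) 0 i * 'D_(delta_mx 0 i) (fun y => f y 0 j) z|
      <= (\sum_j C j) * `|y - z| ^+ 2)).
  by move=> j r r' _ rr H y z yr zr; apply: H; exact: lt_le_trans rr.
move=> j; have [_ [r r0 H]] := CP j; exists r => // y z yr zr.
apply: le_trans (H y z yr zr) _; rewrite ler_wpM2r ?exprn_ge0//.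
by rewrite (bigD1 j)//= lerDl; apply: sumr_ge0 => k _; have [] := CP k.
Qed.

(* If y' = V(y + h W + E) - V(y) - h DV(y) W(y) then |E'| <= K |E| + O(h^2); thus the flow of V
   carries integral curves of W to integral curves of W without knowing that it is smooth. *)
Lemma local_commutation m (V W : 'rV[R]_m -> 'rV[R]_m) x :
  (forall j k, ck k (fun y => V y 0 j) x) -> (forall j k, ck k (fun y => W y 0 j) x) ->
  (\forall y \near x, forall j,
     \sum_a V y 0 a * 'D_(delta_mx 0 a) (fun z => W z 0 j) y =
     \sum_a W y 0 a * 'D_(delta_mx 0 a) (fun z => V z 0 j) y) ->
  exists2 r, 0 < r & exists2 e0, 0 < e0 & forall e, 0 < e -> e <= e0 ->
    forall G : R -> R -> 'rV[R]_m,
    (forall s t, `|s| <= e -> `|t| <= e -> `|G s t - x| < r) ->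
    (forall s t : R, `|s| <= e -> `|t| <= e -> is_derive t 1 (G s) (V (G s t))) ->
    (forall s : R, `|s| < e -> is_derive s 1 (G^~ 0) (W (G s 0))) ->
    forall s t : R, `|s| < e -> `|t| <= e -> is_derive s 1 (G^~ t) (W (G s t)).
Proof.
move=> Vk Wk VW.
have [K K0 [r1 r10 VK]] := C1at_lipschitz (fun j => ck_C1at (Vk j 1)).
have [L L0 [r2 r20 WL]] := C1at_lipschitz (fun j => ck_C1at (Wk j 1)).
have [C C0 [r3 r30 VC]] := taylor2_rV (fun j => Vk j 2).
have near4 : \forall y \near x, (forall j, C1at (fun z => W z 0 j) y) /\ forall j,
     \sum_a V y 0 a * 'D_(delta_mx 0 a) (fun z => W z 0 j) y =
     \sum_a W y 0 a * 'D_(delta_mx 0 a) (fun z => V z 0 j) y.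
  have : \forall y \near x, forall j, C1at (fun z => W z 0 j) y.
    apply: near_forall => j; apply: (near_imp (ck_open (Wk j 1))) => y.
    exact: (@ck_C1at _ _ 0).
  by move/near_and; apply; [exact: VW|].
have [r4 r40 H4] := (ball_normP x _).1 near4.
pose r := Num.min (Num.min r1 r2) (Num.min r3 r4).
have r0 : 0 < r by rewrite !lt_min r10 r20 r30.
have [rr1 rr2 rr3 rr4] : [/\ r <= r1, r <= r2, r <= r3 & r <= r4].
  by rewrite /r !ge_min !lexx !orbT.
pose B := `|W x| + L * r.
have B0 : 0 <= B by rewrite addr_ge0// mulr_ge0// ltW.
have WB y : `|y - x| < r -> `|W y| <= B.
  move=> yr; have -> : W y = W x + (W y - W x) by rewrite addrC subrK.
  apply: le_trans (ler_normD _ _) _; rewrite lerD2l.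
  apply: le_trans (WL _ _ _ _) _; rewrite ?subrr ?normr0//; first exact: lt_le_trans rr2.
  by rewrite ler_wpM2l// ltW.
exists (r / 2); first by rewrite divr_gt0.
pose e0 := (2 * (K + 1))^-1.
have K1 : 0 < 2 * (K + 1) by lra.
exists e0; first by rewrite invr_gt0.
move=> e e_gt0 ee0 G Gr Gt Gs s t se te.
have Ke : K * e <= 2^-1.
  have : e0 * (2 * (K + 1)) = 1 by rewrite mulVf// gt_eqF.
  by have : 0 <= K * (e0 - e) by [rewrite mulr_ge0// subr_ge0]; nra.
have r2r : r / 2 < r by lra.
apply/is_derive_eps => eta eta0.
pose c := e * (C * B ^+ 2).
have c0 : 0 <= c by rewrite mulr_ge0 ?mulr_ge0 ?exprn_ge0// ltW.
have n1 : \forall h \near (0 : R), `|G (h *: 1 + s) 0 - G s 0 - h *: W (G s 0)| <= eta / 4 * `|h|.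
  by apply: (is_derive_eps (G^~ 0) s 1 _).1 (Gs s se) _ _; rewrite divr_gt0.
(* The first bound makes the quadratic error 2 c h^2 at most eta |h| / 2, the second keeps the
   Taylor point [p] in the ball, the third keeps the shifted parameter admissible. *)
have n2 : \forall h \near (0 : R), `|h| * (4 * c + 1) <= eta /\ `|h| * B < r / 2 /\ `|h + s| < e.
  pose d := Num.min (Num.min (eta / (4 * c + 1)) (r / 2 / (B + 1))) (e - `|s|).
  have c4 : 0 < 4 * c + 1 by lra.
  have B1 : 0 < B + 1 by lra.
  apply: (ball_normP (0 : R) _).2; exists d.
    by rewrite !lt_min !divr_gt0//= subr_gt0.
  move=> h; rewrite subr0 !lt_min => /andP[/andP[h1 h2] h3]; split; [|split].
  - by rewrite -ler_pdivlMr// ltW.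
  - apply: le_lt_trans (_ : `|h| * (B + 1) < _); first by rewrite ler_wpM2l// lerDl.
    by rewrite -ltr_pdivlMr.
  - by apply: le_lt_trans (ler_normD _ _) _; rewrite -ltrBrDr.
apply: (near_and n1 n2) => h h1 [h2 [h3 h4]].
pose E t := G (h *: 1 + s) t - G s t - h *: W (G s t).
have hs : `|h *: 1 + s| <= e by rewrite [h *: 1]mulr1 ltW.
pose dE t := V (G (h *: 1 + s) t) - V (G s t) -
   h *: \row_j \sum_a V (G s t) 0 a * 'D_(delta_mx 0 a) (fun z => W z 0 j) (G s t).
have sle : `|s| <= e by exact: ltW.
have Ed (u : R) : `|u| <= e -> is_derive u 1 E (dE u).
  move=> ue; apply: is_deriveB; first by apply: is_deriveB; exact: Gt.
  apply: is_deriveZ; apply/is_derive_rV => j; rewrite mxE.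
  apply: (C1at_chain (f := fun z => W z 0 j) (Gt s u sle ue)).
  apply: (H4 _ _).1; apply: lt_le_trans (Gr s u sle ue) _.
  by rewrite (le_trans (ltW r2r)).
have CB0 : 0 <= C * B ^+ 2 by apply: mulr_ge0 => //; exact: sqr_ge0.
have d0 : 0 <= C * B ^+ 2 * h ^+ 2 by apply: mulr_ge0 => //; exact: sqr_ge0.
have dEK u : `|u| <= e -> `|dE u| <= K * `|E u| + C * B ^+ 2 * h ^+ 2.
  move=> ue.
  have Gu := Gr s u sle ue; have Gu' := Gr _ u hs ue.
  pose p := G s u + h *: W (G s u).
  have px : `|p - x| < r.
    have -> : p - x = (G s u - x) + h *: W (G s u) by rewrite /p addrAC.
    apply: le_lt_trans (ler_normD _ _) _; rewrite [r]splitr; apply: ltrD => //.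
    rewrite normrZ; apply: le_lt_trans h3; rewrite ler_wpM2l// WB//.
    exact: lt_trans r2r.
  have Gur : `|G s u - x| < r by exact: lt_trans r2r.
  have -> : dE u = (V (G (h *: 1 + s) u) - V p) + (V p - V (G s u) -
      h *: \row_j \sum_a V (G s u) 0 a * 'D_(delta_mx 0 a) (fun z => W z 0 j) (G s u)).
    by rewrite [RHS]addrA subrKA.
  apply: le_trans (ler_normD _ _) _; apply: lerD.
    apply: le_trans (VK _ _ _ _) _.
    - by apply: lt_le_trans rr1; exact: lt_trans r2r.
    - exact: lt_le_trans rr1.
    - by rewrite /p opprD addrA.
  apply: rV_norm_le => [|j]; first exact: d0.
  (* The commutation relation turns DW(V) into DV(W), which is the linear term in the Taylor
     expansion of [V] at [G s u]. *)
  rewrite !mxE (H4 _ (lt_le_trans Gur rr4)).2.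
  have := VC j p (G s u) (lt_le_trans px rr3) (lt_le_trans Gur rr3).
  have -> : p - G s u = h *: W (G s u) by rewrite /p addrAC subrr add0r.
  rewrite (eq_bigr (fun i => h * (W (G s u) 0 i * 'D_(delta_mx 0 i) (fun y => V y 0 j) (G s u)))).
    rewrite -mulr_sumr => /le_trans; apply.
    rewrite normrZ exprMn mulrCA [leRHS]mulrC -[in leRHS]real_normK ?num_real//.
    rewrite ler_wpM2l ?exprn_ge0// ler_wpM2l// ler_pXn2r ?nnegrE//.
    exact: WB.
  by move=> i _; rewrite mxE mulrA.
apply: le_trans (gronwall_small e_gt0 K0 d0 Ke Ed dEK te) _.
rewrite /E.
have -> : e * (C * B ^+ 2 * h ^+ 2) = c * `|h| * `|h|.
  have -> : h ^+ 2 = `|h| * `|h| by rewrite -expr2 real_normK ?num_real.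
  by rewrite /c; ring.
have A := normr_ge0 h; have := h1; set w := `| _ - _ - _| => h1'.
have : (`|h| * (4 * c + 1)) * `|h| <= eta * `|h| by rewrite ler_wpM2r.
by nra.
Qed.

End LocalCommutation.

(** * Flows of vector fields on manifolds *)

Section Curves.
Context {R : realType} {m : nat} {X : smoothManifold R m}.
Implicit Types (V W : chart X -> X -> 'rV[R]_m) (c d : chart X) (p q : X).

Definition smooth_field V :=
  (forall c d p, cdom c p -> cdom d p ->
     V d p = V c p *m 'J (fun x => cmap d (cinv c x)) (cmap c p)) /\
  (forall c x, cimg c x -> forall k j, ck k (fun x => V c (cinv c x) 0 j) x).

(** The pointwise form of [integral_curve], for curves that solve the equation only on an interval
    and for gluing them. *)
Definition icurve_at V (g : R -> X) (t : R) :=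
  {for t, continuous g} /\
  forall c, cdom c (g t) -> is_derive t 1 (fun s => cmap c (g s)) (V c (g t)).

Lemma integral_curveP V g : integral_curve V g <-> forall t, icurve_at V g t.
Proof.
split=> [[gc gd] t|H]; first by split; [exact: gc|exact: gd].
by split=> t; [exact: (H t).1|exact: (H t).2].
Qed.

Lemma near_cdom c p : cdom c p -> \forall q \near p, cdom c q.
Proof. by move=> cp; apply: open_nbhs_nbhs; split=> //; exact: cdom_open. Qed.

Lemma near_cimg c x : cimg c x -> \forall y \near x, cimg c y.
Proof. by move=> cp; apply: open_nbhs_nbhs; split=> //; exact: cimg_open. Qed.

Lemma cimg_cmap c p : cdom c p -> cimg c (cmap c p).
Proof. by case/cmapK. Qed.

Lemma cmapKE c p : cdom c p -> cinv c (cmap c p) = p.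
Proof. by case/cmapK. Qed.

Lemma cdom_cinv c x : cimg c x -> cdom c (cinv c x).
Proof. by case/cinvK. Qed.

Lemma cinvKE c x : cimg c x -> cmap c (cinv c x) = x.
Proof. by case/cinvK. Qed.

Lemma cmap_cont c p : cdom c p -> {for p, continuous (cmap c)}.
Proof. by move=> cp; apply: cmap_continuous; exact: mem_set. Qed.

Lemma cinv_cont c x : cimg c x -> {for x, continuous (cinv c)}.
Proof. by move=> cx; apply: cinv_continuous; exact: mem_set. Qed.

Lemma near_cmap_ball c p (x : 'rV[R]_m) r : cdom c p -> `|cmap c p - x| < r ->
  \forall q \near p, cdom c q /\ `|cmap c q - x| < r.
Proof.
move=> cp pr; apply: (near_and (near_cdom cp) (near_cont (cmap_cont cp) (near_norm_lt pr))).
by move=> q; split.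
Qed.

Lemma open_chart_preimage c (U : set X) : open U -> open (cimg c `&` cinv c @^-1` U).
Proof.
move=> oU; rewrite openE => x [cx Ux].
apply: (near_and (near_cimg cx) (_ : \forall y \near x, U (cinv c y))) => [|y cy Uy].
  by apply: (near_cont (cinv_cont cx)); exact: open_nbhs_nbhs.
by split.
Qed.

Lemma transition_ck c d p : cdom c p -> cdom d p ->
  forall k j, ck k (fun x => cmap d (cinv c x) 0 j) (cmap c p).
Proof.
move=> cp dp k j.
have H := Cinfty_ck (open_chart_preimage (c := c) (cdom_open d)) (@chart_compat _ _ X c d j).
have := H (cmap c p); apply.
by split; [exact: cimg_cmap|rewrite /= cmapKE].
Qed.

Lemma transition_differentiable c d p : cdom c p -> cdom d p ->
  differentiable (fun x => cmap d (cinv c x)) (cmap c p).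
Proof.
move=> cp dp; apply: (C1at_differentiable_rV _).1 => j.
exact: (ck_C1at (transition_ck cp dp 1 j)).
Qed.

(** The transformation law of [V] and the chain rule carry the equation from one chart to all
    others. *)
Lemma icurve_one_chart V c g (t : R) : smooth_field V -> {for t, continuous g} -> cdom c (g t) ->
  is_derive t 1 (fun s => cmap c (g s)) (V c (g t)) -> icurve_at V g t.
Proof.
move=> [Vc _] gc cg gd; split=> // d dg.
rewrite (Vc c d)//.
have df := transition_differentiable cg dg.
have := is_derive_diff_comp gd df; rewrite -deriveE// deriveEjacobian// => H.
apply: near_eq_is_derive H.
by apply: (near_imp (near_cont gc (near_cdom cg))) => s cs /=; rewrite cmapKE.
Qed.

Lemma icurve_at_near V g h t : (\forall s \near t, g s = h s) -> icurve_at V g t -> icurve_at V h t.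
Proof.
move=> gh [gc gd]; have ght := nbhs_singleton gh; split.
  by apply: near_eq_continuous gc; apply: filterS gh => s ->.
move=> c; rewrite -ght => cg; apply: near_eq_is_derive (gd c cg).
by apply: filterS gh => s ->.
Qed.

Lemma is_derive_shift_arg (W : normedModType R) (f : R -> W) (s t : R) (d : W) :
  is_derive (s + t) 1 f d <-> is_derive s 1 (fun u => f (u + t)) d.
Proof.
have := is_derive_line f t (1 : R) s d; rewrite [s *: 1]mulr1.
by under eq_fun do rewrite [_ *: _]mulr1.
Qed.

Lemma icurve_at_shift V g (s t : R) :
  icurve_at V g (s + t) -> icurve_at V (fun u => g (u + t)) s.
Proof.
move=> [gc gd]; split.
  apply: (@continuous_comp _ _ _ (fun u : R => u + t) g) => //.
  by apply: (@continuousD _ _ _ id (cst t)); [exact: cvg_id|exact: cst_continuous].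
by move=> c cg; apply: (is_derive_shift_arg (fun u => cmap c (g u)) s t _).1; exact: gd.
Qed.

Lemma field_lipschitz V c x : smooth_field V -> cimg c x ->
  exists2 K, 0 <= K & exists2 r, 0 < r & forall y z, `|y - x| < r -> `|z - x| < r ->
    `|V c (cinv c y) - V c (cinv c z)| <= K * `|y - z|.
Proof.
move=> [_ Vs] cx; apply: (@C1at_lipschitz _ _ _ (fun y => V c (cinv c y))) => j.
exact: (ck_C1at (Vs c x cx 1 j)).
Qed.

Lemma small_time (K e : R) : 0 <= K -> 0 < e ->
  exists2 e', 0 < e' & e' < e /\ K * e' <= 2^-1.
Proof.
move=> K0 e0; pose d := e^-1 + 2 * K + 1; have ei : 0 < e^-1 by rewrite invr_gt0.
have d0 : 0 < d by rewrite /d; lra.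
exists d^-1; first by rewrite invr_gt0.
split; first by rewrite invf_plt ?posrE// /d; lra.
by rewrite ler_pdivrMr// /d; lra.
Qed.

Lemma icurve_unique_near V g h t : smooth_field V ->
  (\forall s \near t, icurve_at V g s) -> (\forall s \near t, icurve_at V h s) ->
  g t = h t -> \forall s \near t, g s = h s.
Proof.
move=> Vs gs hs gh; pose c := chart_at (g t); have cg := cdom_chart_at (g t).
have [K K0 [r r0 VK]] := field_lipschitz Vs (cimg_cmap cg).
have good f : f t = g t -> (\forall s \near t, icurve_at V f s) ->
    \forall s \near t, icurve_at V f s /\ (cdom c (f s) /\ `|cmap c (f s) - cmap c (g t)| < r).
  move=> fg fs; have [fc _] := nbhs_singleton fs.
  have cf : cdom c (f t) by rewrite fg.
  apply: (near_and fs) => [|s A B]; last by split; [exact: A|exact: B].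
  have pr : `|cmap c (f t) - cmap c (g t)| < r by rewrite fg subrr normr0.
  exact: (near_cont fc (near_cmap_ball cf pr)).
have gg := good g erefl gs; have hh := good h (esym gh) hs.
have [e e0 eP] := (ball_normP t _).1 (filterI gg hh).
have [e' e'0 [e'e Ke]] := small_time K0 e0.
apply: (ball_normP t _).2; exists e' => // s se.
have {}eP u : `|u| <= e' -> [/\ icurve_at V g (u + t), icurve_at V h (u + t),
   cdom c (g (u + t)), cdom c (h (u + t)) & `|cmap c (g (u + t)) - cmap c (g t)| < r /\
   `|cmap c (h (u + t)) - cmap c (g t)| < r].
  move=> ue; have [] := eP (u + t); first by rewrite addrK (le_lt_trans ue).
  by move=> [A [B C]] [D [E F]].
have gd (u : R) : `|u| <= e' -> is_derive u 1 (fun u => cmap c (g (u + t)))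
    (V c (cinv c (cmap c (g (u + t))))).
  move=> /eP[A _ B _ _]; rewrite cmapKE//.
  by apply: (is_derive_shift_arg (fun u => cmap c (g u)) u t _).1; exact: A.2.
have hd (u : R) : `|u| <= e' -> is_derive u 1 (fun u => cmap c (h (u + t)))
    (V c (cinv c (cmap c (h (u + t))))).
  move=> /eP[_ A _ B _]; rewrite cmapKE//.
  by apply: (is_derive_shift_arg (fun u => cmap c (h u)) u t _).1; exact: A.2.
have := ode_unique (f := fun x => V c (cinv c x)) e'0 K0 Ke gd hd.
move=> /(_ _ (s - t)); rewrite add0r gh subrr normr0 mulr0 subrK normr_le0 subr_eq0 => H.
have [_ _ A B _] := eP (s - t) (ltW se); rewrite subrK in A B.
rewrite -(cmapKE A) -(cmapKE B); congr (cinv c _); apply/eqP; apply: H; last exact: ltW.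
by move=> u /eP[_ _ _ _ [C D]]; apply: VK.
Qed.

(** The interval is connected, and the set of agreement is open in it by local uniqueness and closed
    because [X] is Hausdorff. *)
Lemma icurve_unique V g h (a b t0 : R) : smooth_field V ->
  (forall t, a < t < b -> icurve_at V g t) -> (forall t, a < t < b -> icurve_at V h t) ->
  a < t0 < b -> g t0 = h t0 -> forall t, a < t < b -> g t = h t.
Proof.
move=> Vs gs hs t0ab gh.
pose A := [set t : R | a < t < b]; pose B := A `&` [set t | g t = h t].
have nearA t : A t -> \forall s \near t, A s.
  by move=> At; have := @near_in_itvoo R a b t; rewrite in_itv/=; apply.
suff : B = A by move=> BA t At; have : B t by [rewrite BA]; case.
have cA : connected A.
  apply/connected_intervalP => x y /andP[xa xb] /andP[ya yb] z /andP[xz zy].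
  by rewrite /A/= (lt_le_trans xa)//= (le_lt_trans zy).
apply: cA; first by exists t0.
  exists [set t | \forall s \near t, g s = h s]; first exact: open_interior.
  apply/seteqP; split=> t [At].
    move=> ght; split=> //; apply: (icurve_unique_near Vs) => //.
      by apply: filterS (nearA t At) => s; exact: gs.
    by apply: filterS (nearA t At) => s; exact: hs.
  by move/nbhs_singleton.
exists (closure B); first exact: closed_closure.
apply/seteqP; split=> t [At]; first by move=> ght; split=> //; apply: subset_closure; split.
move=> Bt; split=> //; apply: contrapT => /eqP ght.
have := @manifold_hausdorff _ _ X; rewrite open_hausdorff => /(_ _ _ ght).
move=> [[U U'] /= [/set_mem Ug /set_mem Uh] [oU oU' /eqP UU']].
have [gc _] := gs t At; have [hc _] := hs t At.
have n : nbhs t [set s | U (g s) /\ U' (h s)].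
  apply: filterI; [apply: (gc U)|apply: (hc U')]; exact: open_nbhs_nbhs.
have [s [[_ gs'] [Us Us']]] := Bt _ n.
by have : (U `&` U') (g s) by [split=> //; rewrite gs']; rewrite UU'.
Qed.

End Curves.

Section Flows.
Context {R : realType} {m : nat} {X : smoothManifold R m}.
Implicit Types (V W : chart X -> X -> 'rV[R]_m) (c d : chart X) (p q : X).

(** The time [e] serves all starting points near [p]. The predicate [U] is carried along in order to
    confine the curves to a prescribed neighbourhood. *)
Lemma local_existence V p (U : X -> Prop) : smooth_field V -> (\forall q \near p, U q) ->
  exists2 e, 0 < e & \forall q \near p, exists g : R -> X,
    g 0 = q /\ forall t, `|t| < e -> icurve_at V g t /\ U (g t).
Proof.
move=> Vs pU; pose c := chart_at p; have cp : cdom c p := cdom_chart_at p.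
have cx := cimg_cmap cp; set x := cmap c p in cx.
have [K K0 [r1 r10 VK]] := field_lipschitz Vs cx.
have near2 : \forall y \near x, cimg c y /\ U (cinv c y).
  apply: (near_and (near_cimg cx)) => [|y A B]; last by split; [exact: A|exact: B].
  by apply: (near_cont (cinv_cont cx)); rewrite cmapKE.
have [r2 r20 H2] := (ball_normP x _).1 near2.
pose r := Num.min r1 r2; have r0 : 0 < r by rewrite lt_min r10.
have [rr1 rr2] : r <= r1 /\ r <= r2 by rewrite !ge_min !lexx orbT.
have VK' y z : `|y - x| < r -> `|z - x| < r ->
    `|V c (cinv c y) - V c (cinv c z)| <= K * `|y - z|.
  by move=> yr zr; apply: VK; exact: lt_le_trans rr1.
have [e e0 [M _ H]] := @local_ode R m (fun y => V c (cinv c y)) x r K r0 K0 VK'.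
exists e => //.
have px : `|cmap c p - x| < r / 2 by rewrite subrr normr0 divr_gt0.
apply: (near_imp (near_cmap_ball cp px)) => q [cq qr].
have [y [y0 yc yP]] := H _ qr.
exists (fun t => cinv c (y t)); rewrite y0 cmapKE//; split=> // t te.
have [yx yd _] := yP t te; have [cy Uy] := H2 _ (lt_le_trans yx rr2); split=> //.
apply: (icurve_one_chart (c := c)) => //.
- by apply: continuous_comp; [exact: yc|exact: cinv_cont].
- exact: cdom_cinv.
- apply: near_eq_is_derive yd.
  apply: (near_imp (near_cont (yc t) (near_cimg cy))) => s cs.
  by rewrite cinvKE.
Qed.

(** Compactness in its near-covering form, with the filter of small positive [e], replaces a finite
    subcover and the minimum of its radii. *)
Lemma compact_uniform (K : set X) (P : R -> X -> Prop) : compact K ->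
  (forall e e' q, 0 < e' -> e' <= e -> P e q -> P e' q) ->
  (forall p, K p -> exists2 e, 0 < e & \forall q \near p, P e q) ->
  exists2 e, 0 < e & forall q, K q -> P e q.
Proof.
move=> /compact_near_coveringP cK Pm PK.
have gt0 : \forall e \near (0 : R)^'+, 0 < e by exact: nbhs_right_gt.
have KP : \forall e \near (0 : R)^'+, K `<=` P e.
  apply: cK => p /PK[e e0 pP].
  exists ([set q | P e q], [set e' | 0 < e' /\ e' < e]) => /=.
    split=> //; apply: filterI; [exact: nbhs_right_gt|exact: nbhs_right_lt].
  by move=> [q e'] [/= Pq [e'0 e'e]]; apply: Pm Pq => //; exact: ltW.
have [e [e0 eP]] := filter_ex (filterI gt0 KP).
by exists e => // q; exact: eP.
Qed.

Section Completeness.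
Variables (V : chart X -> X -> 'rV[R]_m) (K : set X).
Hypothesis Vs : smooth_field V.
Hypothesis cK : compact K.
Hypothesis Kinv : forall g e, (forall t, `|t| < e -> icurve_at V g t) -> K (g 0) ->
  forall t, `|t| < e -> K (g t).

Let P (T : R) := forall q, K q -> exists g : R -> X,
  g 0 = q /\ forall t, `|t| < T -> icurve_at V g t.

Let P_exists : exists2 e, 0 < e & P e.
Proof.
have [||e e0 eP] := @compact_uniform K (fun e q => exists g : R -> X,
   g 0 = q /\ forall t, `|t| < e -> icurve_at V g t) cK.
- move=> e e' q e'0 e'e [g [g0 gP]]; exists g; split=> // t te; apply: gP.
  exact: lt_le_trans e'e.
- move=> p _; have [//|e e0 H] := @local_existence V p (fun=> True) Vs.
    by apply: near_all.
  exists e => //; apply: (near_imp H) => q [g [g0 gP]]; exists g; split=> // t te.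
  exact: (gP t te).1.
by exists e.
Qed.

(* The curves started at g(T/2) and g(-T/2) prolong g. *)
Let P_extend T : 0 < T -> P T -> P (T * (3 / 2)).
Proof.
move=> T0 PT q Kq; have [g [g0 gP]] := PT q Kq.
have T2 : `|T / 2| < T by rewrite gtr0_norm ?divr_gt0//; lra.
have [ga [ga0 gaP]] := PT _ (Kinv gP (eq_ind_r K Kq g0) T2).
have T2' : `|- (T / 2)| < T by rewrite normrN.
have [gb [gb0 gbP]] := PT _ (Kinv gP (eq_ind_r K Kq g0) T2').
pose ga' t := ga (t + - (T / 2)); pose gb' t := gb (t + T / 2).
have gaP' t : - (T / 2) < t < T * (3 / 2) -> icurve_at V ga' t.
  by move=> /andP[t1 t2]; apply: icurve_at_shift; apply: gaP; rewrite ltr_norml; apply/andP;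
    split; lra.
have gbP' t : - (T * (3 / 2)) < t < T / 2 -> icurve_at V gb' t.
  by move=> /andP[t1 t2]; apply: icurve_at_shift; apply: gbP; rewrite ltr_norml; apply/andP;
    split; lra.
have gag t : - (T / 2) < t < T -> ga' t = g t.
  apply: (@icurve_unique _ _ _ V ga' g _ _ (T / 2)) => //.
  - by move=> s /andP[s1 s2]; apply: gaP'; apply/andP; split; lra.
  - by move=> s /andP[s1 s2]; apply: gP; rewrite ltr_norml; apply/andP; split; lra.
  - by apply/andP; split; lra.
  - by rewrite /ga' subrr.
have gbg t : - T < t < T / 2 -> gb' t = g t.
  apply: (@icurve_unique _ _ _ V gb' g _ _ (- (T / 2))) => //.
  - by move=> s /andP[s1 s2]; apply: gbP'; apply/andP; split; lra.
  - by move=> s /andP[s1 s2]; apply: gP; rewrite ltr_norml; apply/andP; split; lra.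
  - by apply/andP; split; lra.
  - by rewrite /gb' addNr.
exists (fun t => if 0 <= t then ga' t else gb' t); split.
  by rewrite lexx gag//; apply/andP; split; lra.
move=> t; rewrite ltr_norml => /andP[t1 t2].
have [t0|t0|->] := ltrgt0P t.
- apply: (@icurve_at_near _ _ _ V ga'); last by apply: gaP'; apply/andP; split; lra.
  by apply: filterS (lt_nbhsr t0) => s s0; rewrite ltW.
- apply: (@icurve_at_near _ _ _ V gb'); last by apply: gbP'; apply/andP; split; lra.
  by apply: filterS (lt_nbhsl t0) => s s0; rewrite leNgt s0.
- apply: (@icurve_at_near _ _ _ V g); last by apply: gP; rewrite normr0.
  have : \forall s \near (0 : R), `|s - 0| < T / 2.
    by apply: near_norm_lt; rewrite subrr normr0 divr_gt0.
  apply: filterS => s; rewrite subr0 ltr_norml => /andP[s1 s2].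
  by case: ifP => _; [rewrite gag//|rewrite gbg//]; apply/andP; split; lra.
Qed.

(** Repeated prolongation reaches the times e (3/2)^n, which are unbounded by Bernoulli's
    inequality. *)
Let P_all T : P T.
Proof.
have [e e0 Pe] := P_exists.
have h0 : 0 < 3 / 2 :> R by rewrite divr_gt0.
have Pn n : P (e * (3 / 2) ^+ n).
  elim: n => [|n IH]; first by rewrite expr0 mulr1.
  by rewrite exprSr [e * _]mulrA; apply: P_extend => //; rewrite mulr_gt0// exprn_gt0.
have bern n : 1 + n%:R / 2 <= (3 / 2 : R) ^+ n.
  elim: n => [|n IH]; first by rewrite mul0r addr0 expr0.
  rewrite exprS -natr1; set h := (3 / 2) ^+ n in IH *.
  have : 0 <= n%:R :> R by []. by lra.
pose n := Num.bound (2 * `|T| / e).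
have nT : T <= e * (3 / 2) ^+ n.
  have : 2 * `|T| / e < n%:R.
    by apply: Num.Theory.archi_boundP; rewrite divr_ge0 ?(ltW e0)// mulr_ge0.
  rewrite ltr_pdivrMr// => H; have := bern n; have := ler_norm T; nra.
move=> q /(Pn n)[g [g0 gP]]; exists g; split=> // t tT; apply: gP.
exact: lt_le_trans nT.
Qed.

Lemma complete_of_compact q : K q -> exists g, integral_curve V g /\ g 0 = q.
Proof.
move=> Kq.
have /choice[G GP] : forall n : nat, exists g : R -> X,
    g 0 = q /\ forall t, `|t| < n%:R -> icurve_at V g t.
  by move=> n; exact: P_all.
have agree N M s : `|s| < N%:R -> `|s| < M%:R -> G N s = G M s.
  move=> sN sM; pose u : R := Num.min N%:R M%:R.
  have su : `|s| < u by rewrite lt_min sN.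
  have u0 : 0 < u by exact: le_lt_trans su.
  have [uN uM] : u <= N%:R /\ u <= M%:R by rewrite !ge_min !lexx orbT.
  apply: (@icurve_unique _ _ _ V _ _ (- u) u 0) => //.
  - by move=> t; rewrite -ltr_norml => tu; apply: (GP N).2; exact: lt_le_trans uN.
  - by move=> t; rewrite -ltr_norml => tu; apply: (GP M).2; exact: lt_le_trans uM.
  - by rewrite oppr_lt0 u0.
  - by rewrite (GP N).1 (GP M).1.
  - by rewrite -ltr_norml.
have bd (t : R) : `|t| < (Num.bound `|t|)%:R by apply: Num.Theory.archi_boundP.
exists (fun t => G (Num.bound `|t|) t); split; last exact: (GP _).1.
(* The index of the glued curve varies with time; for |s - t| < 1 all the curves involved agree with
   the single curve [G M], since |t| + 1 < M. *)
apply/integral_curveP => t; pose M := (Num.bound `|t|).+1.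
have tM : `|t| + 1 < M%:R by rewrite /M -natr1 ltrD2r bd.
apply: (@icurve_at_near _ _ _ V (G M)); last first.
  by apply: (GP M).2; apply: lt_trans tM; rewrite ltrDl.
have : \forall s \near t, `|s - t| < 1 by apply: near_norm_lt; rewrite subrr normr0.
apply: filterS => s st; apply: agree; last exact: bd.
apply: lt_trans tM; have -> : s = (s - t) + t by rewrite subrK.
by apply: le_lt_trans (ler_normD _ _) _; rewrite addrC ltrD2l.
Qed.

End Completeness.

Definition complete_field V := forall q, exists g, integral_curve V g /\ g 0 = q.

Section CompleteFlow.
Variable V : chart X -> X -> 'rV[R]_m.
Hypotheses (Vs : smooth_field V) (Vc : complete_field V).

Lemma flow_curve x : integral_curve V (fun t => flow V t x) /\ flow V 0 x = x.
Proof. by have := xgetPex (cst x) (Vc x). Qed.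

Lemma flow0 x : flow V 0 x = x.
Proof. exact: (flow_curve x).2. Qed.

Lemma flow_icurve x t : icurve_at V (fun s => flow V s x) t.
Proof. exact: ((integral_curveP _ _).1 (flow_curve x).1). Qed.

Lemma flow_local_unique g e t : (forall s, `|s| < e -> icurve_at V g s) -> `|t| < e ->
  g t = flow V t (g 0).
Proof.
move=> gP te; have e0 : 0 < e by exact: le_lt_trans te.
apply: (@icurve_unique _ _ _ V g (fun s => flow V s (g 0)) (- e) e 0) => //.
- by move=> s; rewrite -ltr_norml; exact: gP.
- by move=> s _; exact: flow_icurve.
- by rewrite oppr_lt0 e0.
- by rewrite flow0.
- by rewrite -ltr_norml.
Qed.

Lemma flow_unique g t : integral_curve V g -> g t = flow V t (g 0).
Proof.
move=> /integral_curveP gP; apply: (@flow_local_unique g (`|t| + 1)) => //.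
by rewrite ltrDl.
Qed.

Lemma flowD s t x : flow V (s + t) x = flow V s (flow V t x).
Proof.
have -> : flow V t x = (fun u => flow V (u + t) x) 0 by rewrite add0r.
rewrite -(@flow_unique (fun u => flow V (u + t) x))//.
by apply/integral_curveP => u; apply: icurve_at_shift; exact: flow_icurve.
Qed.

(** This is continuity of the flow, as a function of time and starting point, at (0, p). *)
Lemma flow_near p (U : X -> Prop) : (\forall q \near p, U q) ->
  exists2 e, 0 < e & \forall q \near p, forall t, `|t| < e -> U (flow V t q).
Proof.
move=> /(local_existence Vs)[e e0 H]; exists e => //.
apply: (near_imp H) => q [g [<- gP]] t te.
rewrite -(@flow_local_unique g e)//; first exact: (gP t te).2.
by move=> s se; exact: (gP s se).1.
Qed.

End CompleteFlow.
End Flows.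

(** * Commutation of flows *)

Section CommutingFlows.
Context {R : realType} {m : nat} {X : smoothManifold R m}.
Implicit Types (V W : chart X -> X -> 'rV[R]_m).

(** The vanishing of the Lie bracket [V, W], read in each chart. *)
Definition commuting_fields V W := forall c x, cimg c x -> forall j,
  \sum_a V c (cinv c x) 0 a * 'D_(delta_mx 0 a) (fun z => W c (cinv c z) 0 j) x =
  \sum_a W c (cinv c x) 0 a * 'D_(delta_mx 0 a) (fun z => V c (cinv c z) 0 j) x.

Variables V W : chart X -> X -> 'rV[R]_m.
Hypotheses (Vs : smooth_field V) (Ws : smooth_field W).
Hypotheses (Vc : complete_field V) (Wc : complete_field W).
Hypothesis VW : commuting_fields V W.

(** By [local_commutation], s |-> flow V t (flow W s q) is an integral curve of [W]; it starts at
    flow V t q, so uniqueness identifies it with the flow of [W] from there. *)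
Lemma flows_commute_near (p : X) : exists2 e, 0 < e & \forall q \near p,
  forall s t, `|s| < e -> `|t| < e -> flow V t (flow W s q) = flow W s (flow V t q).
Proof.
pose c := chart_at p; have cp : cdom c p := cdom_chart_at p.
have cx := cimg_cmap cp; set x := cmap c p in cx.
have VW' : \forall y \near x, forall j,
    \sum_a V c (cinv c y) 0 a * 'D_(delta_mx 0 a) (fun z => W c (cinv c z) 0 j) y =
    \sum_a W c (cinv c y) 0 a * 'D_(delta_mx 0 a) (fun z => V c (cinv c z) 0 j) y.
  by apply: (near_imp (near_cimg cx)) => y cy j; exact: VW.
have [r r0 [e0 e00 H]] := @local_commutation R m (fun y => V c (cinv c y))
  (fun y => W c (cinv c y)) x (fun j k => Vs.2 c x cx k j) (fun j k => Ws.2 c x cx k j) VW'.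
have pU : \forall q \near p, cdom c q /\ `|cmap c q - x| < r.
  by apply: near_cmap_ball => //; rewrite subrr normr0.
have [e1 e10 p1] := flow_near Vs Vc pU.
have [e2 e20 p2] := flow_near Ws Wc p1.
(* Halving makes the closed time intervals of [local_commutation] fit into the open ones on which
   the flows are controlled. *)
pose e := Num.min (Num.min e1 e2) e0 / 2.
have m0 : 0 < Num.min (Num.min e1 e2) e0 by rewrite !lt_min e10 e20.
have [em ep] : e < Num.min (Num.min e1 e2) e0 /\ 0 < e by rewrite /e; split; lra.
have [ee1 ee2 ee0] : [/\ e < e1, e < e2 & e < e0].
  by move: em; rewrite !lt_min => /andP[/andP[]].
exists e => //; apply: (near_imp p2) => q qP s t se te.
pose G s t := cmap c (flow V t (flow W s q)).
have GU u w : `|u| <= e -> `|w| <= e ->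
    cdom c (flow V w (flow W u q)) /\ `|G u w - x| < r.
  by move=> ue we; apply: qP; [exact: le_lt_trans ee2|exact: le_lt_trans ee1].
have e_le : `|0 : R| <= e by rewrite normr0 ltW.
have main (u : R) : `|u| < e -> is_derive u 1 (G^~ t) (W c (cinv c (G u t))).
  move=> ue; apply: (H e ep (ltW ee0) G) => //.
  - by move=> a b ae be; exact: (GU a b ae be).2.
  - move=> a b ae be; have [cG _] := GU a b ae be; rewrite cmapKE//.
    exact: ((flow_icurve Vc (flow W a q) b).2 c cG).
  - move=> a ae; have [cG _] := GU a 0 (ltW ae) e_le; rewrite cmapKE//.
    rewrite /G flow0// in cG *; under eq_fun do rewrite flow0//.
    exact: ((flow_icurve Wc q a).2 c cG).
  - exact: ltW.
have near_e (u : R) : `|u| < e -> \forall v \near u, `|v| < e.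
  move=> ue; have := @near_norm_lt R R 0 u e; rewrite subr0 => /(_ ue).
  by apply: filterS => v; rewrite subr0.
have icW (u : R) : `|u| < e -> icurve_at W (fun u => flow V t (flow W u q)) u.
  move=> ue; have [cG _] := GU u t (ltW ue) (ltW te).
  apply: (icurve_one_chart (c := c)) => //.
    apply: (near_eq_continuous (g := fun u => cinv c (G u t))).
      apply: filterS (near_e u ue) => v ve; rewrite cmapKE//.
      exact: (GU v t (ltW ve) (ltW te)).1.
    apply: (@continuous_comp _ _ _ (G^~ t) (cinv c)).
      apply: differentiable_continuous; apply/derivable1_diffP.
      by have [] := main u ue.
    by apply: cinv_cont; exact: cimg_cmap.
  by have := main u ue; rewrite /G cmapKE.
have := flow_local_unique Ws Wc icW se.
by rewrite (flow0 Wc).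
Qed.

Lemma flow_iter (U : chart X -> X -> 'rV[R]_m) n t x : smooth_field U -> complete_field U ->
  iter n (flow U t) x = flow U (n%:R * t) x.
Proof.
move=> Us Uc; elim: n => [|n IH]; first by rewrite mul0r flow0.
by rewrite iterS IH -flowD// -natr1 mulrDl mul1r addrC.
Qed.

Lemma iter_commute (T : Type) (K : set T) (f g : T -> T) n x :
  (forall y, K y -> K (f y)) -> (forall y, K y -> K (g y)) ->
  (forall y, K y -> f (g y) = g (f y)) -> K x -> iter n f (g x) = g (iter n f x).
Proof.
move=> Kf Kg fg Kx; have Ki k : K (iter k f x) by elim: k => //= k; exact: Kf.
by elim: n => // n IH; rewrite !iterS IH fg.
Qed.

(** On the compact invariant set [K] a single [e] works for all points. Both times are cut into [n]
    parts shorter than [e], and the short flows are exchanged one pair at a time. *)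
Lemma flows_commute (K : set X) : compact K ->
  (forall t q, K q -> K (flow V t q)) -> (forall t q, K q -> K (flow W t q)) ->
  forall s t q, K q -> flow V t (flow W s q) = flow W s (flow V t q).
Proof.
move=> cK KV KW s t q Kq.
have [||e e0 eP] := @compact_uniform R m X K (fun e q =>
  forall s t, `|s| < e -> `|t| < e -> flow V t (flow W s q) = flow W s (flow V t q)) cK.
- by move=> e e' y _ ee H a b ae be; apply: H; exact: lt_le_trans ee.
- by move=> p _; exact: flows_commute_near.
pose n := (Num.bound (Num.max `|s| `|t| / e)).+1.
have n0 : 0 < n%:R :> R by rewrite ltr0n.
have small a : `|a| <= Num.max `|s| `|t| -> `|a / n%:R| < e.
  move=> ast; rewrite normrM normfV (gtr0_norm n0) ltr_pdivrMr//.
  apply: le_lt_trans ast _; rewrite mulrC -ltr_pdivrMr//.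
  apply: lt_trans (_ : (Num.bound (Num.max `|s| `|t| / e))%:R < _); last by rewrite ltr_nat.
  by apply: Num.Theory.archi_boundP; rewrite divr_ge0 ?(ltW e0)// le_max normr_ge0.
have sn : s = n%:R * (s / n%:R) by rewrite mulrC divfK// gt_eqF.
have tn : t = n%:R * (t / n%:R) by rewrite mulrC divfK// gt_eqF.
rewrite sn tn -!flow_iter//.
have base y : K y ->
    flow W (s / n%:R) (flow V (t / n%:R) y) = flow V (t / n%:R) (flow W (s / n%:R) y).
  by move=> Ky; rewrite eP//; apply: small; rewrite le_max lexx ?orbT.
have KWi k y : K y -> K (iter k (flow W (s / n%:R)) y).
  by move=> Ky; elim: k => //= k; exact: KW.
apply: (iter_commute (K := K)) => //; [exact: KV|exact: KWi|].
move=> y Ky; rewrite (iter_commute n (K := K) (f := flow W (s / n%:R)))//.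
- exact: KW.
- exact: KV.
Qed.

End CommutingFlows.

(** * Hamiltonian vector fields *)

(* In index notation with d_a = partial derivatives: differentiating the identities
   v W = - dF, u W = - dG and v W u = 0 and using dW = 0 yields [v, u] W = 0. *)
Lemma bracket_algebra (R : comRingType) m (v u : 'I_m -> R) (W dv du F G : 'I_m -> 'I_m -> R)
    (dW : 'I_m -> 'I_m -> 'I_m -> R) (b : 'I_m) :
  (forall a c, \sum_k (dv a k * W k c + v k * dW a k c) = - F a c) ->
  (forall a c, \sum_k (du a k * W k c + u k * dW a k c) = - G a c) ->
  (forall a, \sum_k \sum_l
     (dv a k * W k l * u l + v k * dW a k l * u l + v k * W k l * du a l) = 0) ->
  (forall a c, W a c = - W c a) -> (forall a k l, dW a k l = - dW a l k) ->
  (forall a k l, dW a k l + dW k l a + dW l a k = 0) ->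
  (forall a c, F a c = F c a) -> (forall a c, G a c = G c a) ->
  \sum_c (\sum_a v a * du a c - \sum_a u a * dv a c) * W c b = 0.
Proof.
move=> HF HG H3 Ws dWs dWc Fs Gs.
pose S (f : 'I_m -> 'I_m -> R) := \sum_a \sum_c f a c.
have SD f g : S (fun a c => f a c + g a c) = S f + S g.
  by rewrite /S -big_split; apply: eq_bigr => a _; rewrite -big_split.
have SN f : S (fun a c => - f a c) = - S f.
  by rewrite /S -sumrN; apply: eq_bigr => a _; rewrite -sumrN.
have Ssw f : S f = S (fun a c => f c a) by rewrite /S exchange_big.
have half (x y : 'I_m -> R) (dy K : 'I_m -> 'I_m -> R) :
    (forall a c, \sum_k (dy a k * W k c + y k * dW a k c) = - K a c) ->
    (forall a c, K a c = K c a) ->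
    S (fun a c => x a * dy a c * W c b) = S (fun a c => x a * dy b c * W c a
       + x a * y c * dW b c a - x a * y c * dW a c b).
  move=> HK Ks.
  have E a : \sum_c x a * dy a c * W c b + \sum_c x a * y c * dW a c b = x a * - K a b.
    rewrite -HK mulr_sumr -big_split; apply: eq_bigr => c _; rewrite /=; ring.
  have E' a : \sum_c (x a * dy b c * W c a + x a * y c * dW b c a) = x a * - K a b.
    rewrite Ks -HK mulr_sumr; apply: eq_bigr => c _; ring.
  rewrite SD SN; apply/(canRL (addrK _)).
  rewrite /S -big_split; apply: eq_bigr => a _ /=; by rewrite E E'.
have -> : \sum_c (\sum_a v a * du a c - \sum_a u a * dv a c) * W c b =
    S (fun a c => v a * du a c * W c b) - S (fun a c => u a * dv a c * W c b).
  rewrite -SN -SD Ssw; apply: eq_bigr => c _; rewrite mulrBl !mulr_suml -sumrB.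
  by apply: eq_bigr => a _.
rewrite (half v u du G HG Gs) (half u v dv F HF Fs).
rewrite [X in _ - X]Ssw -SN -SD.
rewrite -[RHS]oppr0 -(H3 b) -SN; apply: eq_bigr => a _; apply: eq_bigr => c _.
have e1 := dWc a c b; have e2 := dWs c b a.
have -> : dW a c b = dW c a b - dW b a c.
  by apply/eqP; rewrite -subr_eq0 -e1 e2; apply/eqP; ring.
rewrite (Ws c a) (dWs b c a); ring.
Qed.

Section Hamiltonian.
Context {R : realType} {m : nat} {X : smoothManifold R m}.
Variable w : symplectic_form X.
Implicit Types (F G : X -> R) (c d : chart X).

Definition smooth_fun F := forall c x, cimg c x -> forall k, ck k (fun y => F (cinv c y)) x.

Lemma differential_change F c d p : smooth_fun F -> cdom c p -> cdom d p ->
  differential F c p = differential F d p *m ('J (fun x => cmap d (cinv c x)) (cmap c p))^T.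
Proof.
move=> Fs cp dp; apply/rowP => i; rewrite !mxE.
set phi := fun x => cmap d (cinv c x); have df : differentiable phi (cmap c p).
  exact: transition_differentiable.
have phip : phi (cmap c p) = cmap d p by rewrite /phi cmapKE.
have FC : C1at (fun y => F (cinv d y)) (phi (cmap c p)).
  by rewrite phip; exact: (ck_C1at (Fs d _ (cimg_cmap dp) 1%N)).
have := C1at_chain (derivableP (diff_derivable (v := delta_mx 0 i) df)) FC.
rewrite deriveEjacobian// -rowE phip => H.
have [_ ->] : is_derive (cmap c p) (delta_mx 0 i) (fun x => F (cinv c x))
    (\sum_j row i ('J phi (cmap c p)) 0 j * 'D_(delta_mx 0 j) (fun y => F (cinv d y)) (cmap d p)).
  apply: near_eq_is_derive H.
  have cc : {for cmap c p, continuous (cinv c)} by apply: cinv_cont; exact: cimg_cmap.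
  have dpc : cdom d (cinv c (cmap c p)) by rewrite cmapKE.
  apply: (near_imp (near_cont cc (near_cdom dpc))) => y dy.
  by rewrite /= /phi cmapKE.
by apply: eq_bigr => j _; rewrite !mxE mulrC.
Qed.

(** No inverse transition map is differentiated: [w c p] is invertible and factors through [J], so
    [J] is invertible. *)
Lemma jacobian_unit c d p : cdom c p -> cdom d p ->
  'J (fun x => cmap d (cinv c x)) (cmap c p) \in unitmx.
Proof.
move=> cp dp; have := omega_nondegenerate w cp; rewrite (omega_change w cp dp).
by rewrite !unitmx_mul => /andP[/andP[]].
Qed.

(** Passing between charts multiplies the covector -dF by J^T and omega by J and J^T; cancelling J^T
    leaves the law for vectors. *)
Lemma hamiltonian_change F c d p : smooth_fun F -> cdom c p -> cdom d p ->
  hamiltonian_field w F d p =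
  hamiltonian_field w F c p *m 'J (fun x => cmap d (cinv c x)) (cmap c p).
Proof.
move=> Fs cp dp; have Ju := jacobian_unit cp dp; set J := 'J _ _ in Ju *.
have := hamiltonian_fieldE w F cp; rewrite (omega_change w cp dp) -/J.
rewrite (differential_change Fs cp dp) -/J -mulNmx !mulmxA => H.
have JTu : J^T \in unitmx by rewrite unitmx_tr.
have := congr1 (mulmx^~ (invmx J^T)) H; rewrite !mulmxK// => E.
by rewrite [LHS]/hamiltonian_field -E mulmxK//; exact: omega_nondegenerate.
Qed.

Lemma near_differential F c x i : cimg c x ->
  \forall y \near x, differential F c (cinv c y) 0 i =
    'D_(delta_mx 0 i) (fun z => F (cinv c z)) y.
Proof. by move=> /near_cimg/near_imp; apply => y cy; rewrite mxE cinvKE. Qed.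

Lemma hamiltonian_smooth F c x k j : smooth_fun F -> cimg c x ->
  ck k (fun y => hamiltonian_field w F c (cinv c y) 0 j) x.
Proof.
move=> Fs cx; rewrite /hamiltonian_field.
apply: (@ck_mulmx R m 1 m m k (fun y => - differential F c (cinv c y))
  (fun y => invmx (w c (cinv c y)))) => [i l|].
  rewrite (ord1 i); under eq_fun do rewrite mxE; apply: ckN.
  apply: (@ck_near_eq _ _ _ ('D_(delta_mx 0 l) (fun z => F (cinv c z)))).
    by apply: (near_imp (near_differential F l cx)) => y ->.
  exact: (Fs c x cx k.+1).2.
apply: ck_invmx => [|i l]; first by apply: omega_nondegenerate; exact: cdom_cinv.
exact: (Cinfty_ck (cimg_open (c := c)) (@omega_smooth _ _ _ w c i l) cx k).
Qed.

Lemma hamiltonian_smooth_field F : smooth_fun F -> smooth_field (hamiltonian_field w F).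
Proof.
move=> Fs; split=> [c d p cp dp|c x cx k j]; first exact: hamiltonian_change.
exact: hamiltonian_smooth.
Qed.

(** Both sides are dG(V_F): transposing V_G W = - dG and using that W is skew gives W V_G^T =
    dG^T. *)
Lemma hamiltonian_derivative F G c p : cdom c p ->
  \sum_a hamiltonian_field w F c p 0 a * differential G c p 0 a =
  (hamiltonian_field w F c p *m w c p *m (hamiltonian_field w G c p)^T) 0 0.
Proof.
move=> cp; have := congr1 trmx (hamiltonian_fieldE w G cp).
rewrite trmx_mul omega_skew// mulNmx [(- differential _ _ _)^T]raddfN => /oppr_inj e.
by rewrite -mulmxA e mxE; apply: eq_bigr => a _; congr (_ * _); rewrite [RHS]mxE.
Qed.

Lemma poisson_chart F G c p : smooth_fun F -> smooth_fun G -> cdom c p ->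
  (hamiltonian_field w F c p *m w c p *m (hamiltonian_field w G c p)^T) 0 0 = poisson w F G p.
Proof.
move=> Fs Gs cp; rewrite /poisson; set d := chart_at p.
have dp : cdom d p by exact: cdom_chart_at.
rewrite (hamiltonian_change Fs cp dp) (hamiltonian_change Gs cp dp) (omega_change w cp dp).
by rewrite [(_ *m 'J _ _)^T]trmx_mul !mulmxA.
Qed.

Lemma smooth_fun_C1at F c p : smooth_fun F -> cdom c p ->
  C1at (fun y => F (cinv c y)) (cmap c p).
Proof. by move=> Fs cp; exact: (ck_C1at (Fs c _ (cimg_cmap cp) 1%N)). Qed.

Lemma is_derive_along_icurve V F g (t : R) c : smooth_fun F -> icurve_at V g t ->
  cdom c (g t) ->
  is_derive t 1 (fun s => F (g s)) (\sum_a V c (g t) 0 a * differential F c (g t) 0 a).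
Proof.
move=> Fs [gc gd] cg.
have := C1at_chain (gd c cg) (smooth_fun_C1at Fs cg) => H.
apply: (@near_eq_is_derive _ _ _ ((fun y => F (cinv c y)) \o (fun s => cmap c (g s)))).
  by apply: (near_imp (near_cont gc (near_cdom cg))) => s cs /=; rewrite cmapKE.
by apply: (is_derive_eq H); apply: eq_bigr => a _; rewrite mxE.
Qed.

(** The derivative of [G] along the curve is dG(V_F) = {F, G} = 0. *)
Lemma hamiltonian_conserved F G g e : smooth_fun F -> smooth_fun G ->
  (forall p, poisson w F G p = 0) ->
  (forall t, `|t| < e -> icurve_at (hamiltonian_field w F) g t) ->
  forall t, `|t| < e -> G (g t) = G (g 0).
Proof.
move=> Fs Gs FG gP t te; apply/eqP; rewrite -subr_eq0 -normr_le0; rewrite -[leRHS](mul0r `|t|).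
apply: (@mvt_le R (fun s => G (g s)) (fun=> 0)) => u /andP[u0 u1]; last by rewrite normr0.
have ute : `|u * t| < e.
  by apply: le_lt_trans te; rewrite normrM ger0_norm// ler_piMl.
apply: (is_derive_eq (is_derive_along_icurve Gs (gP _ ute) (cdom_chart_at _))).
by rewrite hamiltonian_derivative ?poisson_chart//; exact: cdom_chart_at.
Qed.

(** The identities needed by [bracket_algebra] come from differentiating, in a chart, the
    definitions of the two fields ([first]) and the relation {F, G} = 0 ([third]); [schwarz] and
    closedness of omega supply the symmetries. The bracket [z] is then annihilated by omega, hence
    zero. *)
Lemma hamiltonian_commuting F G : smooth_fun F -> smooth_fun G ->
  (forall p, poisson w F G p = 0) ->
  commuting_fields (hamiltonian_field w F) (hamiltonian_field w G).
Proof.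
move=> Fs Gs FG c x cx.
pose v (H : X -> R) a y := hamiltonian_field w H c (cinv c y) 0 a.
pose W a b y := w c (cinv c y) a b.
have cdx := cdom_cinv cx.
have vC H a : smooth_fun H -> C1at (v H a) x.
  by move=> Hs; exact: (ck_C1at (hamiltonian_smooth 1%N a Hs cx)).
have WC a b : C1at (W a b) x.
  apply: (@ck_C1at _ _ 0).
  exact: (Cinfty_ck (cimg_open (c := c)) (@omega_smooth _ _ _ w c a b) cx 1%N).
have vd H a i : smooth_fun H -> is_derive x (delta_mx 0 i) (v H a) ('D_(delta_mx 0 i) (v H a) x).
  by move=> Hs; apply: derivableP; exact: (diff_derivable (C1at_differentiable (vC H a Hs))).
have Wd a b i : is_derive x (delta_mx 0 i) (W a b) ('D_(delta_mx 0 i) (W a b) x).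
  by apply: derivableP; exact: (diff_derivable (C1at_differentiable (WC a b))).
have first H : smooth_fun H -> forall a b,
    \sum_k ('D_(delta_mx 0 a) (v H k) x * W k b x + v H k x * 'D_(delta_mx 0 a) (W k b) x) =
    - 'D_(delta_mx 0 a) ('D_(delta_mx 0 b) (fun y => H (cinv c y))) x.
  move=> Hs a b.
  have e : \forall y \near x, \sum_k v H k y * W k b y
      = - 'D_(delta_mx 0 b) (fun y => H (cinv c y)) y.
    apply: (near_and (near_cimg cx) (near_differential H b cx)) => y cy <-.
    have := hamiltonian_fieldE w H (cdom_cinv cy) => /matrixP/(_ 0 b).
    by rewrite !mxE.
  have Hd : is_derive x (delta_mx 0 a) ('D_(delta_mx 0 b) (fun y => H (cinv c y)))
      ('D_(delta_mx 0 a) ('D_(delta_mx 0 b) (fun y => H (cinv c y))) x).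
    by apply: derivableP; exact: (nbhs_singleton ((Hs c x cx 2%N).2 b).1).2.
  have [_ <-] := is_deriveN Hd.
  have [_ <-] : is_derive x (delta_mx 0 a) (fun y => \sum_k v H k y * W k b y)
     (\sum_k ('D_(delta_mx 0 a) (v H k) x * W k b x + v H k x * 'D_(delta_mx 0 a) (W k b) x)).
    have := @is_derive_sum _ _ _ _ (fun k => v H k * W k b) x (delta_mx 0 a) _
       (fun k => is_deriveM (vd H k a Hs) (Wd k b a)).
    rewrite (_ : \sum_i _ = (fun y => \sum_k v H k y * W k b y)); last first.
      by apply: funext => y; rewrite fct_sumE.
    move/is_derive_eq; apply; apply: eq_bigr => k _.
    by rewrite addrC [_ *: _]mulrC.
  exact: near_eq_derive.
have third a : \sum_k \sum_l ('D_(delta_mx 0 a) (v F k) x * W k l x * v G l x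
    + v F k x * 'D_(delta_mx 0 a) (W k l) x * v G l x
    + v F k x * W k l x * 'D_(delta_mx 0 a) (v G l) x) = 0.
  have e : \forall y \near x, \sum_k \sum_l v F k y * W k l y * v G l y = 0.
    apply: (near_imp (near_cimg cx)) => y cy.
    apply: etrans (FG (cinv c y)).
    rewrite -(poisson_chart Fs Gs (cdom_cinv cy)) [RHS]mxE exchange_big.
    by apply: eq_bigr => l _; rewrite [(_ *m _) 0 l]mxE [_^T l 0]mxE mulr_suml.
  have [_ <-] : is_derive x (delta_mx 0 a) (fun y => \sum_k \sum_l v F k y * W k l y * v G l y)
     (\sum_k \sum_l ('D_(delta_mx 0 a) (v F k) x * W k l x * v G l x
    + v F k x * 'D_(delta_mx 0 a) (W k l) x * v G l x
    + v F k x * W k l x * 'D_(delta_mx 0 a) (v G l) x)).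
    have := @is_derive_sum _ _ _ _ (fun k => \sum_l v F k * W k l * v G l) x (delta_mx 0 a) _
      (fun k => @is_derive_sum _ _ _ _ (fun l => v F k * W k l * v G l) x (delta_mx 0 a) _
       (fun l => is_deriveM (is_deriveM (vd F k a Fs) (Wd k l a)) (vd G l a Gs))).
    rewrite (_ : \sum_i _ = (fun y => \sum_k \sum_l v F k y * W k l y * v G l y)); last first.
      by apply: funext => y; rewrite fct_sumE; apply: eq_bigr => k _; rewrite fct_sumE.
    move/is_derive_eq; apply; apply: eq_bigr => k _; apply: eq_bigr => l _.
    rewrite -![_ *: _]/(_ * _) -![(_ * _) x]/(_ x * _ x); ring.
  by rewrite (near_eq_derive _ e) derive_cst.
have skew k l y : cimg c y -> W k l y = - W l k y.
  move=> cy; have := omega_skew w (cdom_cinv cy) => /matrixP/(_ l k).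
  by rewrite !mxE.
have dskew a k l : 'D_(delta_mx 0 a) (W k l) x = - 'D_(delta_mx 0 a) (W l k) x.
  have [_ <-] := is_deriveN (Wd l k a).
  by apply: near_eq_derive; apply: (near_imp (near_cimg cx)) => y; exact: skew.
have sym H a b : smooth_fun H -> 'D_(delta_mx 0 a) ('D_(delta_mx 0 b) (fun y => H (cinv c y))) x
  = 'D_(delta_mx 0 b) ('D_(delta_mx 0 a) (fun y => H (cinv c y))) x.
  by move=> Hs; apply: schwarz; exact: Hs.
have key b := @bracket_algebra R m (fun a => v F a x) (fun a => v G a x) (fun a b => W a b x)
  (fun a k => 'D_(delta_mx 0 a) (v F k) x) (fun a k => 'D_(delta_mx 0 a) (v G k) x)
  _ _ (fun a k l => 'D_(delta_mx 0 a) (W k l) x) b (first F Fs) (first G Gs) third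
  (fun k l => skew k l x cx) dskew (fun i j l => omega_closed w i j l cx)
  (fun a b => sym F a b Fs) (fun a b => sym G a b Gs).
pose z : 'rV[R]_m := \row_j (\sum_a v F a x * 'D_(delta_mx 0 a) (v G j) x -
  \sum_a v G a x * 'D_(delta_mx 0 a) (v F j) x).
have zw : z *m w c (cinv c x) = 0.
  apply/rowP => b; rewrite !mxE -[RHS](key b); apply: eq_bigr => j _.
  by rewrite mxE.
have z0 : z = 0 by rewrite -[z](mulmxK (omega_nondegenerate w cdx)) zw mul0mx.
by move=> j; apply/eqP; rewrite -subr_eq0; apply/eqP; have /rowP/(_ j) := z0; rewrite !mxE.
Qed.

End Hamiltonian.

(** * Inverse function theorem *)

Section LocalInverse.
Context {R : realType}.

Variables (n : nat) (Psi : 'rV[R]_n -> 'rV[R]_n) (t0 : 'rV[R]_n).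
Hypothesis Psis : \forall t \near t0, forall k j, ck k (fun t => Psi t 0 j) t.
Hypothesis Psi1 : forall i j, 'D_(delta_mx 0 i) (fun t => Psi t 0 j) t0 = (i == j)%:R.

Let y0 := Psi t0.

Let Psik : forall k j, ck k (fun t => Psi t 0 j) t0 := nbhs_singleton Psis.

(** Since the Jacobian at [t0] is the identity, strict differentiability with error 1/2 says that
    Psi - id is a contraction near [t0]. *)
Let strict : exists2 r, 0 < r & forall s t, `|s - t0| < r -> `|t - t0| < r ->
  `|Psi s - Psi t - (s - t)| <= 2^-1 * `|s - t|.
Proof.
have h0 : 0 < 2^-1 :> R by rewrite invr_gt0.
have [|j|r r0 H] := @fin_radius R 'I_n (fun j r => forall s t, `|s - t0| < r -> `|t - t0| < r ->
   `|Psi s 0 j - Psi t 0 j - \sum_i (s - t) 0 i * 'D_(delta_mx 0 i) (fun t => Psi t 0 j) t0|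
     <= 2^-1 * `|s - t|).
- by move=> j r r' _ rr K s t sr tr; apply: K; exact: lt_le_trans rr.
- exact: (C1at_strict (ck_C1at (Psik 1 j)) h0).
exists r => // s t sr tr; apply: rV_norm_le => [|j]; first by rewrite mulr_ge0// ltW.
have := H j s t sr tr; rewrite (bigD1 j)//= big1 => [|i ij]; last first.
  by rewrite Psi1 (negbTE ij) mulr0.
by rewrite Psi1 eqxx mulr1 addr0 !mxE.
Qed.

Let expand r : (forall s t, `|s - t0| < r -> `|t - t0| < r ->
  `|Psi s - Psi t - (s - t)| <= 2^-1 * `|s - t|) ->
  forall s t, `|s - t0| < r -> `|t - t0| < r -> `|s - t| <= 2 * `|Psi s - Psi t|.
Proof.
move=> H s t sr tr; have := H s t sr tr.
have : `|s - t| <= `|Psi s - Psi t| + `|Psi s - Psi t - (s - t)|.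
  have := ler_normB (Psi s - Psi t) (Psi s - Psi t - (s - t)).
  by rewrite opprB addrC subrK.
by lra.
Qed.

(** Newton's iteration with the derivative frozen at the identity. The increments are at most C
    2^-k, so the iterates stay within 2 C < r / 2 of [t0] and converge to a solution. *)
Let surj r : 0 < r -> (forall s t, `|s - t0| < r -> `|t - t0| < r ->
  `|Psi s - Psi t - (s - t)| <= 2^-1 * `|s - t|) ->
  forall y, `|y - y0| < r / 4 -> exists s, `|s - t0| < r /\ Psi s = y.
Proof.
move=> r0 H y yr; set C := `|y - y0| in yr.
pose u k := iter k (fun s => s - (Psi s - y)) t0.
have uS k : u k.+1 = u k - (Psi (u k) - y) by [].
have inv k : `|u k - t0| <= 2 * C * (1 - 2^-1 ^+ k) /\ `|u k.+1 - u k| <= C * 2^-1 ^+ k.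
  elim: k => [|k [IH1 IH2]].
    rewrite subrr normr0 expr0 subrr mulr0 lexx mulr1; split=> //.
    by rewrite uS /u/= opprB addrAC subrr add0r.
  have h0 : 0 <= 2^-1 ^+ k :> R by rewrite exprn_ge0.
  have C0 : 0 <= C by exact: normr_ge0.
  have hS : 2^-1 ^+ k.+1 = 2^-1 * 2^-1 ^+ k :> R by rewrite exprS.
  have Ch : 0 <= C * 2^-1 ^+ k by rewrite mulr_ge0.
  have A : `|u k.+1 - t0| <= 2 * C * (1 - 2^-1 ^+ k.+1).
    have -> : u k.+1 - t0 = (u k.+1 - u k) + (u k - t0) by rewrite subrKA.
    by apply: le_trans (ler_normD _ _) _; rewrite hS; lra.
  split=> //.
  have -> : u k.+2 - u k.+1 = - (Psi (u k.+1) - Psi (u k) - (u k.+1 - u k)).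
    rewrite (uS k.+1) [in X in _ - X](uS k) addrAC subrr add0r; congr (- _).
    by rewrite [u k.+1]uS [u k - _ - u k]addrAC subrr add0r opprK addrA subrK.
  rewrite normrN; apply: le_trans (H _ _ _ _) _.
  - by apply: le_lt_trans A _; rewrite hS; lra.
  - by apply: le_lt_trans IH1 _; lra.
  - by rewrite hS mulrCA ler_wpM2l.
have [l lP] := geometric_limit (fun k => (inv k).2).
have C0 : 0 <= C by exact: normr_ge0.
have lr : `|l - t0| < r.
  by have := lP 0%N; rewrite expr0 mulr1 distrC => A; apply: le_lt_trans A _; lra.
exists l; split=> //; apply/eqP; rewrite -subr_eq0 -normr_le0.
apply/ler_addgt0Pl => d d0; rewrite addr0.
have [k kP] := half_pow_small (4 * C) d0; apply: le_trans kP.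
have h0 : 0 <= 2^-1 ^+ k :> R by rewrite exprn_ge0.
have Ch : 0 <= C * 2^-1 ^+ k by rewrite mulr_ge0.
have [A B] := inv k; have D := lP k.
have ur : `|u k - t0| < r by apply: le_lt_trans A _; lra.
have E := H _ _ lr ur.
have -> : Psi l - y = (Psi l - Psi (u k) - (l - u k)) + ((l - u k) - (u k.+1 - u k)).
  by rewrite subrKA uS [u k - _ - u k]addrAC subrr add0r opprK subrKA.
apply: le_trans (ler_normD _ _) _; have := ler_normB (l - u k) (u k.+1 - u k).
by rewrite (distrC l) in E *; lra.
Qed.

Lemma local_inverse : exists theta : 'rV[R]_n -> 'rV[R]_n,
  [/\ theta (Psi t0) = t0,
      \forall y \near Psi t0, Psi (theta y) = y /\ forall k j, ck k (fun y => theta y 0 j) y &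
      \forall t \near t0, theta (Psi t) = t].
Proof.
have [r r0 H] := strict; have ex := expand H; have su := surj r0 H.
have /choice[theta thP] : forall y, exists s, `|y - y0| < r / 4 -> `|s - t0| < r /\ Psi s = y.
  move=> y; have [/su[s sP]|/negP ny] := boolP (`|y - y0| < r / 4); first by exists s.
  by exists t0.
have r4 : 0 < r / 4 by rewrite divr_gt0.
have thE t : `|t - t0| < r -> `|Psi t - y0| < r / 4 -> theta (Psi t) = t.
  move=> tr /thP[sr e]; apply/eqP; rewrite -subr_eq0 -normr_le0.
  by apply: le_trans (ex _ _ sr tr) _; rewrite e subrr normr0 mulr0.
have th0 : theta y0 = t0 by apply: thE; rewrite subrr normr0.
have Psic : {for t0, continuous Psi}.
  by apply: rV_continuous => j; exact: ck_continuous (Psik 0 j).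
have thL y z : `|y - y0| < r / 4 -> `|z - y0| < r / 4 -> `|theta y - theta z| <= 2 * `|y - z|.
  move=> /thP[yr ye] /thP[zr ze].
  by apply: le_trans (ex _ _ yr zr) _; rewrite ye ze.
have nearb y : `|y - y0| < r / 4 -> \forall z \near y, `|z - y0| < r / 4.
  exact: near_norm_lt.
have thc y : `|y - y0| < r / 4 -> {for y, continuous theta}.
  move=> yr; apply: continuous_eps => e e0.
  have ny : \forall z \near y, `|z - y| < e / 2.
    by apply: near_norm_lt; rewrite subrr normr0 divr_gt0.
  apply: (near_and (nearb y yr) ny) => z zr zy.
  by apply: le_trans (thL _ _ yr zr) _; rewrite distrC; lra.
pose J t : 'M[R]_n := \matrix_(i, j) 'D_(delta_mx 0 i) (fun t => Psi t 0 j) t.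
have Jk k i j : ck k (fun t => J t i j) t0.
  by under eq_fun do rewrite mxE; exact: (Psik k.+1 j).2.
have J1 : J t0 = 1%:M by apply/matrixP => i j; rewrite !mxE Psi1.
have Ju : J t0 \in unitmx by rewrite J1 unitmx1.
have near_th : \forall t \near t0, theta (Psi t) = t.
  have n1 : \forall t \near t0, `|t - t0| < r by apply: near_norm_lt; rewrite subrr normr0.
  have n2 : \forall t \near t0, `|Psi t - y0| < r / 4.
    have y0r : `|Psi t0 - y0| < r / 4 by rewrite subrr normr0.
    exact: (near_cont Psic (near_norm_lt y0r)).
  by apply: (near_and n1 n2) => t; exact: thE.
have good : \forall t \near t0, [/\ forall k j, ck k (fun t => Psi t 0 j) t,
    forall j, C1at (fun t => Psi t 0 j) t & J t \in unitmx].
  have g2 : \forall t \near t0, \det (J t) != 0.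
    have d0 : \det (J t0) != 0 by rewrite -unitfE -unitmxE.
    exact: cvgr_neq0 (ck_continuous (ck_det (Jk 0%N))) d0.
  apply: (near_and Psis g2) => t A B; split; [exact: A| |by rewrite unitmxE unitfE].
  by move=> j; exact: (ck_C1at (A 1%N j)).
have y0r : `|y0 - y0| < r / 4 by rewrite subrr normr0.
have goodth : \forall y \near y0, [/\ forall k j, ck k (fun t => Psi t 0 j) (theta y),
    forall j, C1at (fun t => Psi t 0 j) (theta y) & J (theta y) \in unitmx].
  apply: (near_cont (thc y0 y0r) (P := fun t => [/\ forall k j, ck k (fun t => Psi t 0 j) t,
    forall j, C1at (fun t => Psi t 0 j) t & J t \in unitmx])).
  by rewrite th0.
exists theta; split=> //.
apply: (near_and (near_join goodth) (near_join (nearb _ y0r))) => y1 goody1 nearby1.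
split; first exact: (thP _ (nbhs_singleton nearby1)).2.
(* The derivative of [theta] is the inverse of [J] evaluated at [theta] itself, which is the form
   required for bootstrapping. *)
apply: (@ck_bootstrap R n n theta (fun i j t => invmx (J t) i j)).
- by apply: (near_imp nearby1).
- apply: (near_and nearby1 goody1) => y yr [_ PC JU] i j.
  have [dPsi JE] := C1at_differentiable_rV PC.
  set t := theta y in PC JU dPsi JE *.
  have JE' : 'J Psi t = J t by rewrite JE.
  suff : is_derive y (delta_mx 0 i) theta (row i (invmx (J t))).
    by move/is_derive_rV/(_ j); rewrite mxE.
  (* With s = theta (y + h e_i), differentiability of [Psi] at [t] gives h e_i = (s - t) J + o(|s -
     t|), and |s - t| <= 2 |h|. Multiplying by the inverse of J yields the derivative; the factor 2
     C in [eta'] absorbs both constants. *)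
  have [C C0 CP] := mulmx_norm_le (invmx (J t)).
  apply/is_derive_eps => eta eta0.
  pose eta' := eta / (2 * C); have eta'0 : 0 < eta' by rewrite divr_gt0// mulr_gt0.
  have Lc : continuous ('d Psi t) by exact: diff_continuous.
  have /diff_locally/eqaddoP/(_ _ eta'0)/(ball_normP (0 : 'rV[R]_n) _).1[d d0 dP] := dPsi.
  have n1 : \forall h \near (0 : R), `|h *: (delta_mx 0 i : 'rV[R]_n) + y - y0| < r / 4 /\
    `|h| < d / 2.
    pose q := Num.min (r / 4 - `|y - y0|) (d / 2).
    apply: (ball_normP (0 : R) _).2; exists q.
      by rewrite lt_min subr_gt0 yr divr_gt0.
    move=> h; rewrite subr0 lt_min => /andP[h1 h2]; split=> //.
    rewrite -addrA; apply: le_lt_trans (ler_normD _ _) _; rewrite -ltrBrDr.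
    apply: le_lt_trans h1; rewrite normrZ ler_piMr//; exact: norm_delta_le.
  apply: (near_imp n1) => h [hr hd].
  set v := h *: (delta_mx 0 i : 'rV[R]_n) in hr *.
  have vh : `|v| <= `|h| by rewrite normrZ ler_piMr//; exact: norm_delta_le.
  set s := theta (v + y).
  have [sr se] := thP _ hr; have [tr te] := thP _ yr.
  have st : `|s - t| <= 2 * `|h|.
    apply: le_trans (thL _ _ hr yr) _; rewrite addrK ler_wpM2l//.
  have sd : `|s - t - 0| < d by rewrite subr0; apply: le_lt_trans st _; lra.
  have D := dP _ sd.
  have {D} : `|v - (s - t) *m J t| <= eta' * `|s - t|.
    move: D; rewrite -[X in `|X| <= _]/(Psi (s - t + t) - (Psi t + 'd Psi t (s - t))).
    rewrite subrK [Psi s]se [Psi t]te -deriveE// deriveEjacobian// JE' opprD addrA addrK.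
    by [].
  have -> : s - t - h *: row i (invmx (J t)) = - ((v - (s - t) *m J t) *m invmx (J t)).
    by rewrite mulmxBl mulmxK// /v -scalemxAl -rowE opprB.
  move=> D; rewrite normrN; apply: le_trans (CP _) _.
  apply: (@le_trans _ _ (C * (eta' * (2 * `|h|)))).
    rewrite ler_wpM2l ?(ltW C0)//; apply: le_trans D _.
    by rewrite ler_wpM2l// ltW.
  rewrite (_ : C * _ = eta * `|h|)// /eta'; field.
  by rewrite gt_eqF.
- move=> i j k; have [ckth _ JU] := nbhs_singleton goody1.
  apply: ck_invmx => // a b; under eq_fun do rewrite mxE; exact: (ckth k.+1 b).2.
Qed.

End LocalInverse.

(** * Discrete subgroups of R^n *)

Section Lattice.
Context {R : realType}.

Definition is_subgroup n (L : set 'rV[R]_n) := L 0 /\ forall x y, L x -> L y -> L (x - y).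

Definition is_discrete n (L : set 'rV[R]_n) :=
  exists2 r, 0 < r & forall x, L x -> `|x| < r -> x = 0.

Lemma subgroupN n (L : set 'rV[R]_n) x : is_subgroup L -> L x -> L (- x).
Proof. by move=> [L0 LB] Lx; rewrite -sub0r; exact: LB. Qed.

Lemma subgroupD n (L : set 'rV[R]_n) x y : is_subgroup L -> L x -> L y -> L (x + y).
Proof. by move=> Ls Lx /(subgroupN Ls) Ly; rewrite -[y]opprK; exact: Ls.2. Qed.

Lemma subgroup_int n (L : set 'rV[R]_n) (a : R) x : is_subgroup L ->
  a \is a Num.int -> L x -> L (a *: x).
Proof.
move=> Ls /floorK <- Lx; rewrite scaler_int.
have Ln k : L (x *+ k).
  by elim: k => [|k IH]; [rewrite mulr0n; exact: Ls.1|rewrite mulrS; exact: subgroupD].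
case: (Num.floor a) => k; first exact: Ln.
by rewrite NegzE mulrNz; apply: subgroupN => //; exact: Ln.
Qed.

Lemma subgroup_sum n (L : set 'rV[R]_n) (I : finType) (f : I -> 'rV[R]_n) :
  is_subgroup L -> (forall i, L (f i)) -> L (\sum_i f i).
Proof.
move=> Ls Lf; elim/big_rec: _ => [|i x _ Lx]; first exact: Ls.1.
exact: subgroupD.
Qed.

(** The generator is a *: w for the least positive [a] with a *: w in [L]; if b *: v is in [L], a
    nonzero fractional part of [b] would produce a smaller one. *)
Lemma discrete_line n (L : set 'rV[R]_n) w : is_subgroup L -> is_discrete L ->
  L w -> w != 0 -> exists2 v, v != 0 & forall b : R, L (b *: v) <-> b \is a Num.int.
Proof.
move=> Ls [r r0 Lr] Lw w0.
have nw : 0 < `|w| by rewrite normr_gt0.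
pose S := [set a : R | 0 < a /\ L (a *: w)].
pose d := r / `|w|; have d0 : 0 < d by rewrite divr_gt0.
have Sd a : S a -> d <= a.
  move=> [a0 La]; rewrite leNgt; apply/negP => ad.
  have : a *: w = 0 by apply: Lr => //; rewrite normrZ gtr0_norm// -ltr_pdivlMr.
  by move/eqP; rewrite scaler_eq0 gt_eqF//= (negbTE w0).
have S1 : S 1 by split; rewrite ?scale1r.
have hS : has_inf S by split; [exists 1|exists d => a; exact: Sd].
(* A positive difference of two elements of [S] is again in [S], hence at least [d]; so an element
   within [d] of the infimum is the minimum. *)
have [a [[a0 La] amin]] : exists a, S a /\ forall b, S b -> a <= b.
  have [a Sa ad] := inf_adherent d0 hS.
  exists a; split=> // b Sb; rewrite leNgt; apply/negP => ba.
  have : S (a - b).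
    by split; [rewrite subr_gt0|rewrite scalerBl; apply: Ls.2; [exact: Sa.2|exact: Sb.2]].
  move/Sd; have : inf S <= b by apply: ge_inf => //; case: hS.
  by lra.
exists (a *: w) => [|b]; first by rewrite scaler_eq0 gt_eqF.
split=> [Lb|bi]; last exact: subgroup_int.
pose e := b - (Num.floor b)%:~R.
have Le : L ((e * a) *: w).
  rewrite -scalerA /e scalerBl; apply: Ls.2 => //.
  by apply: subgroup_int => //; exact: intr_int.
have := floor_itv b; rewrite intrD1 => /andP[b1 b2].
have [e0|e0] := eqVneq e 0.
  by move: e0 => /subr0_eq ->; exact: intr_int.
have ep : 0 < e by rewrite lt_def e0 subr_ge0.
have : a <= e * a by apply: amin; split=> //; rewrite mulr_gt0.
have : 0 < (1 - e) * a by rewrite mulr_gt0// /e; lra.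
by lra.
Qed.

(* By Dirichlet's pigeonhole argument, if y is short then some multiple of (x, y) with a
   coefficient in 1..N is, modulo the first basis vector, a short vector of L, hence 0. *)
Lemma discrete_projection n (L : set 'rV[R]_(1 + n)) : is_subgroup L -> is_discrete L ->
  L (row_mx 1%:M 0) ->
  is_discrete [set y : 'rV[R]_n | exists x : 'rV[R]_1, L (row_mx x y)].
Proof.
move=> Ls [r r0 Lr] L1.
pose N := (Num.bound r^-1).+1.
have N0 : 0 < N%:R :> R by rewrite ltr0n.
have Nr : N%:R^-1 < r.
  rewrite invf_plt ?posrE//; apply: lt_trans (_ : (Num.bound r^-1)%:R < _); last first.
    by rewrite ltr_nat.
  by apply: Num.Theory.archi_boundP; rewrite invr_ge0 ltW.
(* The multiple of [y] that will be used has a coefficient of at most [N], so it stays shorter than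
   [r]. *)
exists (r / N%:R); first by rewrite divr_gt0.
move=> y [x Lxy] yr; pose a := x 0 0.
pose fr (j : nat) := j%:R * a - (Num.floor (j%:R * a))%:~R.
have frP j : 0 <= fr j < 1.
  by have := floor_itv (j%:R * a); rewrite intrD1 => /andP[b1 b2]; apply/andP; rewrite /fr;
    split; lra.
have flP j : (Num.truncn (N%:R * fr j) < N)%N.
  have /andP[f0 f1] := frP j.
  rewrite -(ltr_nat R); apply: le_lt_trans (_ : N%:R * fr j < _).
    by rewrite truncn_le// mulr_ge0// ltW.
  by rewrite -[ltRHS]mulr1 ltr_pM2l.
pose fl (j : 'I_N.+1) : 'I_N := Ordinal (flP j).
have : ~~ injectiveb fl.
  by apply/negP => /injectiveP/leq_card; rewrite !card_ord ltnn.
move/injectivePn => [i [j ij /(congr1 val)/= flij]].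
wlog ltij : i j ij flij / (i < j)%N.
  move=> W; have [ilj|jli|e] := ltngtP i j; first exact: (W i j).
    by apply: (W j i) => //; rewrite eq_sym.
    by move: ij; rewrite (val_inj e) eqxx.
have tr k : (Num.truncn (N%:R * fr k))%:R <= N%:R * fr k < (Num.truncn (N%:R * fr k)).+1%:R.
  by apply: truncn_itv; have /andP[f0 f1] := frP k; rewrite mulr_ge0// ltW.
have close : `|fr j - fr i| < N%:R^-1.
  rewrite -(ltr_pM2l N0) divff ?gt_eqF// -[X in X * `|_|](gtr0_norm N0) -normrM.
  have /andP[i1 i2] := tr i; have /andP[j1 j2] := tr j.
  by rewrite flij -natr1 in i1 i2; rewrite -natr1 in j2; rewrite ltr_norml; apply/andP; split; lra.
pose z := (j - i)%:R *: row_mx x y -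
  ((Num.floor (j%:R * a))%:~R - (Num.floor (i%:R * a))%:~R) *: row_mx 1%:M 0.
have Lz : L z.
  apply: Ls.2; apply: subgroup_int => //.
  by rewrite rpredB ?intr_int.
have zE : z = row_mx (const_mx (fr j - fr i)) ((j - i)%:R *: y).
  rewrite /z !scale_row_mx scaler0 opp_row_mx add_row_mx oppr0 addr0; congr row_mx.
  apply/rowP => k; rewrite (ord1 k) !mxE /fr natrB 1?ltnW// -/a eqxx mulr1; ring.
have z0 : z = 0.
  apply: Lr => //; rewrite zE; apply: rV_norm_lt => // k.
  case: (split_ordP k) => l ->.
    by rewrite row_mxEl mxE; exact: lt_trans Nr.
  rewrite row_mxEr mxE normrM ger0_norm//.
  apply: (@le_lt_trans _ _ (N%:R * `|y|)); last by rewrite mulrC -ltr_pdivlMr.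
  apply: ler_pM => //; last exact: rV_norm_coord.
  by rewrite ler_nat (leq_trans (leq_subr _ _))// -ltnS.
move: z0; rewrite zE -[0]row_mx0 => /eq_row_mx[_ /eqP].
by rewrite scaler_eq0 pnatr_eq0 subn_eq0 leqNgt ltij => /eqP.
Qed.

(** For k <= n this is membership in Z^k x 0, the first [k] coordinates being the integral ones. *)
Definition lattice_coord n (k : nat) (c : 'rV[R]_n) :=
  forall i : 'I_n, if (i < k)%N then c 0 i \is a Num.int else c 0 i == 0.

Lemma first_vector n (v : 'rV[R]_(1 + n)) : v != 0 ->
  exists2 P : 'M[R]_(1 + n), P \in unitmx & v *m P = row_mx 1%:M 0.
Proof.
move=> v0; pose E := row_ebase v; pose a := col_ebase v 0 0.
have rk : \rank v = 1%N by rewrite rank_rV v0.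
have au : a != 0.
  have : col_ebase v \in unitmx by exact: col_ebase_unit.
  by rewrite unitmxE [col_ebase v]mx11_scalar det_scalar1 unitfE.
have vE : v = (a *: row_mx 1%:M 0 : 'rV_(1 + n)) *m E.
  rewrite -[LHS]mulmx_ebase rk [col_ebase v]mx11_scalar mul_scalar_mx -/a; congr (_ *: _ *m _).
  by apply/rowP => i; case: (split_ordP i) => j ->;
    rewrite ?row_mxEl ?row_mxEr !mxE ?(ord1 j)//= andbC.
have Eu : E \in unitmx by exact: row_ebase_unit.
exists (a^-1 *: invmx E).
  by rewrite unitmxE detZ unitrM -unitmxE unitmx_inv Eu andbT unitrX// unitfE invr_eq0.
by rewrite -scalemxAr {1}vE mulmxK// scalerA mulVf// scale1r.
Qed.

(** Induction on [n]: a generator of [L] on some line is moved to the first basis vector by [P]; the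
    projection [M] along it is again discrete and has a basis by induction, which is lifted back to
    the subgroup. *)
Lemma discrete_subgroup n (L : set 'rV[R]_n) : is_subgroup L -> is_discrete L ->
  exists2 k, (k <= n)%N & exists2 A : 'M[R]_n, A \in unitmx &
    forall t, L t <-> lattice_coord k (t *m A).
Proof.
elim: n L => [|n IH] L Ls Ld.
  exists 0%N => //; exists 1%:M => [|t]; first exact: unitmx1.
  split=> [_ []//|_]; have -> : t = 0 by apply/rowP => -[].
  exact: Ls.1.
have [[w [Lw w0]]|L0] := pselect (exists w, L w /\ w != 0); last first.
  exists 0%N => //; exists 1%:M => [|t]; first exact: unitmx1.
  rewrite mulmx1; split=> [Lt i|H].
    by rewrite ltn0; have [->|t0] := eqVneq t 0; [rewrite mxE|case: L0; exists t].
  have -> : t = 0 by apply/rowP => i; rewrite mxE; apply/eqP; exact: H.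
  exact: Ls.1.
have [v v0 vP] := discrete_line Ls Ld Lw w0.
have [P Pu vPE] := @first_vector n v v0.
pose L' : set 'rV[R]_(1 + n) := [set x | L (x *m invmx P)].
have L's : is_subgroup L'.
  split; first by rewrite /L'/= mul0mx; exact: Ls.1.
  by move=> x y Lx Ly; rewrite /L'/= mulmxBl; exact: Ls.2.
have vE : row_mx 1%:M 0 *m invmx P = v by rewrite -vPE mulmxK.
have L'1 b : L' (row_mx (b%:M : 'M[R]_1) 0) <-> b \is a Num.int.
  rewrite -vP /L'/= -vE scalemxAl scale_row_mx scaler0.
  by rewrite scalemx1.
have L'd : is_discrete L'.
  have [r r0 Lr] := Ld.
  have [K K0 KP] := mulmx_norm_le (invmx P).
  exists (r / K); first by rewrite divr_gt0.
  move=> x Lx xr; have : x *m invmx P = 0.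
    by apply: Lr => //; apply: le_lt_trans (KP x) _; rewrite mulrC -ltr_pdivlMr.
  by move/(congr1 (mulmx^~ P)); rewrite mulmxKV// mul0mx.
have L'1' : L' (row_mx 1%:M 0) by apply/L'1; exact: rpred1.
pose M := [set y : 'rV[R]_n | exists x : 'rV[R]_1, L' (row_mx x y)].
have Ms : is_subgroup M.
  split; first by exists 0; rewrite row_mx0; exact: L's.1.
  move=> y z [a La] [b Lb]; exists (a - b).
  by have := L's.2 _ _ La Lb; rewrite opp_row_mx add_row_mx.
have [k kn [A Au AP]] := IH M Ms (discrete_projection L's L'd L'1').
(* First coordinates of lifts of the lattice generators of [M]; the remaining basis vectors are
   lifted with first coordinate 0. *)
have /choice[X XP] : forall i : 'I_n, exists x : R,
    ((i < k)%N -> L' (row_mx x%:M (row i (invmx A)))) /\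
    (~~ (i < k)%N -> x = 0).
  move=> i; have [ik|ik] := boolP (i < k)%N; last by exists 0.
  have [x Lx] : M (row i (invmx A)).
    apply/AP => j; rewrite rowE -mulmxA mulVmx// mulmx1 mxE eqxx/=.
    have [->|ji] := eqVneq j i; first by rewrite ik; exact: rpred1.
    by case: ifP => // _; exact: rpred0.
  by exists (x 0 0); split=> // _; rewrite -mx11_scalar.
pose Y : 'cV[R]_n := \col_i X i.
(* The shear subtracts from the first coordinate that of the combination of lifts lying over [y];
   what remains is a multiple of the first basis vector, in the subgroup exactly when it is
   integral. *)
pose B : 'M[R]_(1 + n) := block_mx 1%:M 0 (- (A *m Y)) A.
have Bu : B \in unitmx.
  by rewrite unitmxE det_lblock det1 mul1r -unitmxE.
have cB (x : 'rV[R]_1) (y : 'rV[R]_n) : row_mx x y *m B = row_mx (x - y *m A *m Y) (y *m A).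
  by rewrite /B mul_row_block mulmx1 mulmx0 add0r mulmxN mulmxA.
have comb (c : 'rV[R]_n) : lattice_coord k c -> L' (row_mx (c *m Y) (c *m invmx A)).
  move=> ck; rewrite (_ : row_mx _ _ = \sum_i (c 0 i) *: row_mx (X i)%:M (row i (invmx A))).
    apply: subgroup_sum => // i; have [XL X0] := XP i; have := ck i.
    have [ik|ik] := boolP (i < k)%N; last by move/eqP ->; rewrite scale0r; exact: L's.1.
    by move=> ci; apply: subgroup_int => //; exact: XL.
  apply/rowP => l; rewrite summxE; case: (split_ordP l) => j ->.
    rewrite row_mxEl mxE; apply: eq_bigr => i _.
    by rewrite [Y _ _]mxE [RHS]mxE row_mxEl [_%:M _ _]mxE (ord1 j).
  rewrite row_mxEr mxE; apply: eq_bigr => i _.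
  by rewrite [RHS]mxE row_mxEr [row _ _ _ _]mxE.
have main (x : 'rV[R]_1) (y : 'rV[R]_n) :
    L' (row_mx x y) <-> lattice_coord k.+1 (row_mx x y *m B).
  rewrite cB; set c := y *m A; have yE : y = c *m invmx A by rewrite /c mulmxK.
  have split_coord : lattice_coord k.+1 (row_mx (x - c *m Y) c : 'rV_(1 + n)) <->
      (x - c *m Y) 0 0 \is a Num.int /\ lattice_coord k c.
    split=> [H|[H1 H2] i].
      split; first by have := H (lshift n 0); rewrite row_mxEl.
      by move=> i; have := H (rshift 1 i); rewrite row_mxEr.
    case: (split_ordP i) => j ->; first by rewrite row_mxEl (ord1 j).
    by rewrite row_mxEr; exact: H2.
  have diff : lattice_coord k c -> (L' (row_mx x y) <-> (x - c *m Y) 0 0 \is a Num.int).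
    move=> ck; have Lc := comb c ck; rewrite -yE in Lc.
    have e : row_mx ((x - c *m Y) 0 0)%:M 0 = row_mx x y - row_mx (c *m Y) y.
      by rewrite opp_row_mx add_row_mx subrr -mx11_scalar.
    rewrite -L'1 e; split=> H; first exact: L's.2.
    by have := subgroupD L's H Lc; rewrite subrK.
  rewrite split_coord; split=> [Lxy|[H1 H2]]; last exact/diff.
  have ck : lattice_coord k c by apply/AP; exists x.
  by split=> //; apply/diff.
exists k.+1 => //; exists (P *m B); first by rewrite unitmx_mul Pu.
move=> t; rewrite mulmxA -[t *m P](@hsubmxK R 1 1 n) -main hsubmxK.
by rewrite /L'/= mulmxK.
Qed.

End Lattice.

(** * Orbits of commuting flows *)

Section JointFlow.
Context {R : realType} {m n : nat} {X : smoothManifold R m}.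
Variable V : 'I_n -> chart X -> X -> 'rV[R]_m.
Hypothesis Vs : forall i, smooth_field (V i).
Hypothesis Vc : forall i, complete_field (V i).
Hypothesis VV : forall i j s t x, flow (V i) t (flow (V j) s x) = flow (V j) s (flow (V i) t x).

(** An arbitrary list of indices allows induction; on [enum 'I_n] and for Hamiltonian fields this
    unfolds to [joint_flow]. *)
Definition flow_along (l : seq 'I_n) (t : 'rV[R]_n) (x : X) : X :=
  foldr (fun i => flow (V i) (t 0 i)) x l.

Definition flow_action := flow_along (enum 'I_n).

Lemma flow_along_flow l t i s x : flow_along l t (flow (V i) s x) = flow (V i) s (flow_along l t x).
Proof. by elim: l => //= j l ->; exact: VV. Qed.

Lemma flow_actionD t u x : flow_action (t + u) x = flow_action t (flow_action u x).
Proof.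
rewrite /flow_action; elim: (enum _) => //= i l ->.
by rewrite mxE flowD// flow_along_flow.
Qed.

Lemma flow_action0 x : flow_action 0 x = x.
Proof.
rewrite /flow_action; elim: (enum _) => //= i l ->.
by rewrite mxE flow0.
Qed.

Lemma flow_action_delta i (s : R) x : flow_action (s *: delta_mx 0 i) x = flow (V i) s x.
Proof.
have notin l : i \notin l -> flow_along l (s *: delta_mx 0 i) x = x.
  elim: l => //= j l IH; rewrite inE negb_or => /andP[ij il].
  by rewrite IH// !mxE (negbTE (_ : j != i)) 1?eq_sym// andbF mulr0 flow0.
rewrite /flow_action; have := mem_enum 'I_n i; rewrite inE.
elim: (enum _) (enum_uniq 'I_n) => //= j l IH /andP[jl ul].
rewrite inE => /predU1P[e|il].
  by subst j; rewrite notin// !mxE !eqxx mulr1.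
have ji : j != i by apply: contraNneq jl => ->.
by rewrite IH// !mxE (negbTE ji) andbF mulr0 flow0.
Qed.

Lemma flow_along_near l (y : X) (U : X -> Prop) : (\forall q \near y, U q) ->
  exists2 e, 0 < e & \forall q \near y, forall t : 'rV[R]_n, `|t| < e -> U (flow_along l t q).
Proof.
elim: l U => [|i l IH] U yU.
  by exists 1 => //; apply: (near_imp yU) => q Uq t _.
have [e1 e10 /IH[e2 e20 H]] := flow_near (Vs i) (Vc i) yU.
exists (Num.min e1 e2); first by rewrite lt_min e10.
apply: (near_imp H) => q qP t; rewrite lt_min => /andP[te1 te2] /=.
apply: qP => //; apply: le_lt_trans te1; exact: rV_norm_coord.
Qed.

Variable x0 : X.
Let Phi t := flow_action t x0.

(** By the group law Phi(u) is the action of u - t on Phi(t), so only continuity of the action at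
    time 0 is involved. *)
Lemma orbit_map_continuous : continuous (fun t => flow_action t x0).
Proof.
move=> t U tU; have [e e0 H] := flow_along_near (enum 'I_n) tU.
have n1 : \forall u \near t, `|u - t| < e by apply: near_norm_lt; rewrite subrr normr0.
apply: (near_imp n1) => u ut; rewrite -[u](subrK t) /= flow_actionD.
exact: (nbhs_singleton H).
Qed.

Lemma orbit_map_derive t c i : cdom c (Phi t) ->
  is_derive t (delta_mx 0 i) (fun u => cmap c (Phi u)) (V i c (Phi t)).
Proof.
move=> ct; apply: (is_derive_line0 _ _ _ _).2.
have e : (fun s : R => cmap c (Phi (s *: delta_mx 0 i + t))) =
    fun s => cmap c (flow (V i) s (Phi t)).
  by apply: funext => s; rewrite /Phi flow_actionD flow_action_delta.
rewrite e; have [_ H] := flow_icurve (Vc i) (Phi t) 0.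
by have := H c; rewrite flow0//; exact.
Qed.

Lemma orbit_map_ck t c : cdom c (Phi t) ->
  forall k j, ck k (fun u => cmap c (Phi u) 0 j) t.
Proof.
move=> ct; have nct : \forall u \near t, cdom c (Phi u).
  exact: (near_cont (@orbit_map_continuous t) (near_cdom ct)).
apply: (@ck_bootstrap R n m (fun u => cmap c (Phi u)) (fun i j x => V i c (cinv c x) 0 j)).
- apply: (near_imp nct) => u cu; apply: continuous_comp; first exact: orbit_map_continuous.
  exact: cmap_cont.
- apply: (near_imp nct) => u cu i j; rewrite cmapKE//.
  exact: ((is_derive_rV _ _ _ _).1 (orbit_map_derive i cu) j).
- by move=> i j k; apply: (Vs i).2; exact: cimg_cmap.
Qed.

Definition field_mx c p : 'M[R]_(n, m) := \matrix_(i, j) V i c p 0 j.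

Lemma orbit_map_directional t c v : cdom c (Phi t) ->
  is_derive t v (fun u => cmap c (Phi u)) (v *m field_mx c (Phi t)).
Proof.
move=> ct; apply/is_derive_rV => j.
apply: (is_derive_eq (C1at_is_derive v (ck_C1at (orbit_map_ck ct 1%N j)))).
rewrite mxE; apply: eq_bigr => i _; rewrite mxE; congr (_ * _).
by have [_ ->] := (is_derive_rV _ _ _ _).1 (orbit_map_derive i ct) j.
Qed.

Lemma field_comb_smooth (v : 'rV[R]_n) : smooth_field (fun c p => v *m field_mx c p).
Proof.
split=> [c d p cp dp|c x cx k j].
  rewrite -mulmxA; congr (_ *m _); apply/row_matrixP => i; rewrite row_mul.
  have rowE' e : row i (field_mx e p) = V i e p by apply/rowP => j; rewrite !mxE.
  by rewrite !rowE'; exact: (Vs i).1.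
under eq_fun do rewrite mxE; apply: ck_sum => i; apply: ck_scale.
under eq_fun do rewrite mxE; exact: (Vs i).2.
Qed.

Lemma orbit_line_icurve t v (s : R) :
  icurve_at (fun c p => v *m field_mx c p) (fun s => Phi (s *: v + t)) s.
Proof.
split.
  apply: (@continuous_comp _ _ _ (fun s : R => s *: v + t) Phi).
    apply: (@continuousD _ _ _ (fun s : R => s *: v) (cst t)); last exact: cst_continuous.
    exact: scalel_continuous.
  exact: orbit_map_continuous.
move=> c cs; apply: (is_derive_line (fun u => cmap c (Phi u)) t v s _).1.
exact: orbit_map_directional.
Qed.

Lemma orbit_stabilizer t u : Phi t = Phi u <-> Phi (t - u) = x0.
Proof.
split=> [e|e]; last by rewrite -[t](subrK u) addrC /Phi flow_actionD -/(Phi _) e.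
rewrite addrC /Phi flow_actionD -/(Phi t) e -flow_actionD addNr.
exact: flow_action0.
Qed.

(* If v V(Phi t) = 0 then the orbit is constant along the line t + s v, so v generates a line of
   periods, which is excluded at x0. *)
Lemma orbit_row_free c0 : cdom c0 x0 -> row_free (field_mx c0 x0) ->
  forall t c, cdom c (Phi t) -> row_free (field_mx c (Phi t)).
Proof.
move=> cx0 free0 t c ct; apply: inj_row_free => v v0.
have const s : Phi (s *: v + t) = Phi t.
  have := @icurve_unique _ _ X (fun c p => v *m field_mx c p) (fun s => Phi (s *: v + t))
    (fun=> Phi t) (- (`|s| + 1)) (`|s| + 1) 0 (field_comb_smooth v).
  apply.
  - by move=> u _; exact: orbit_line_icurve.
  - move=> u _; apply: (@icurve_one_chart _ _ _ _ c) => //.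
    + exact: field_comb_smooth.
    + exact: cst_continuous.
    + by rewrite v0; exact: is_derive_cst.
  - by have := normr_ge0 s; move=> ?; apply/andP; split; lra.
  - by rewrite scale0r add0r.
  - by have := ler_norm s; have := ler_norm (- s); rewrite normrN => *; apply/andP; split; lra.
have line s : Phi (s *: v) = x0.
  by have := (orbit_stabilizer _ _).1 (const s); rewrite addrK.
have P0 : Phi 0 = x0 by exact: flow_action0.
have := @orbit_map_directional 0 c0 v; rewrite P0 => /(_ cx0)/is_derive_line0.
have -> : (fun s : R => cmap c0 (Phi (s *: v + 0))) = fun=> cmap c0 x0.
  by apply: funext => s; rewrite addr0 line.
move=> [_ e]; apply/eqP; rewrite -(mulmx_free_eq0 _ free0) -e.
by rewrite derive_cst.
Qed.

End JointFlow.

(** * Local inverses of the orbit map *)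

Section OrbitCharts.
Context {R : realType} {m n : nat} {X : smoothManifold R m}.
Variable V : 'I_n -> chart X -> X -> 'rV[R]_m.
Hypothesis Vs : forall i, smooth_field (V i).
Hypothesis Vc : forall i, complete_field (V i).
Hypothesis VV : forall i j s t x, flow (V i) t (flow (V j) s x) = flow (V j) s (flow (V i) t x).
Variables (H : X -> 'rV[R]_n) (x0 : X).
Let Phi t := flow_action V t x0.
Let dH c p : 'M[R]_(n, m) := \matrix_(i, j) differential (fun q => H q 0 i) c p 0 j.
Hypothesis Hs : forall i, smooth_fun (fun q => H q 0 i).
Hypothesis Hinv : forall t, H (Phi t) = H x0.
Hypothesis Vfree : forall t c, cdom c (Phi t) -> row_free (field_mx V c (Phi t)).
Hypothesis Hker : forall t c, cdom c (Phi t) -> forall z : 'rV[R]_m,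
  z *m (dH c (Phi t))^T = 0 -> (z <= field_mx V c (Phi t))%MS.

Lemma is_derive_mulmxr (W : normedModType R) p q (f : W -> 'rV[R]_p) (L : 'M[R]_(p, q)) x v d :
  is_derive x v f d -> is_derive x v (fun y => f y *m L) (d *m L).
Proof.
move=> fd; have Lc : continuous (mulmxr L : 'rV[R]_p -> 'rV[R]_q) by exact: mulmxr_continuous.
have dL : differentiable (mulmxr L : 'rV[R]_p -> 'rV[R]_q) (f x) by exact: linear_differentiable.
have := is_derive_diff_comp fd dL; rewrite diff_lin//.
Qed.

Lemma ck_mulmxr p q l k (f : 'rV[R]_l -> 'rV[R]_p) (L : 'M[R]_(p, q)) x :
  (forall j, ck k (fun y => f y 0 j) x) -> forall j, ck k (fun y => (f y *m L) 0 j) x.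
Proof.
move=> fk j; apply: (ck_mulmx (A := f) (B := fun=> L)) => [i a|i a].
  by rewrite (ord1 i).
exact: ck_cst.
Qed.

(** The matrix [A] of (dH, L) has trivial kernel: a vector killed by dH is a combination of the V_i,
    from which [L] reads off the coefficients. So |x - y| is at most C times the size of its image
    under [A]; there the part from [L] is 0 and the part from dH is at most eta |x - y| because [H]
    agrees. With eta = 1 / (2 C) this forces x = y. *)
Let level_injective t0 c (L : 'M[R]_(m, n)) : cdom c (Phi t0) ->
  field_mx V c (Phi t0) *m L = 1%:M ->
  exists2 r, 0 < r & forall x y, `|x - cmap c (Phi t0)| < r -> `|y - cmap c (Phi t0)| < r ->
    H (cinv c x) = H (cinv c y) -> x *m L = y *m L -> x = y.
Proof.
move=> cp VL; set p := Phi t0 in cp VL *.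
pose A := row_mx (dH c p)^T L.
have Afree : row_free A.
  apply: inj_row_free => z; rewrite mul_mx_row -[0]row_mx0 => /eq_row_mx[z1 z2].
  have /submxP[a az] := Hker cp z1.
  by rewrite az -mulmxA VL mulmx1 in z2; rewrite az z2 mul0mx.
have [A' AA'] := row_freeP Afree.
have [C C0 CP] := mulmx_norm_le A'.
pose eta := (2 * C)^-1; have eta0 : 0 < eta by rewrite invr_gt0 mulr_gt0.
have [|j|r r0 HP] := @fin_radius R 'I_n (fun j r => forall x y, `|x - cmap c p| < r ->
   `|y - cmap c p| < r -> `|H (cinv c x) 0 j - H (cinv c y) 0 j - \sum_i (x - y) 0 i *
     'D_(delta_mx 0 i) (fun x => H (cinv c x) 0 j) (cmap c p)| <= eta * `|x - y|).
- by move=> j r r' _ rr K x y xr yr; apply: K; exact: lt_le_trans rr.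
- exact: (C1at_strict (smooth_fun_C1at (Hs j) cp) eta0).
exists r => // x y xr yr Hxy Lxy.
have zL : (x - y) *m L = 0 by rewrite mulmxBl Lxy subrr.
have zH : `|(x - y) *m (dH c p)^T| <= eta * `|x - y|.
  apply: rV_norm_le => [|j]; first by rewrite mulr_ge0// ltW.
  have := HP j x y xr yr; rewrite Hxy subrr sub0r normrN mxE; congr (is_true (`|_| <= _)).
  by apply: eq_bigr => i _; rewrite !mxE.
have zA : (x - y) = row_mx ((x - y) *m (dH c p)^T) 0 *m A'.
  by rewrite -[LHS]mulmx1 -AA' mulmxA mul_mx_row zL.
have zn : `|x - y| <= C * (eta * `|x - y|).
  rewrite {1}zA; apply: le_trans (CP _) _; rewrite ler_wpM2l ?(ltW C0)//.
  apply: rV_norm_le => [|k]; first by rewrite mulr_ge0// ltW.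
  case: (split_ordP k) => l ->; last by rewrite row_mxEr mxE normr0 mulr_ge0// ltW.
  by rewrite row_mxEl; apply: le_trans zH; exact: rV_norm_coord.
apply/eqP; rewrite -subr_eq0 -normr_le0; move: zn.
have -> : C * (eta * `|x - y|) = `|x - y| / 2 by rewrite /eta; field; rewrite gt_eqF.
by lra.
Qed.

(** [th] applies a local inverse of [Psi] to the coordinates of [q] compressed by [L], so it is
    defined off the orbit as well. In the second clause the time [t] is arbitrary: [q] and Phi(th q)
    have the same image under [L], and the same value of [H] since both lie on the orbit, so
    [level_injective] identifies them. *)
Lemma orbit_local_inverse t0 : exists (U : set X) (th : X -> 'rV[R]_n),
  [/\ open U /\ U (Phi t0), forall q t, U q -> q = Phi t -> Phi (th q) = q,
      forall q d, U q -> cdom d q -> forall k j, ck k (fun x => th (cinv d x) 0 j) (cmap d q) &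
      \forall t \near t0, th (Phi t) = t].
Proof.
pose c := chart_at (Phi t0); have cp : cdom c (Phi t0) := cdom_chart_at (Phi t0).
have [L VL] := row_freeP (Vfree cp).
have [r r0 inj] := level_injective cp VL.
pose Psi t := cmap c (Phi t) *m L.
have Phic : continuous Phi by exact: orbit_map_continuous.
have nct : \forall t \near t0, cdom c (Phi t) by exact: (near_cont (Phic t0) (near_cdom cp)).
have Psis : \forall t \near t0, forall k j, ck k (fun t => Psi t 0 j) t.
  apply: (near_imp nct) => t ct k; apply: ck_mulmxr => j.
  exact: (orbit_map_ck Vs Vc VV ct).
have Psi1 i j : 'D_(delta_mx 0 i) (fun t => Psi t 0 j) t0 = (i == j)%:R.
  have /is_derive_rV/(_ j)[_ ->] := is_derive_mulmxr L (orbit_map_derive Vs Vc VV i cp).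
  have -> : V i c (Phi t0) = row i (field_mx V c (Phi t0)) by apply/rowP => a; rewrite !mxE.
  by rewrite -row_mul VL !mxE.
have [th [th0 thinv thleft]] := local_inverse Psis Psi1.
pose P q := (cdom c q /\ `|cmap c q - cmap c (Phi t0)| < r) /\
  (Psi (th (cmap c q *m L)) = cmap c q *m L /\
     forall k j, ck k (fun y => th y 0 j) (cmap c q *m L)) /\
  (cdom c (Phi (th (cmap c q *m L))) /\
     `|cmap c (Phi (th (cmap c q *m L))) - cmap c (Phi t0)| < r).
have cL : {for Phi t0, continuous (fun q => cmap c q *m L)}.
  apply: (@continuous_comp _ _ _ (cmap c) (fun x => x *m L)); first exact: cmap_cont.
  exact: mulmxr_continuous.
have pr : `|cmap c (Phi t0) - cmap c (Phi t0)| < r by rewrite subrr normr0.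
have nP : \forall q \near Phi t0, P q.
  have n1 := near_cmap_ball cp pr.
  have n2 : \forall q \near Phi t0, Psi (th (cmap c q *m L)) = cmap c q *m L /\
     forall k j, ck k (fun y => th y 0 j) (cmap c q *m L).
    exact: (near_cont cL thinv).
  have thc : {for Psi t0, continuous th}.
    apply: rV_continuous => j; have [_ K] := nbhs_singleton thinv.
    exact: ck_continuous (K 0%N j).
  have n3 : \forall q \near Phi t0, cdom c (Phi (th (cmap c q *m L))) /\
     `|cmap c (Phi (th (cmap c q *m L))) - cmap c (Phi t0)| < r.
    apply: (near_cont cL (P := fun y => cdom c (Phi (th y)) /\
      `|cmap c (Phi (th y)) - cmap c (Phi t0)| < r)).
    apply: (near_cont thc (P := fun t => cdom c (Phi t) /\
      `|cmap c (Phi t) - cmap c (Phi t0)| < r)).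
    by rewrite th0; apply: (near_cont (Phic t0) n1).
  by apply: (near_and (near_and n1 n2 (fun q A B => conj A B)) n3) => q [A B] D; split.
exists [set q | \forall q' \near q, P q'], (fun q => th (cmap c q *m L)); split.
- by split; [exact: open_interior|exact: nP].
- move=> q t /nbhs_singleton[[cq qr] [[e _] [cq' q'r]]] qE.
  have : cmap c (Phi (th (cmap c q *m L))) = cmap c q.
    by apply: inj => //; rewrite !cmapKE// Hinv qE Hinv.
  by move/(congr1 (cinv c)); rewrite !cmapKE.
- move=> q d /nbhs_singleton[[cq qr] [[_ K] _]] dq k j.
  apply: (@ck_comp R m n k (fun x => cmap c (cinv d x) *m L) (fun y => th y 0 j)).
    by apply: ck_mulmxr => a; exact: transition_ck.
  by rewrite cmapKE.
- exact: thleft.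
Qed.

End OrbitCharts.

(** * Descent of the orbit map to the quotient by the periods *)

Section OrbitDiffeo.
Context {R : realType} {m n p : nat} {X : smoothManifold R m} {N : smoothManifold R p}.
Variables (Phi : 'rV[R]_n -> X) (Lam : set 'rV[R]_n) (pi : 'rV[R]_p -> N).
Variables (A : 'M[R]_(n, p)) (A' : 'M[R]_(p, n)).
Hypothesis Phik : forall t c, cdom c (Phi t) -> forall k j, ck k (fun u => cmap c (Phi u) 0 j) t.
Hypothesis Phic : continuous Phi.
Hypothesis PhiP : forall t u, Phi t = Phi u <-> Lam (t - u).
Hypothesis Phi_inv : forall t0, exists (U : set X) (th : X -> 'rV[R]_n),
  [/\ open U /\ U (Phi t0), forall q t, U q -> q = Phi t -> Phi (th q) = q,
      forall q d, U q -> cdom d q -> forall k j, ck k (fun x => th (cinv d x) 0 j) (cmap d q) &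
      \forall t \near t0, th (Phi t) = t].
Hypothesis piE : forall d u, cimg d u -> cinv d u = pi u.
Hypothesis piP : forall x y, pi x = pi y <-> Lam ((x - y) *m A').
Hypotheses (AA' : A *m A' = 1%:M) (A'A : A' *m A = 1%:M).

Let rho (z : N) := cmap (chart_at z) z.

Let pi_rho z : pi (rho z) = z.
Proof.
have cz := cdom_chart_at z.
by rewrite -(piE (cimg_cmap cz)) cmapKE.
Qed.

Let pi_translate x y z : pi x = pi y -> pi (z + (x - y)) = pi z.
Proof. by move=> /piP e; apply/piP; rewrite addrAC subrr add0r. Qed.

(** In charts [pi] is locally a translation: [x] and [cmap d (pi x)] lie over the same point, and
    translating by their difference does not change [pi]. *)
Let cmap_pi d x : cdom d (pi x) ->
  \forall y \near x, cimg d (y + (cmap d (pi x) - x)) /\ cmap d (pi y) = y + (cmap d (pi x) - x).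
Proof.
move=> dx; set a := cmap d (pi x) - x.
have ux : pi (cmap d (pi x)) = pi x by rewrite -(piE (cimg_cmap dx)) cmapKE.
have ac : {for x, continuous (fun y : 'rV[R]_p => y + a)}.
  by apply: (@continuousD _ _ _ id (cst a)); [exact: cvg_id|exact: cst_continuous].
have n1 : \forall y \near x, cimg d (y + a).
  apply: (near_cont ac (P := cimg d)); rewrite /a addrC subrK.
  exact: near_cimg (cimg_cmap dx).
apply: (near_imp n1) => y ya; split=> //.
by rewrite -(pi_translate y ux) -(piE ya) cinvKE.
Qed.

Let pi_continuous : continuous pi.
Proof.
move=> x; have dx := cdom_chart_at (pi x); set d := chart_at _ in dx.
have n1 := cmap_pi dx; set a := cmap d (pi x) - x in n1.
have ux : pi (cmap d (pi x)) = pi x by rewrite -(piE (cimg_cmap dx)) cmapKE.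
apply: (near_eq_continuous (g := fun y : 'rV[R]_p => cinv d (y + a))).
  by apply: (near_imp n1) => y [cy _]; rewrite (piE cy) pi_translate.
apply: (@continuous_comp _ _ _ (fun y : 'rV[R]_p => y + a) (cinv d)).
  by apply: (@continuousD _ _ _ id (cst a)); [exact: cvg_id|exact: cst_continuous].
by apply: cinv_cont; rewrite /a addrC subrK; exact: cimg_cmap.
Qed.

Let orbit := [set Phi t | t in [set: 'rV[R]_n]].

Let Phi_pi x y : pi x = pi y -> Phi (x *m A') = Phi (y *m A').
Proof. by move=> /piP e; apply/PhiP; rewrite -mulmxBl. Qed.

Let pi_Phi t u : Phi t = Phi u -> pi (t *m A) = pi (u *m A).
Proof. by move=> /PhiP e; apply/piP; rewrite -mulmxBl -mulmxA AA' mulmx1. Qed.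

(** The times [tau] are an arbitrary, possibly discontinuous choice. Near each orbit point the
    smooth extension uses [th] instead; on the orbit [tau] and [th] differ by periods, which [pi]
    does not see after the change of basis [A]. In the other direction the representative [rho] may
    likewise be replaced by any chart. *)
Lemma orbit_diffeomorphic : diffeomorphic orbit [set: N].
Proof.
have /choice[tau tauP] : forall q, exists t, orbit q -> Phi t = q.
  move=> q; have [[t _ tq]|nq] := pselect (orbit q); first by exists t.
  by exists 0.
exists (fun q => pi (tau q *m A)), (fun z => Phi (rho z *m A')); split.
- move=> _ [t0 _ <-]; have [U [th [[oU Ut0] Uinv thk _]]] := Phi_inv t0.
  pose G q := pi (th q *m A).
  have thc q : U q -> {for q, continuous th}.
    move=> Uq; have dq := cdom_chart_at q; set d := chart_at q in dq.
    apply: (near_eq_continuous (g := fun q => th (cinv d (cmap d q)))).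
      by apply: (near_imp (near_cdom dq)) => q' dq'; rewrite cmapKE.
    apply: (@continuous_comp _ _ _ (cmap d) (fun x => th (cinv d x))); first exact: cmap_cont.
    by apply: rV_continuous => j; exact: ck_continuous (thk q d Uq dq 0%N j).
  have Gc q : U q -> {for q, continuous G}.
    move=> Uq; apply: (@continuous_comp _ _ _ (fun q => th q *m A) pi); last exact: pi_continuous.
    by apply: (@continuous_comp _ _ _ th (mulmx^~ A)); [exact: thc|exact: mulmxr_continuous].
  exists U, G; split=> //.
    split=> [q /set_mem Uq|c d i]; first exact: Gc.
    have oUG : open (U `&` G @^-1` cdom d).
      rewrite openE => q [Uq dq].
      have n1 : \forall q' \near q, U q' by apply: open_nbhs_nbhs.
      by apply: (near_and n1 (near_cont (Gc q Uq) (near_cdom dq))) => q' A1 B1; split.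
    apply: (ck_Cinfty (open_chart_preimage (c := c) oUG)) => x [cx [Ux dx]] k.
    have hk j : ck k (fun x => (th (cinv c x) *m A) 0 j) x.
      apply: ck_mulmxr => a; have cd := cdom_cinv cx.
      by have := thk _ c Ux cd k a; rewrite cinvKE.
    have hc : {for x, continuous (fun x => th (cinv c x) *m A)}.
      by apply: rV_continuous => j; exact: ck_continuous (hk j).
    set a := cmap d (pi (th (cinv c x) *m A)) - th (cinv c x) *m A.
    apply: (@ck_near_eq _ _ _ (fun x => (th (cinv c x) *m A) 0 i + a 0 i)).
      apply: (near_imp (near_cont hc (cmap_pi dx))) => y [_ e].
      by rewrite /G e [RHS]mxE.
    by apply: ckD => //; exact: ck_cst.
  move=> q; rewrite inE => -[Oq Uq]; apply: pi_Phi.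
  have tq := tauP q Oq; rewrite tq; apply: esym.
  by apply: (Uinv q (tau q)).
- have g_pi x : Phi (rho (pi x) *m A') = Phi (x *m A') by apply: Phi_pi; rewrite pi_rho.
  have gnear (z : N) d : cdom d z -> \forall z' \near z, Phi (rho z' *m A') = Phi (cmap d z' *m A').
    move=> dz; apply: (near_imp (near_cdom dz)) => z' dz'.
    by rewrite -[in LHS](cmapKE dz') (piE (cimg_cmap dz')) g_pi.
  move=> z _; exists setT, (fun z : N => Phi (rho z *m A')); split=> //; first exact: openT.
  have PAc : continuous (fun x : 'rV[R]_p => Phi (x *m A')).
    by move=> x; apply: (@continuous_comp _ _ _ (fun x : 'rV[R]_p => x *m A') Phi);
      [exact: mulmxr_continuous|exact: Phic].
  have gc : continuous (fun z : N => Phi (rho z *m A')).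
    move=> z'; have dz := cdom_chart_at z'; set d := chart_at z' in dz.
    apply: (near_eq_continuous (g := fun z : N => Phi (cmap d z *m A'))); first exact: gnear.
    by apply: (@continuous_comp _ _ _ (cmap d) (fun x : 'rV[R]_p => Phi (x *m A')));
      [exact: cmap_cont|exact: PAc].
  split=> [z' _|d c i]; first exact: gc.
  have oG : open ([set: N] `&` (fun z : N => Phi (rho z *m A')) @^-1` cdom c).
    rewrite setTI; apply: open_comp; last exact: cdom_open.
    by move=> z' _; exact: gc.
  apply: (ck_Cinfty (open_chart_preimage (c := d) oG)) => x [dx [_ cx]] k.
  have E y : cimg d y -> Phi (rho (cinv d y) *m A') = Phi (y *m A').
    by move=> dy; rewrite (piE dy) g_pi.
  apply: (@ck_near_eq _ _ _ (fun y : 'rV[R]_p => cmap c (Phi (y *m A')) 0 i)).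
    by apply: (near_imp (near_cimg dx)) => y dy; rewrite E.
  apply: (@ck_comp R p n k (fun y : 'rV[R]_p => y *m A') (fun u => cmap c (Phi u) 0 i)).
    by apply: (ck_mulmxr (f := id)) => j; exact: ck_coord.
  by apply: Phik; rewrite -(E x dx).
- move=> q Oq; split=> //; rewrite -[RHS](tauP q Oq).
  rewrite -[tau q in RHS]mulmx1 -AA' mulmxA; apply: Phi_pi.
  by rewrite pi_rho.
- move=> z _; split; first by exists (rho z *m A').
  rewrite -[RHS]pi_rho -[rho z in RHS]mulmx1 -A'A mulmxA; apply: pi_Phi.
  by apply: tauP; exists (rho z *m A').
Qed.

End OrbitDiffeo.

(** * Orbits of integrable systems *)

Section IntegrableSystems.
Context {R : realType} {n : nat} {X : smoothManifold R (2 * n)}.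
Variables (w : symplectic_form X) (H : X -> 'rV[R]_n).
Hypothesis IS : integrable_system w H.

Let h i (p : X) : R := H p 0 i.
Let V i := hamiltonian_field w (h i).
Let dH c p : 'M[R]_(n, 2 * n) := \matrix_(i, j) differential (h i) c p 0 j.

Lemma components_smooth i : smooth_fun (fun p => H p 0 i).
Proof.
move=> c x cx k; have [_ Hsm] := integrable_smooth IS.
have oT : open ([set: X] `&` H @^-1` cdom (tt : chart (euclidean R n))).
  by rewrite (_ : _ `&` _ = setT); [exact: openT|rewrite setTI].
exact: (Cinfty_ck (open_chart_preimage (c := c) oT) (Hsm c tt i)).
Qed.

Let hs i : smooth_fun (h i) := components_smooth i.

Let Vs i : smooth_field (V i).
Proof. exact: hamiltonian_smooth_field. Qed.

Let conserved i g e : (forall t, `|t| < e -> icurve_at (V i) g t) ->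
  forall t, `|t| < e -> H (g t) = H (g 0).
Proof.
move=> gP t te; apply/rowP => j.
exact: (hamiltonian_conserved (hs i) (hs j) (integrable_involution IS i j) gP te).
Qed.

Let level_compact q : compact (H @^-1` [set H q]).
Proof. by apply: (integrable_proper IS); exact: compact_set1. Qed.

Let Vc i : complete_field (V i).
Proof.
move=> q; apply: (@complete_of_compact _ _ _ (V i) (H @^-1` [set H q])) => //.
by move=> g e gP /= g0 t te; rewrite -g0; exact: conserved gP t te.
Qed.

Let level_flow i t q : H (flow (V i) t q) = H q.
Proof.
have te : `|t| < `|t| + 1 by rewrite ltrDl.
have := conserved (fun s _ => flow_icurve (Vc i) q s) te.
by rewrite flow0.
Qed.

Let VV i j s t x : flow (V i) t (flow (V j) s x) = flow (V j) s (flow (V i) t x).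
Proof.
have comm := hamiltonian_commuting (hs i) (hs j) (integrable_involution IS i j).
have stable l u q : H q = H x -> H (flow (V l) u q) = H x.
  by move=> <-; exact: level_flow.
exact: (flows_commute (Vs i) (Vs j) (Vc i) (Vc j) comm (@level_compact x) (stable i) (stable j)).
Qed.

Let level_orbit t x : H (flow_action V t x) = H x.
Proof.
rewrite /flow_action /flow_along; elim: (enum _) => //= i l <-.
exact: level_flow.
Qed.

Let field_omega c p : cdom c p -> field_mx V c p *m w c p = - dH c p.
Proof.
move=> cp; apply/row_matrixP => i; rewrite row_mul.
have -> : row i (field_mx V c p) = V i c p by apply/rowP => j; rewrite !mxE.
rewrite hamiltonian_fieldE//; apply/rowP => j; by rewrite !mxE.
Qed.

Let field_dH c p : cdom c p -> field_mx V c p *m (dH c p)^T = 0.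
Proof.
move=> cp; apply/matrixP => i j; rewrite mxE [RHS]mxE.
have := hamiltonian_derivative w (h i) (h j) cp.
rewrite (poisson_chart w (hs i) (hs j) cp) [poisson _ _ _ _](integrable_involution IS i j) => e.
rewrite -[RHS]e; apply: eq_bigr => a _.
by rewrite [field_mx _ _ _ _ _]mxE [_^T _ _]mxE [dH _ _ _ _]mxE.
Qed.

(** A dimension count: involution puts the span of the V_i inside the kernel of dH, and both have
    dimension n = 2n - n. The span is thus Lagrangian. *)
Let kernel_sub c p (z : 'rV[R]_(2 * n)) : cdom c p -> row_free (field_mx V c p) ->
  z *m (dH c p)^T = 0 -> (z <= field_mx V c p)%MS.
Proof.
move=> cp free zH; have wu := omega_nondegenerate w cp.
have rH : \rank (dH c p)^T = n.
  have dHE : dH c p = - field_mx V c p *m w c p by rewrite mulNmx field_omega// opprK.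
  by rewrite mxrank_tr dHE mxrankMfree ?row_free_unit// mxrank_opp; apply/eqP.
have sub : (field_mx V c p <= kermx (dH c p)^T)%MS by rewrite sub_kermx field_dH.
apply: submx_trans (_ : z <= kermx (dH c p)^T)%MS _; first by rewrite sub_kermx zH.
rewrite -(mxrank_leqif_sup sub).2 mxrank_ker rH (eqP free).
by rewrite mul2n -addnn addnK.
Qed.

(** Differentiating H o s = id shows that dH at [s b] is surjective, with right inverse built from
    the Jacobian [S] of the section; since the fields satisfy V omega = - dH, a right inverse of
    their matrix follows. *)
Lemma section_row_free B s b c : local_section H B s -> B b -> cdom c (s b) ->
  row_free (field_mx V c (s b)).
Proof.
move=> [oB _ [sc ss] sid] Bb cb.
have oU : open ([set: 'rV[R]_n] `&` (id : 'rV[R]_n -> 'rV[R]_n) @^-1` (B `&` s @^-1` cdom c)).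
  rewrite openE => y [_ [By cy]].
  have n1 : \forall z \near y, B z by apply: open_nbhs_nbhs.
  have sy : {for y, continuous s} by apply: sc; exact: mem_set.
  by apply: (near_and n1 (near_cont sy (near_cdom cy))) => z A1 B1; split.
pose hh (y : 'rV[R]_n) := cmap c (s y).
have hk j k : ck k (fun y => hh y 0 j) b.
  exact: (Cinfty_ck oU (ss (tt : chart (euclidean R n)) c j)).
have hd i : is_derive b (delta_mx 0 i) hh (\row_j 'D_(delta_mx 0 i) (fun y => hh y 0 j) b).
  apply/is_derive_rV => j; rewrite mxE; apply: derivableP.
  by apply: diff_derivable; apply: C1at_differentiable; exact: (ck_C1at (hk j 1%N)).
pose S : 'M[R]_(n, 2 * n) := \matrix_(i, j) 'D_(delta_mx 0 i) (fun y => hh y 0 j) b.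
have SM : S *m (dH c (s b))^T = 1%:M.
  apply/matrixP => i j; rewrite mxE.
  have [_ e] := C1at_chain (hd i) (smooth_fun_C1at (hs j) cb).
  have e' : 'D_(delta_mx 0 i) ((fun y => h j (cinv c y)) \o hh) b =
      'D_(delta_mx 0 i) (fun y : 'rV[R]_n => y 0 j) b.
    apply: near_eq_derive.
    have Ub : nbhs b ([set: 'rV[R]_n] `&` id @^-1` (B `&` s @^-1` cdom c)).
      by apply: open_nbhs_nbhs; split.
    by apply: (near_imp Ub) => y [_ [By cy]]; rewrite /= /hh cmapKE// /h sid//; exact: mem_set.
  have [_ e''] := is_derive_coord b (delta_mx 0 i) j.
  transitivity ((delta_mx 0 i : 'rV[R]_n) 0 j); last by rewrite !mxE eqxx eq_sym.
  rewrite -e'' -e' e; apply: eq_bigr => a _.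
  by rewrite [S _ _]mxE [_^T _ _]mxE [dH _ _ _ _]mxE [differential _ _ _ _ _]mxE mxE.
have MS : dH c (s b) *m S^T = 1%:M by rewrite -[LHS]trmxK trmx_mul trmxK SM trmx1.
apply/row_freeP; exists (w c (s b) *m - S^T).
by rewrite mulmxA field_omega// mulmxN mulNmx opprK.
Qed.

Section Orbit.
Variable x0 : X.
Hypothesis free0 : forall c, cdom c x0 -> row_free (field_mx V c x0).
Let Phi t := flow_action V t x0.
Let Lam := [set t | Phi t = x0].

Let free t c : cdom c (Phi t) -> row_free (field_mx V c (Phi t)).
Proof.
have cx := cdom_chart_at x0.
by move=> ct; exact: (orbit_row_free Vs Vc VV cx (free0 cx)).
Qed.

Let orbit_inverse := @orbit_local_inverse _ _ _ _ V Vs Vc VV H x0 hs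
  (fun t => level_orbit t x0) free (fun t c ct z => kernel_sub ct (free ct)).

Lemma period_subgroup : is_subgroup Lam /\ is_discrete Lam.
Proof.
have P0 : Phi 0 = x0 by exact: flow_action0.
split; first split=> //.
  move=> t u Lt Lu; apply/(orbit_stabilizer Vs Vc VV).
  by rewrite -[flow_action _ _ _]/(Phi t) Lt -[flow_action _ _ _]/(Phi u) Lu.
have [U [th [_ _ _ /(ball_normP (0 : 'rV[R]_n) _).1[r r0 rP]]]] := orbit_inverse 0.
exists r => // t Lt tr.
have := rP t; rewrite subr0 => /(_ tr); have := rP 0; rewrite subrr normr0 => /(_ r0).
by rewrite -/(Phi t) -/(Phi 0) P0 Lt => -> ->.
Qed.

Lemma orbit_diffeomorphic_cover p (N : smoothManifold R p) (pi : 'rV[R]_p -> N)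
    (A : 'M[R]_(n, p)) (A' : 'M[R]_(p, n)) :
  (forall d u, cimg d u -> cinv d u = pi u) ->
  (forall x y, pi x = pi y <-> Lam ((x - y) *m A')) ->
  A *m A' = 1%:M -> A' *m A = 1%:M ->
  diffeomorphic (flow_orbit w H x0) [set: N].
Proof.
move=> piE piP AA' A'A.
apply: (@orbit_diffeomorphic _ _ _ _ _ _ Phi Lam pi A A') => //.
- by move=> t c ct; exact: (orbit_map_ck Vs Vc VV ct).
- exact: (orbit_map_continuous Vs Vc VV).
- by move=> t u; exact: (orbit_stabilizer Vs Vc VV).
Qed.

End Orbit.
End IntegrableSystems.

(** * Compact orbits and the shape of the orbits *)

Lemma smooth_on_continuous (R : realType) (m p : nat) (M : smoothManifold R m)
    (N : smoothManifold R p) (A : set M) (f : M -> N) :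
  smooth_on A f -> {within A, continuous f}.
Proof.
move=> fs; apply/subspace_continuousP => x Ax.
have [U [g [oU Ux [gc _] fg]]] := fs x Ax.
have fgx : f x = g x by apply: fg; rewrite inE.
have gx : {for x, continuous g} by apply: gc; exact: mem_set.
move=> W fW; have gW : nbhs (g x) W by rewrite -fgx.
have n1 : \forall y \near x, U y by apply: open_nbhs_nbhs.
apply: (near_and n1 (near_cont gx gW)) => y Uy Wy Ay.
have e : f y = g y by apply: fg; rewrite inE.
by have := Wy; rewrite -e.
Qed.

(** If l > 0, the first coordinate of the Euclidean factor has a maximum on the compact set [A], but
    by surjectivity some point of [A] has this coordinate larger by 1. *)
Lemma compact_diffeomorphic_line_free (R : realType) (m k l : nat) (X : smoothManifold R m)
    (M : smoothManifold R k) (A : set X) :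
  compact A -> diffeomorphic A [set: prod_manifold M (euclidean R l)] -> A !=set0 -> l = 0%N.
Proof.
case: l => // l cA [f [g [fs gs fg gf]]] A0.
have hc : {within A, continuous (fun q => (f q).2 0 0 : R)}.
  have fc := smooth_on_continuous fs.
  move=> q; apply: (@continuous_comp _ _ _ (f : subspace A -> _)
    (fun z : M * 'rV[R]_l.+1 => z.2 0 0)); first exact: fc.
  apply: (@continuous_comp _ _ _ snd (fun x : 'rV[R]_l.+1 => x 0 0)); first exact: cvg_snd.
  exact: coord_continuous.
have [c /set_mem Ac cmax] := compact_EVT_max A0 cA hc.
pose z : prod_manifold M (euclidean R l.+1) := ((f c).1, const_mx ((f c).2 0 0 + 1)).
have [Az ez] := gf z I.
have := cmax (g z) (mem_set Az); rewrite ez /z /= mxE.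
by rewrite gerDl ler10.
Qed.

(* k + (n - k) is not convertible to n, so the basis matrix must be cast. *)
Lemma lattice_basis_cast (R : realType) (n p k : nat) (A0 : 'M[R]_n) : p = n ->
  A0 \in unitmx -> exists (A : 'M[R]_(n, p)) (A' : 'M[R]_(p, n)),
  [/\ A *m A' = 1%:M, A' *m A = 1%:M &
      forall x : 'rV[R]_p, lattice_coord k (x *m A' *m A0) <-> lattice_coord k x].
Proof.
move=> e A0u; subst p; exists A0, (invmx A0); split; [exact: mulmxV|exact: mulVmx|].
by move=> x; rewrite mulmxKV.
Qed.

Lemma lattice_coord_split (R : realType) (k l : nat) (x y : 'rV[R]_(k + l)) :
  lattice_coord k (x - y) <-> lattice_eqv (lsubmx x) (lsubmx y) /\ rsubmx x = rsubmx y.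
Proof.
split=> [H|[/lattice_eqvP H1 H2] i].
  split.
    apply/lattice_eqvP => i; have := H (lshift l i); rewrite /= ltn_ord !mxE.
    by [].
  apply/rowP => i; have := H (rshift k i); rewrite /= ltnNge leq_addr/= !mxE subr_eq0.
  by move/eqP.
case: (split_ordP i) => j ->.
  by have := H1 j; rewrite !mxE.
rewrite !mxE subr_eq0; have /rowP/(_ j) := H2.
by rewrite !mxE => ->.
Qed.

Theorem theorem1p40 (R : realType) (n : nat)
    (X : smoothManifold R (2 * n)) (w : symplectic_form X)
    (H : X -> 'rV[R]_n) (B : set 'rV[R]_n) (s : 'rV[R]_n -> X) :
  integrable_system w H -> local_section H B s ->
  forall b : 'rV[R]_n, B b ->
    (exists2 k : nat, (k <= n)%N &
       diffeomorphic (flow_orbit w H (s b))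
         [set: prod_manifold (torus R k) (euclidean R (n - k))]) /\
    (compact (flow_orbit w H (s b)) ->
       diffeomorphic (flow_orbit w H (s b)) [set: torus R n]).
Proof.
move=> IS LS b Bb.
have free0 c : cdom c (s b) ->
    row_free (field_mx (fun i => hamiltonian_field w (fun p => H p 0 i)) c (s b)).
  exact: (section_row_free IS LS Bb).
have [Ls Ld] := period_subgroup IS free0.
have [k kn [A0 A0u LE]] := discrete_subgroup Ls Ld.
have prod_diffeo : diffeomorphic (flow_orbit w H (s b))
    [set: prod_manifold (torus R k) (euclidean R (n - k))].
  have [A [A' [AA' A'A LA]]] := lattice_basis_cast k (subnKC kn) A0u.
  apply: (orbit_diffeomorphic_cover IS free0 (N := prod_manifold (torus R k) (euclidean R (n - k)))
    (pi := fun x => (torus_pi (lsubmx x), rsubmx x)) (A := A) (A' := A')) => //.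
  move=> x y; rewrite LE LA lattice_coord_split.
  by split=> [[/torus_piP e1 e2]|[/torus_piP e1 e2]]; [split|rewrite e1 e2].
split; first by exists k.
move=> cO.
have O0 : flow_orbit w H (s b) !=set0 by exists (joint_flow w H 0 (s b)); exists 0.
have /eqP := compact_diffeomorphic_line_free cO prod_diffeo O0.
rewrite subn_eq0 => nk; have {}kn : k = n by apply/eqP; rewrite eqn_leq kn.
(* For k = n the torus itself is taken as the target rather than its product with R^0, with
   [torus_pi] as the covering map. *)
apply: (orbit_diffeomorphic_cover IS free0 (N := torus R n) (pi := torus_pi)
  (A := A0) (A' := invmx A0)); [by []| |exact: mulmxV|exact: mulVmx].
move=> x y; rewrite LE mulmxKV// torus_piP kn.
split=> [/lattice_eqvP H1 i|H1]; first by rewrite ltn_ord; have := H1 i; rewrite !mxE.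
by apply/lattice_eqvP => i; have := H1 i; rewrite ltn_ord !mxE.
Qed.
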